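(* The space $\hat\Upsilon^{\rm q}$ of canonical representatives of cosymmetries of the system (S) is spanned by cosymmetries from three families: 1. $e^{r^1-r^2}\big(\Omega,\,-\Omega,\,(\hat{\mathscr A}\Omega)/\omega^1\big)$ with the operator $\hat{\mathscr A}=\sum_{\kappa=0}^\infty\omega^{\kappa+1}\partial_{\omega^\kappa}$ and with $\Omega$ running through the space of smooth functions of a finite, but unspecified number of $\omega^\kappa$, $\kappa\in\mathbb N_0$. 2. $e^{(r^1-r^2)/2}\big(-2\Phi_{r^1},\,\Phi,\,0\big)$, where the parameter function $\Phi=\Phi(r^1,r^2)$ runs through the solution space of the Klein--Gordon equation $\Phi_{r^1r^2}=-\Phi/4$. 3. $e^{(r^1-r^2)/2}\big(-\tilde{\mathscr D}_y\tilde{\mathfrak Q}\tilde q,\,\tilde{\mathfrak Q}\tilde q,\,0\big)$, where the operator $\tilde{\mathfrak Q}$ runs through the set $\{\tilde{\mathscr J}^\kappa,\ \tilde{\mathscr J}^\kappa\tilde{\mathscr D}_y^\iota,\ \tilde{\mathscr J}^\kappa\tilde{\mathscr D}_z^\iota,\ \kappa\in\mathbb N_0,\ \iota\in\mathbb N\}$.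
   Context: System (S), for unknown functions $r^1,r^2,r^3$ of $(t,x)$: $r^1_t+V^1r^1_x=0$, $r^2_t+V^2r^2_x=0$, $r^3_t+V^3r^3_x=0$, where $V^1=r^1+r^2+1$, $V^2=r^1+r^2-1$, $V^3=r^1+r^2$. $r^i_\kappa$ denotes the jet variable corresponding to $\partial^\kappa r^i/\partial x^\kappa$ (so $r^i_0=r^i$, $r^i_1=r^i_x$). A differential function $f=f[r]$ is a smooth function of $t$, $x$ and finitely many $r^i_\kappa$; derivatives involving differentiation in $t$ are always eliminated using (S). On such functions $$\mathscr D_x=\partial_x+\sum_{\kappa\ge0}\sum_{i=1}^3 r^i_{\kappa+1}\partial_{r^i_\kappa},\qquad \mathscr D_t=\partial_t-\sum_{\kappa\ge0}\sum_{i=1}^3\mathscr D_x^\kappa(V^ir^i_1)\,\partial_{r^i_\kappa}.$$ $\omega^\kappa:=(e^{r^2-r^1}\mathscr D_x)^\kappa r^3$; in particular $\omega^0=r^3$, $\omega^1=e^{r^2-r^1}r^3_x$. $$\tilde{\mathscr D}_y:=-\frac1{r^1_x}(\mathscr D_t+V^2\mathscr D_x),\quad \tilde{\mathscr D}_z:=-\frac1{r^2_x}(\mathscr D_t+V^1\mathscr D_x),\quad \tilde{\mathscr J}:=\frac{r^1}2\tilde{\mathscr D}_y+\frac{r^2}2\tilde{\mathscr D}_z,\quad \tilde q:=e^{(r^1-r^2)/2}\big(x-(r^1+r^2+1)t\big).$$ Differential functions are considered where the occurring denominators do not vanish. $\mathbb N=\{1,2,\dots\}$, $\mathbb N_0=\mathbb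 N\cup\{0\}$. $\hat\Upsilon^{\rm q}$ is the space of reduced cosymmetries, i.e. tuples $(\lambda^1[r],\lambda^2[r],\lambda^3[r])$ of differential functions satisfying the system adjoint to the linearization of (S): $$\mathscr D_t\lambda^1+V^1\mathscr D_x\lambda^1=r^2_x(\lambda^2-\lambda^1)+r^3_x\lambda^3,\quad \mathscr D_t\lambda^2+V^2\mathscr D_x\lambda^2=r^1_x(\lambda^1-\lambda^2)+r^3_x\lambda^3,\quad \mathscr D_t\lambda^3+V^3\mathscr D_x\lambda^3+(r^1_x+r^2_x)\lambda^3=0.$$ It represents the quotient of the space of all cosymmetries of (S) by the trivial ones (those vanishing on solutions of (S)). *)

(* Defs.v *)
From HB Require Import structures.
From mathcomp Require Import all_boot all_order all_algebra.
From mathcomp Require Import all_classical all_reals all_analysis.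
Import Order.TTheory GRing.Theory Num.Theory.
Import numFieldNormedType.Exports.

Set Implicit Arguments.
Unset Strict Implicit.
Unset Printing Implicit Defensive.

Local Open Scope classical_set_scope.
Local Open Scope ring_scope.

(* Functions of (possibly infinitely many) real variables indexed by [I] are
   functions on [{ptws I -> R}], i.e. on I -> R with the product topology, whose
   neighborhoods constrain finitely many coordinates.  Functions are total, but
   only their germs at a point are used: all values outside a neighborhood of
   the base point are irrelevant. *)
Section FinitelyManyVariables.
Context {R : realType} {I : eqType}.
Implicit Types (f : {ptws I -> R} -> R) (p z : {ptws I -> R}).

Definition line f z (i : I) : R -> R := fun s => f (dfwith z i s).

Definition pd (i : I) f : {ptws I -> R} -> R :=
  fun z => derive1 (line f z i) (z i).

Definition finitely_dependent_near p f : Prop :=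
  exists (s : seq I) (U : set {ptws I -> R}), nbhs p U /\
    forall z z', U z -> U z' -> (forall i, i \in s -> z i = z' i) ->
      f z = f z'.

Definition smooth_near p f : Prop :=
  finitely_dependent_near p f /\
  \forall z \near p, forall s : seq I,
    {for z, continuous (foldr pd f s)} /\
    forall i, derivable (line (foldr pd f s) z i) (z i) 1.

End FinitelyManyVariables.

(* Coordinates on the jet space: t, x and r^i_k. *)
Inductive jetvar := Jt | Jx | Jr of 'I_3 & nat.
HB.instance Definition _ := gen_eqMixin jetvar.

Definition i1 : 'I_3 := @Ordinal 3 0 isT.
Definition i2 : 'I_3 := @Ordinal 3 1 isT.
Definition i3 : 'I_3 := @Ordinal 3 2 isT.

Section Cosymmetries.
Context {R : realType}.

Local Notation jet := {ptws jetvar -> R}.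

Definition r (i : 'I_3) (k : nat) : jet -> R := fun j => j (Jr i k).

Definition V (i : 'I_3) : jet -> R :=
  fun j => r i1 0 j + r i2 0 j + tnth [tuple 1; -1; 0] i.

(* For a differential function the sums over k have finite support. *)
Definition Dx (f : jet -> R) : jet -> R := fun j =>
  pd Jx f j +
  \sum_(k \in [set: nat]) \sum_(i < 3) r i k.+1 j * pd (Jr i k) f j.

Definition Dt (f : jet -> R) : jet -> R := fun j =>
  pd Jt f j -
  \sum_(k \in [set: nat]) \sum_(i < 3)
    iter k Dx (fun j' => V i j' * r i 1 j') j * pd (Jr i k) f j.

Definition omega (k : nat) : jet -> R :=
  iter k (fun f j => expR (r i2 0 j - r i1 0 j) * Dx f j) (r i3 0).

Definition omegas (j : jet) : {ptws nat -> R} := fun k => omega k j.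

Definition Dy (f : jet -> R) : jet -> R := fun j =>
  - (r i1 1 j)^-1 * (Dt f j + V i2 j * Dx f j).

Definition Dz (f : jet -> R) : jet -> R := fun j =>
  - (r i2 1 j)^-1 * (Dt f j + V i1 j * Dx f j).

Definition Jop (f : jet -> R) : jet -> R := fun j =>
  r i1 0 j / 2 * Dy f j + r i2 0 j / 2 * Dz f j.

Definition qt : jet -> R := fun j =>
  expR ((r i1 0 j - r i2 0 j) / 2) *
  (j Jx - (r i1 0 j + r i2 0 j + 1) * j Jt).

Definition regular (p : jet) : Prop :=
  [/\ r i1 1 p != 0, r i2 1 p != 0 & omega 1 p != 0].

Definition triple (a b c : jet -> R) : 'I_3 -> jet -> R :=
  tnth [tuple a; b; c].

(* Differential functions are local objects: the space of reduced cosymmetries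
   is described by its germs at each [regular] point [p].  (On a fixed domain
   that is disconnected, such as the set of all regular points, coefficients of a
   decomposition would only be locally constant.) *)
Definition reduced_cosymmetry (p : jet) (lam : 'I_3 -> jet -> R) : Prop :=
  (forall i, smooth_near p (lam i)) /\
  \forall j \near p,
    [/\ Dt (lam i1) j + V i1 j * Dx (lam i1) j =
          r i2 1 j * (lam i2 j - lam i1 j) + r i3 1 j * lam i3 j,
        Dt (lam i2) j + V i2 j * Dx (lam i2) j =
          r i1 1 j * (lam i1 j - lam i2 j) + r i3 1 j * lam i3 j &
        Dt (lam i3) j + V i3 j * Dx (lam i3) j +
          (r i1 1 j + r i2 1 j) * lam i3 j = 0].

Definition Aop (Om : {ptws nat -> R} -> R) : {ptws nat -> R} -> R := fun w =>
  \sum_(k \in [set: nat]) w k.+1 * pd k Om w.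

Definition family1 (p : jet) (lam : 'I_3 -> jet -> R) : Prop :=
  exists Om : {ptws nat -> R} -> R, smooth_near (omegas p) Om /\
    let E j := expR (r i1 0 j - r i2 0 j) in
    lam = triple (fun j => E j * Om (omegas j))
                 (fun j => E j * - Om (omegas j))
                 (fun j => E j * (Aop Om (omegas j) / omega 1 j)).

Definition r12 (j : jet) : {ptws 'I_2 -> R} :=
  fun i => tnth [tuple r i1 0 j; r i2 0 j] i.

Definition family2 (p : jet) (lam : 'I_3 -> jet -> R) : Prop :=
  exists Phi : {ptws 'I_2 -> R} -> R,
    let d1 := @pd R 'I_2 ord0 in
    let d2 := @pd R 'I_2 ord_max in
    [/\ smooth_near (r12 p) Phi,
        \forall z \near r12 p, d2 (d1 Phi) z = - Phi z / 4 &
        let E j := expR ((r i1 0 j - r i2 0 j) / 2) in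
        lam = triple (fun j => E j * (- 2 * d1 Phi (r12 j)))
                     (fun j => E j * Phi (r12 j))
                     (fun=> 0)].

Variant Qop : ((jet -> R) -> jet -> R) -> Prop :=
| Qop_J (k : nat) : Qop (iter k Jop)
| Qop_Jy (k l : nat) of (0 < l)%N : Qop (fun f => iter k Jop (iter l Dy f))
| Qop_Jz (k l : nat) of (0 < l)%N : Qop (fun f => iter k Jop (iter l Dz f)).

Definition family3 (lam : 'I_3 -> jet -> R) : Prop :=
  exists Q, Qop Q /\
    let E j := expR ((r i1 0 j - r i2 0 j) / 2) in
    lam = triple (fun j => E j * - Dy (Q qt) j)
                 (fun j => E j * Q qt j)
                 (fun=> 0).

(* Equality near [p] with a linear combination, with constant real
   coefficients, of finitely many elements of [F]. *)
Definition span_near (p : jet) (F : ('I_3 -> jet -> R) -> Prop)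
    (lam : 'I_3 -> jet -> R) : Prop :=
  exists (n : nat) (c : 'I_n -> R) (mu : 'I_n -> 'I_3 -> jet -> R),
    (forall l, F (mu l)) /\
    \forall j \near p, forall i, lam i j = \sum_(l < n) c l * mu l i j.

End Cosymmetries.

(* Main.v *)
(* On jets with r1_x, r2_x nonzero, the operators D_y and D_z commute, act on
   y = r1/2 and z = -r2/2 as the coordinate derivations, and q = qt satisfies
   D_y D_z q = q.  Hence y, z, the q_k = D_y^k q (D_z^(-k) q for k < 0) and the
   omega^k form a coordinate system on jets ([Phi], with inverse [Psi]) in which
   D_y and D_z become vector fields with explicit coefficients.

   Writing a cosymmetry as (E a, E b, E^2 h) with E = e^(y+z), the system turns
   into D_z a + b = E T g, D_y b + a = E S g, S D_z h + T D_y h = 0, where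
   g = omega^1 h, S = -E^2/r1_x and T = -E^2/r2_x.  All functions depend on
   finitely many coordinates, so differentiating with respect to the extreme q_k
   and descending shows that h depends on the omega^k only; descending in the
   omega^k shows that E F, -E F, for some function F of the omega^k, accounts
   for the dependence of a, b on them, and g = A F + x with x constant.
   The remaining a, b are affine in the q_k with coefficients depending on y, z.
   Comparing the coefficients, modulo multiples of E^2, with the expansion of a
   rational symbol at infinity forces x = 0.  Finally D_z D_y b = b makes the top
   coefficient of b a polynomial in y alone, so that b is reduced to a function of
   y and z by subtracting linear combinations of J^k q_m. *)
Require Import Defs.
From HB Require Import structures.
From mathcomp Require Import all_boot all_order all_algebra.
From mathcomp Require Import all_classical all_reals all_analysis.
From mathcomp Require Import ring lra zify.
Import Order.TTheory GRing.Theory Num.Theory.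
Import numFieldNormedType.Exports.
Set Implicit Arguments.
Unset Strict Implicit.
Unset Printing Implicit Defensive.
Local Open Scope classical_set_scope.
Local Open Scope ring_scope.

(** * Smooth functions of finitely many of infinitely many variables *)

Section Boxes.
Context {R : realType} {I : eqType}.
Implicit Types (p z w : {ptws I -> R}) (U : set {ptws I -> R}) (s : seq I).

(** The weights E, E, E^2 are chosen to remove all undifferentiated terms of the system except the
    coupling of a with b. S and T themselves involve q_(-2), ..., q_1, so the descent for h stalls
    at q_0 and q_(-1); these two derivatives are eliminated by playing the remaining equations
    against each other. The constant x cannot be absorbed into F: A raises the order, so A F = 1 has
    no solution among functions of finitely many omega^k. It has to be excluded by the part of a, b
    affine in the q_k, where a nonzero x would force a symbol with a pole at lambda = -1, that is, a
    series in the q_k that never terminates. The work takes place on one box around the image of the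
    base point. It restricts finitely many coordinates, is convex along each of them, so that a
    vanishing derivative means independence, and is stable under freezing coordinates at its centre,
    which replaces integration by restriction to a slice. *)

Definition box p s (e : R) : set {ptws I -> R} :=
  [set z | forall i, i \in s -> `|z i - p i| < e].

(** The sets containing a box around [p] form a filter. Convergence in a product topology is tested
    on each coordinate, where boxes with one constraint suffice, so this filter converges to [p]. *)
Lemma nbhs_box p U : nbhs p U ->
  exists s, exists2 e : R, 0 < e & box p s e `<=` U.
Proof.
pose F : set_system {ptws I -> R} :=
  [set U | exists s, exists2 e : R, 0 < e & box p s e `<=` U].
have FF : Filter F.
  split.
  - by exists [::], 1.
  - move=> A B [s [e e0 sA]] [s' [e' e0' sB]].
    exists (s ++ s'), (Num.min e e'); first by rewrite lt_min e0.
    move=> z zb; split; [apply: sA|apply: sB] => i is_; have := zb i.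
      by rewrite mem_cat is_ lt_min => /(_ isT) /andP[].
    by rewrite mem_cat is_ orbT lt_min => /(_ isT) /andP[].
  - move=> A B AB [s [e e0 sA]]; exists s, e => //; exact: subset_trans AB.
suff : F --> p by exact.
apply/cvg_sup => i V [W [[A oA AW] /= Wp] WV].
have : nbhs (p i) A.
  by apply: open_nbhs_nbhs; split=> //; rewrite -AW in Wp.
move/nbhs_ballP => [e /= e0 eA].
exists [:: i], e => // z zb; apply: WV; rewrite -AW; apply: eA.
rewrite /ball /= distrC; apply: zb; exact: mem_head.
Qed.

Lemma continuous_coord (i : I) : continuous (fun z : {ptws I -> R} => z i).
Proof. exact: (@proj_continuous I (fun=> R) i). Qed.

Lemma line_continuous z (i : I) :
  continuous (fun t : R => dfwith z i t : {ptws I -> R}).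
Proof. exact: (@dfwith_continuous I (fun=> R) z i). Qed.

Lemma open_box p s e : open (box p s e).
Proof.
rewrite openE => z zb; rewrite /interior.
suff : \forall w \near z, forall i, i \in s -> `|w i - p i| < e by [].
elim: s zb => [_|i s IHs zb]; first by near=> w => i; rewrite in_nil.
have zs : box p s e z by move=> j js; apply: zb; rewrite inE js orbT.
have zi : nbhs z [set w | `|w i - p i| < e].
  suff : nbhs (z i) [set t | `|t - p i| < e] by exact: continuous_coord.
  have zpe : `|z i - p i| < e by apply: zb; exact: mem_head.
  apply/nbhs_ballP; exists (e - `|z i - p i|); first by rewrite /= subr_gt0.
  move=> t; rewrite /ball /= => tz; rewrite -(subrKA (z i)) addrC.
  by apply: le_lt_trans (ler_normD _ _) _; rewrite (distrC t) -ltrBrDl.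
by near=> w => j; rewrite inE => /predU1P[->|js]; [near: w|
  move: j js; near: w; exact: IHs].
Unshelve. all: by end_near. Qed.

Lemma box_center p s e : 0 < e -> box p s e p.
Proof. by move=> e0 i _; rewrite subrr normr0. Qed.

Lemma nbhs_boxW p s e : 0 < e -> nbhs p (box p s e).
Proof. by move=> e0; apply: open_nbhs_nbhs; split; [exact: open_box|exact: box_center]. Qed.

Lemma box_dfwith p s e w i (v : R) : box p s e w ->
  (i \in s -> `|v - p i| < e) -> box p s e (dfwith w i v).
Proof.
move=> wb vb j js; case: (eqVneq i j) => [ij|ij].
  by rewrite -ij dfwithin; apply: vb; rewrite ij.
by rewrite dfwithout//; exact: wb.
Qed.

Lemma dfwith_id z (i : I) : dfwith z i (z i) = z.
Proof. by apply/funext => j; case: dfwithP. Qed.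

Lemma dfwith_twice z (i : I) (u v : R) :
  dfwith (dfwith z i u) i v = dfwith z i v.
Proof.
apply/funext => j; case: (eqVneq i j) => [<-|ij]; first by rewrite !dfwithin.
by rewrite !dfwithout.
Qed.

Lemma dfwithC z (i j : I) (u v : R) : i != j ->
  dfwith (dfwith z i u) j v = dfwith (dfwith z j v) i u.
Proof.
move=> ij; apply/funext => k.
case: (eqVneq i k) => ik; case: (eqVneq j k) => jk.
- by case/eqP: ij; rewrite ik jk.
- by rewrite -ik in jk *; rewrite (dfwithout _ _ jk) !dfwithin.
- by rewrite -jk in ik *; rewrite dfwithin (dfwithout _ _ ik) dfwithin.
- by rewrite !dfwithout.
Qed.

Lemma near_line U z (i : I) : nbhs z U -> \forall t \near z i, U (dfwith z i t).
Proof. by move=> zU; apply: line_continuous; rewrite dfwith_id. Qed.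

End Boxes.

(** * Mean value theorem along coordinate lines *)

Section PartialDerivatives.
Context {R : realType} {I : eqType}.
Implicit Types (p z w : {ptws I -> R}) (U : set {ptws I -> R}) (s : seq I).
Implicit Types (f g : {ptws I -> R} -> R).

Lemma cvg_ptws (T : Type) (F : set_system T) (FF : Filter F)
    (g : T -> {ptws I -> R}) p :
  (forall i, (fun t => g t i) @ F --> p i) -> g @ F --> p.
Proof.
move=> gp U /nbhs_box[s [e e0 sU]].
suff : F [set t | forall i, i \in s -> `|g t i - p i| < e].
  by apply: (@filterS _ F FF) => t tb; exact: sU.
elim: s {sU} => [|i s IHs]; first by apply: (@filterS _ F FF _ _ _ filterT) => t _ i.
have pe : nbhs (p i) [set v | `|v - p i| < e].
  rewrite -nbhs_ballE; exists e => // v.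
  by rewrite /ball /= distrC.
have gi : F [set t | `|g t i - p i| < e] := gp i _ pe.
move: IHs gi; apply: (@filterS2 _ F FF) => t ts ti j; rewrite inE => /predU1P[->//|]; exact: ts.
Qed.

Lemma eq_pd f g z (i : I) :
  (\forall w \near z, f w = g w) -> pd i f z = pd i g z.
Proof.
move=> fg; rewrite /pd !derive1E; apply: near_eq_derive.
exact: (near_line i fg).
Qed.

Lemma eq_derivable_line f g z (i : I) : (\forall w \near z, f w = g w) ->
  derivable (line f z i) (z i) 1 -> derivable (line g z i) (z i) 1.
Proof. by move=> fg; apply: near_eq_derivable; exact: (near_line i fg). Qed.

Lemma line_dfwith f z (i : I) (t : R) : line f (dfwith z i t) i = line f z i.
Proof. by apply/funext => u; rewrite /line dfwith_twice. Qed.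

Lemma is_derive_line f z (i : I) (t : R) :
  derivable (line f (dfwith z i t) i) (dfwith z i t i) 1 ->
  is_derive t 1 (line f z i) (pd i f (dfwith z i t)).
Proof.
rewrite line_dfwith dfwithin => dft; apply: DeriveDef => //.
by rewrite /pd line_dfwith dfwithin derive1E.
Qed.

Lemma MVT_unordered (f df : R -> R) (u v : R) :
  (forall t, Num.min u v <= t <= Num.max u v -> is_derive t 1 f (df t)) ->
  exists2 t, Num.min u v <= t <= Num.max u v & f v - f u = df t * (v - u).
Proof.
wlog uv : u v / u <= v => [hw|].
  have /orP[uv|vu] := le_total u v; first exact: hw.
  rewrite minC maxC => fdf; have [t tvu E] := hw _ _ vu fdf.
  by exists t => //; rewrite -(opprB (f u)) E; ring.
rewrite min_l// max_r// => fdf.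
have [||t tuv E] := @MVT_segment _ f df u v uv.
- by move=> t; rewrite in_itv /= => /andP[ut tv]; apply: fdf; rewrite !ltW.
- apply: derivable_within_continuous => t; rewrite in_itv /= => tuv.
  by case: (fdf t tuv).
- by exists t.
Qed.

Lemma between_lt (u v c e t : R) : `|u - c| < e -> `|v - c| < e ->
  Num.min u v <= t <= Num.max u v -> `|t - c| < e.
Proof.
rewrite !ltr_norml => /andP[? ?] /andP[? ?]; rewrite ge_min le_max.
by move=> /andP[/orP[]? /orP[]?]; apply/andP; split; lra.
Qed.

Lemma between_le (u v t : R) :
  Num.min u v <= t <= Num.max u v -> `|t - u| <= `|v - u|.
Proof.
rewrite ge_min le_max => /andP[a b]; rewrite ler_norml.
have := ler_norm (v - u); have := ler_norm (u - v); rewrite distrC.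
by case/orP : a; case/orP : b => *; apply/andP; split; lra.
Qed.

(** Boxes are convex along each coordinate, and a coordinate outside [s] ranges over the whole line;
    this is why the bounds on [v] and [t] are stated only for [i \in s]. *)
Lemma mvt_line f p s e w (i : I) (v : R) : box p s e w ->
  (i \in s -> `|v - p i| < e) ->
  (forall w, box p s e w -> derivable (line f w i) (w i) 1) ->
  exists t, [/\ `|t - w i| <= `|v - w i|, i \in s -> `|t - p i| < e &
    f (dfwith w i v) - f w = pd i f (dfwith w i t) * (v - w i)].
Proof.
move=> wB vB df.
have tB t : Num.min (w i) v <= t <= Num.max (w i) v -> i \in s -> `|t - p i| < e.
  by move=> tv is_; apply: (between_lt _ _ tv); [exact: wB|exact: vB].
have [|t tv E] := @MVT_unordered (line f w i) (fun t => pd i f (dfwith w i t)) (w i) v.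
  by move=> t tv; apply: is_derive_line; apply: df; apply: box_dfwith => //; exact: tB.
exists t; split; [exact: between_le|exact: tB|].
by rewrite -E /line dfwith_id.
Qed.

(** Caratheodory's form of differentiability: the difference quotient of [h] is that of [u] times a
    factor with limit [c0]. It avoids a division by [u t - u t0], which may vanish arbitrarily close
    to [t0]. *)
Lemma is_derive_factor (h u c : R -> R) (t0 c0 du : R) :
  (\forall t \near t0, h t - h t0 = c t * (u t - u t0)) -> c @ t0 --> c0 ->
  is_derive t0 1 u du -> is_derive t0 1 h (c0 * du).
Proof.
move=> hc cc0 [du' <-].
have cv : (fun a : R => a^-1 *: (h (a *: 1 + t0) - h t0)) @ 0^' --> c0 * 'D_1 u t0.
  have sh : (fun a : R => a *: (1 : R) + t0) @ 0^' --> t0.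
    have : (fun a : R => a *: (1 : R) + t0) @ 0^' --> 0 *: (1 : R) + t0.
      by apply: cvgD; [apply: cvgZr_tmp; exact: cvg_within|exact: cvg_cst].
    by rewrite scale0r add0r.
  apply: cvg_trans (cvgM (cvg_comp _ _ sh cc0) du').
  apply: near_eq_cvg; near=> a => /=.
  have -> : h (a *: 1 + t0) - h t0 = c (a *: 1 + t0) * (u (a *: 1 + t0) - u t0).
    by near: a; exact: (sh _ hc).
  by rewrite /GRing.scale /= mulrCA.
split; first by apply/cvg_ex; eexists; exact: cv.
exact/cvg_lim.
Unshelve. all: by end_near. Qed.

End PartialDerivatives.

(** * Chain rule along a path *)

Section ChainRule.
Context {R : realType} {I : eqType}.
Implicit Types (p z w : {ptws I -> R}) (U : set {ptws I -> R}) (s : seq I).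
Implicit Types (f g : {ptws I -> R} -> R).

(** The points [mix s w p] for growing [s] lead from [p] towards [w] by changing one coordinate at a
    time, the chain over which increments are telescoped. *)
Definition mix s w p : {ptws I -> R} := fun i => if i \in s then w i else p i.

Lemma mix_box p s e l w : 0 < e -> box p s e w -> box p s e (mix l w p).
Proof.
move=> e0 wb i is_; rewrite /mix; case: ifP => _; first exact: wb.
by rewrite subrr normr0.
Qed.

(** Telescoping over [l]: each increment changes one coordinate and, by the mean value theorem, is a
    partial derivative at an intermediate point times the increment of that coordinate. Continuity
    of the partial derivatives at [gam t0] gives the limit. *)
Lemma is_derive_path (gam : R -> {ptws I -> R}) (dgam : I -> R) (t0 e : R) s l f :
  0 < e -> uniq l -> gam @ t0 --> gam t0 ->
  (forall i, i \in l -> is_derive t0 1 (fun t => gam t i) (dgam i)) ->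
  (forall z z', box (gam t0) s e z -> box (gam t0) s e z' ->
    (forall i, i \in l -> z i = z' i) -> f z = f z') ->
  (forall z i, box (gam t0) s e z -> i \in l ->
    derivable (line f z i) (z i) 1) ->
  (forall i, i \in l -> {for gam t0, continuous (pd i f)}) ->
  is_derive t0 1 (f \o gam) (\sum_(i <- l) pd i f (gam t0) * dgam i).
Proof.
move=> e0 ul cg dg fl df cf; set p := gam t0.
have gB : \forall t \near t0, box p s e (gam t).
  by apply: cg; exact: nbhs_boxW.
apply: (@near_eq_is_derive _ _ _ (fun t => f (mix l (gam t) p))).
  near=> t; apply: fl; last by move=> i il; rewrite /mix il.
    by apply: mix_box => //; near: t.
  by near: t.
have mp l' : mix l' p p = p by apply/funext => i; rewrite /mix; case: ifP.
suff H l' : uniq l' -> {subset l' <= l} ->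
  is_derive t0 1 (fun t => f (mix l' (gam t) p)) (\sum_(i <- l') pd i f p * dgam i).
  exact: H.
elim: l' => [_ _|j l' IHl /= /andP[jl' ul'] l'l].
  rewrite big_nil (_ : (fun t => _) = cst (f p)); first exact: is_derive_cst.
  by apply/funext.
have jl : j \in l by apply: l'l; rewrite mem_head.
have {}IHl := IHl ul' (fun i il' => l'l i (mem_behead (s := j :: l') il')).
rewrite big_cons addrC.
pose h t := f (mix (j :: l') (gam t) p) - f (mix l' (gam t) p).
rewrite (_ : (fun t => _) = (fun t => f (mix l' (gam t) p)) + h); last first.
  by apply/funext => t; rewrite /h /= addrC subrK.
apply: is_deriveD.
have mixE t : mix (j :: l') (gam t) p = dfwith (mix l' (gam t) p) j (gam t j).
  apply/funext => i; rewrite /mix inE; case: (eqVneq i j) => [->|ij /=].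
    by rewrite dfwithin.
  by rewrite dfwithout // eq_sym.
pose m t := mix l' (gam t) p.
have mj t : m t j = p j by rewrite /m /mix (negbTE jl').
pose P t := [set v : R | `|v - p j| <= `|gam t j - p j| /\
  h t = pd j f (dfwith (m t) j v) * (gam t j - p j)].
(* The default 0 is harmless: [P t] is nonempty for [t] close to [t0]. *)
pose xi t := xget 0 (P t).
have Pxi : \forall t \near t0, P t (xi t).
  near=> t; rewrite /xi; apply: xgetPex.
  have gtB : box p s e (gam t) by near: t.
  have [|||v [vp _ E]] := @mvt_line _ _ f p s e (m t) j (gam t j).
  - exact: mix_box.
  - exact: gtB.
  - by move=> w wB; apply: df.
  exists v; rewrite /P /= /h mixE; rewrite mj in vp E; split => //.
apply: (@is_derive_factor _ h (fun t => gam t j)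
    (fun t => pd j f (dfwith (m t) j (xi t)))).
- near=> t; rewrite (_ : h t0 = 0) ?subr0; last by rewrite /h -/p !mp subrr.
  by have [] : P t (xi t) by near: t.
- have gj i : (fun t => gam t i) @ t0 --> p i.
    exact: (cvg_comp _ (fun z => z i) cg (@continuous_coord R I i p)).
  have : (fun t => dfwith (m t) j (xi t) : {ptws I -> R}) @ t0 --> p.
    apply: cvg_ptws => i; case: (eqVneq j i) => [<-|ji].
      under eq_fun do rewrite dfwithin.
      apply/cvgrPdist_lt => eps eps0; near=> t.
      have [+ _] : P t (xi t) by near: t.
      rewrite distrC => /le_lt_trans; apply; rewrite distrC; near: t.
      have /cvgrPdist_lt gj' := gj j; exact: gj'.
    under eq_fun do rewrite dfwithout// /m /mix.
    by case: (i \in l'); [exact: gj|exact: cvg_cst].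
  by move=> mcv; exact: (cvg_comp _ _ mcv (cf j jl)).
- exact: dg.
Unshelve. all: by end_near. Qed.

End ChainRule.

(** * Symmetry of mixed partial derivatives *)

Section Schwarz.
Context {R : realType} {I : eqType}.
Implicit Types (p z w : {ptws I -> R}) (U : set {ptws I -> R}) (s : seq I).
Implicit Types (f g : {ptws I -> R} -> R).

(** The mean value theorem is applied twice, in direction [i] and then in direction [j]. The second
    difference is symmetric in the two directions, which is what the proof of [pdC] exploits. *)
Lemma second_difference f p s (e h : R) (i j : I) : 0 < h < e -> i != j ->
  (forall w, box p s e w -> derivable (line f w i) (w i) 1) ->
  (forall w, box p s e w -> derivable (line (pd i f) w j) (w j) 1) ->
  exists2 w, box p s e w &
    f (dfwith (dfwith p i (p i + h)) j (p j + h)) - f (dfwith p i (p i + h)) -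
    (f (dfwith p j (p j + h)) - f p) = h * h * pd j (pd i f) w.
Proof.
move=> /andP[h0 he] ij df ddf.
have e0 : 0 < e by exact: lt_trans he.
have pB := @box_center _ _ p s e e0.
have bd k t : Num.min (p k) (p k + h) <= t <= Num.max (p k) (p k + h) ->
    `|t - p k| < e.
  by apply: between_lt; rewrite ?subrr ?normr0 // addrAC subrr add0r gtr0_norm.
pose g t := f (dfwith (dfwith p i t) j (p j + h)) - f (dfwith p i t).
pose dg t := pd i f (dfwith (dfwith p i t) j (p j + h)) - pd i f (dfwith p i t).
have bh k : `|p k + h - p k| < e by rewrite addrAC subrr add0r gtr0_norm.
have [t tb|t /bd tb E] := @MVT_unordered R g dg (p i) (p i + h).
  have tB : box p s e (dfwith p i t) by apply: box_dfwith => // _; exact: bd.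
  apply: is_deriveB; last by apply: is_derive_line; exact: df.
  rewrite (dfwithC _ _ _ ij).
  rewrite (_ : (fun t => _) = line f (dfwith p j (p j + h)) i); last first.
    by apply/funext => u; rewrite /line (dfwithC _ _ _ ij).
  apply: is_derive_line; apply: df; rewrite -(dfwithC _ _ _ ij).
  by apply: box_dfwith => // _; exact: bh.
have tB : box p s e (dfwith p i t) by apply: box_dfwith => // _; exact: bd.
have [|v [_ vB E']] := @mvt_line _ _ (pd i f) p s e _ j (p j + h) tB _ ddf.
  by move=> _; exact: bh.
exists (dfwith (dfwith p i t) j v); first exact: box_dfwith.
rewrite dfwithout // in E'.
move: E; rewrite /g /dg E' !dfwith_id => ->; ring.
Qed.

Lemma not_both_near (a b x : R) :
  `|a - x| < `|a - b| / 2 -> `|b - x| < `|a - b| / 2 -> False.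
Proof.
rewrite (distrC b) => ax bx; have := ler_normD (a - x) (x - b).
by rewrite subrKA leNgt [X in _ < X](splitr `|a - b|) ltrD.
Qed.

(** The two mixed derivatives, each at some point of an arbitrarily small box, equal the same second
    difference divided by its squared step. If they differed at [p], continuity would keep them
    apart on a small enough box. *)
Lemma pdC f p s (e : R) (i j : I) : 0 < e ->
  (forall w k, box p s e w -> k \in [:: i; j] -> derivable (line f w k) (w k) 1) ->
  (forall w k l, box p s e w -> k \in [:: i; j] -> l \in [:: i; j] ->
     derivable (line (pd k f) w l) (w l) 1) ->
  (forall k l, k \in [:: i; j] -> l \in [:: i; j] ->
     {for p, continuous (pd l (pd k f))}) ->
  pd j (pd i f) p = pd i (pd j f) p.
Proof.
have [->//|ij] := eqVneq i j.
have iij : i \in [:: i; j] by rewrite inE eqxx.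
have jij : j \in [:: i; j] by rewrite !inE eqxx orbT.
move=> e0 df ddf cf; apply/eqP/negPn/negP => neq.
pose d := `|pd j (pd i f) p - pd i (pd j f) p| / 2.
have d0 : 0 < d by rewrite divr_gt0 // normr_gt0 subr_eq0.
have ca : \forall w \near p, `|pd j (pd i f) p - pd j (pd i f) w| < d.
  by have /cvgrPdist_lt/(_ d d0) := cf i j iij jij.
have cb : \forall w \near p, `|pd i (pd j f) p - pd i (pd j f) w| < d.
  by have /cvgrPdist_lt/(_ d d0) := cf j i jij iij.
have [s' [e' e'0 sub]] := nbhs_box (filterI (@nbhs_boxW _ _ p s e e0) (filterI ca cb)).
have he : 0 < e' / 2 < e' by rewrite divr_gt0 //= gtr_pMr // invf_lt1 // ltr1n.
have [||w /sub[_ [wa _]] Ew] := @second_difference f p s' e' (e' / 2) i j he ij.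
- by move=> w /sub[wB _]; exact: df.
- by move=> w /sub[wB _]; exact: ddf.
have ji : j != i by rewrite eq_sym.
have [||v /sub[_ [_ vb]] Ev] := @second_difference f p s' e' (e' / 2) j i he ji.
- by move=> v /sub[vB _]; exact: df.
- by move=> v /sub[vB _]; exact: ddf.
rewrite (dfwithC _ _ _ ji) in Ev.
have E : pd j (pd i f) w = pd i (pd j f) v.
  have h0 : e' / 2 * (e' / 2) != 0 by rewrite gt_eqF // mulr_gt0 // divr_gt0.
  have sw (x1 x2 x3 x4 : R) : x1 - x2 - (x3 - x4) = x1 - x3 - (x2 - x4) by ring.
  exact: (mulfI h0 (etrans (esym Ew) (etrans (sw _ _ _ _) Ev))).
rewrite -E in vb; exact: (not_both_near wa vb).
Qed.

End Schwarz.

(** * Smoothness on an open set *)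

Section SmoothFunctions.
Context {R : realType}.

Section Basics.
Context {I : eqType}.
Implicit Types (p z w : {ptws I -> R}) (U V : set {ptws I -> R}) (s l : seq I).
Implicit Types (f g : {ptws I -> R} -> R).

Definition C1_at z f : Prop :=
  {for z, continuous f} /\ forall i, derivable (line f z i) (z i) 1.

Definition smooth_on U f : Prop := forall s z, U z -> C1_at z (foldr pd f s).

Definition depends_on U l f : Prop := forall z z', U z -> U z' ->
  (forall i, i \in l -> z i = z' i) -> f z = f z'.

Lemma smooth_nearP p f : smooth_near p f <->
  exists U l, [/\ open U, U p, uniq l, depends_on U l f & smooth_on U f].
Proof.
split=> [[[l [V [pV Vf]]] cf]|[U [l [oU Up _ Ul Uf]]]]; last first.
  split; first by exists l, U; split=> //; exact: open_nbhs_nbhs.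
  by apply: filterS (open_nbhs_nbhs (conj oU Up)) => z Uz s; exact: Uf.
exists (V `&` [set z | forall s, C1_at z (foldr pd f s)])^°, (undup l).
split; [exact: open_interior|exact: filterI|exact: undup_uniq| |].
- move=> z z' /interior_subset[Vz _] /interior_subset[Vz' _] zz'; apply: Vf => //.
  by move=> i il; apply: zz'; rewrite mem_undup.
- by move=> s z /interior_subset[_]; exact.
Qed.

Lemma pd_eq U f g : open U -> (forall z, U z -> f z = g z) ->
  forall i z, U z -> pd i f z = pd i g z.
Proof.
move=> oU fg i z Uz; apply: eq_pd.
by apply: filterS (open_nbhs_nbhs (conj oU Uz)); exact: fg.
Qed.

Lemma foldr_pd_eq U f g : open U -> (forall z, U z -> f z = g z) ->
  forall s z, U z -> foldr pd f s z = foldr pd g s z.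
Proof. by move=> oU fg; elim=> [|i s IHs] //=; exact: pd_eq. Qed.

Lemma C1_eq U f g z : open U -> (forall z, U z -> f z = g z) -> U z ->
  C1_at z f -> C1_at z g.
Proof.
move=> oU fg Uz [cf df].
have fg' : \forall w \near z, f w = g w.
  by apply: filterS (open_nbhs_nbhs (conj oU Uz)); exact: fg.
split; last by move=> i; exact: eq_derivable_line fg' (df i).
rewrite /prop_for /continuous_at -(fg _ Uz).
exact: (cvg_trans (@near_eq_cvg _ _ (nbhs z) _ f g fg') cf).
Qed.

Lemma smooth_on_eq U f g : open U -> (forall z, U z -> f z = g z) ->
  smooth_on U f -> smooth_on U g.
Proof.
move=> oU fg sf s z Uz; apply: (C1_eq oU _ Uz (sf s z Uz)).
by move=> w Uw; apply: (foldr_pd_eq oU fg).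
Qed.

Lemma depends_on_eq U l f g : (forall z, U z -> f z = g z) ->
  depends_on U l f -> depends_on U l g.
Proof. by move=> fg fl z z' Uz Uz' zz'; rewrite -!fg //; exact: fl. Qed.

Lemma smooth_on_sub U V f : V `<=` U -> smooth_on U f -> smooth_on V f.
Proof. by move=> VU sf s z /VU; exact: sf. Qed.

Lemma depends_on_sub U V l l' f : V `<=` U -> {subset l <= l'} ->
  depends_on U l f -> depends_on V l' f.
Proof.
by move=> VU ll' fl z z' /VU Uz /VU Uz' zz'; apply: fl => // i /ll'; exact: zz'.
Qed.

Lemma smooth_on_pd U f i : smooth_on U f -> smooth_on U (pd i f).
Proof. by move=> sf s; rewrite -foldr_rcons; exact: sf. Qed.

Lemma pd_notin U l f i z : open U -> depends_on U l f -> U z -> i \notin l ->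
  pd i f z = 0.
Proof.
move=> oU fl Uz il; rewrite /pd -(derive1_cst (f z) (z i)) !derive1E.
apply: near_eq_derive.
have zU := open_nbhs_nbhs (conj oU Uz).
apply: filterS (near_line i zU) => t tU; rewrite /line /cst.
apply: fl => // j jl; rewrite dfwithout //.
by apply: contra il => /eqP ->.
Qed.

Lemma depends_on_pd U l f i : open U -> depends_on U l f ->
  depends_on U l (pd i f).
Proof.
move=> oU fl z z' Uz Uz' zz'.
have [il|il] := boolP (i \in l); last by rewrite !(pd_notin oU fl).
rewrite /pd -(zz' i il) !derive1E; apply: near_eq_derive.
have zU := near_line i (open_nbhs_nbhs (conj oU Uz)).
have := near_line i (open_nbhs_nbhs (conj oU Uz')); rewrite -(zz' i il).
apply: filterS2 zU => t tU tU'; rewrite /line; apply: fl => // j jl.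
case: (eqVneq i j) => [<-|ij]; first by rewrite !dfwithin.
by rewrite !dfwithout //; exact: zz'.
Qed.

(** Coinduction: derivatives of all orders are reached one at a time, so it is enough to place [f]
    in a class of C^1 functions that is stable, up to equality on [U], under partial derivatives. *)
Lemma smooth_on_coind U (P : ({ptws I -> R} -> R) -> Prop) : open U ->
  (forall f, P f -> (forall z, U z -> C1_at z f) /\
     forall i, exists2 g, P g & forall z, U z -> pd i f z = g z) ->
  forall f, P f -> smooth_on U f.
Proof.
move=> oU H f Pf s.
have [g Pg fg] : exists2 g, P g & forall z, U z -> foldr pd f s z = g z.
  elim: s => [|i s [g Pg fg]]; first by exists f.
  have [_ /(_ i)[h Ph gh]] := H g Pg; exists h => // z Uz /=.
  by rewrite (pd_eq oU fg) // gh.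
move=> z Uz; apply: (@C1_eq U g) => //; first by move=> w Uw; rewrite fg.
by have [+ _] := H g Pg; exact.
Qed.

Lemma pdcst (c : R) i z : pd i (cst c) z = 0.
Proof. by rewrite /pd -(derive1_cst c (z i)). Qed.

Lemma pd_coord i j z : pd i (fun z : {ptws I -> R} => z j) z = (i == j)%:R.
Proof.
rewrite /pd /line; case: eqVneq => [<-|ij].
  by under eq_fun do rewrite dfwithin; rewrite derive1_id.
by under eq_fun do rewrite dfwithout//; rewrite derive1_cst.
Qed.

Lemma C1_cst (c : R) z : C1_at z (cst c).
Proof. by split; [exact: cst_continuous|move=> i; exact: derivable_cst]. Qed.

Lemma smooth_on_cst U (c : R) : open U -> smooth_on U (cst c).
Proof.
move=> oU; apply: (@smooth_on_coind _ (fun f => exists c, f = cst c)) => //.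
- move=> _ [{}c ->]; split=> [z _|i]; first exact: C1_cst.
  by exists (cst 0); [exists 0|move=> z _; rewrite pdcst].
- by exists c.
Qed.

Lemma smooth_on_coord U j : open U -> smooth_on U (fun z => z j).
Proof.
move=> oU; apply: (@smooth_on_coind _
  (fun f => f = (fun z => z j) \/ exists c, f = cst c)) => //; last by left.
move=> _ [->|[c ->]]; split=> [z _|i].
- split; [exact: (@continuous_coord R I j z)|move=> i].
  rewrite /line; case: (eqVneq i j) => [<-|ij].
    by under eq_fun do rewrite dfwithin; exact: derivable_id.
  by under eq_fun do rewrite dfwithout//; exact: derivable_cst.
- by exists (cst (i == j)%:R); [right; exists (i == j)%:R|move=> z _; exact: pd_coord].
- exact: C1_cst.
- by exists (cst 0); [right; exists 0|move=> z _; exact: pdcst].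
Qed.

Lemma C1D z f g : C1_at z f -> C1_at z g -> C1_at z (fun w => f w + g w).
Proof.
move=> [cf df] [cg dg]; split.
  exact: (@cvgD R R _ (nbhs z) _ f g _ _ cf cg).
by move=> i; exact: (derivableD (df i) (dg i)).
Qed.

Lemma C1M z f g : C1_at z f -> C1_at z g -> C1_at z (fun w => f w * g w).
Proof.
move=> [cf df] [cg dg]; split.
  exact: (@cvgM R _ (nbhs z) _ f g _ _ cf cg).
by move=> i; exact: (derivableM (df i) (dg i)).
Qed.

Lemma C1V z f : f z != 0 -> C1_at z f -> C1_at z (fun w => (f w)^-1).
Proof.
move=> fz [cf df]; split; first exact: (@cvgV R _ (nbhs z) _ f _ fz cf).
move=> i; have fz' : line f z i (z i) != 0 by rewrite /line dfwith_id.
exact: (derivableV fz' (df i)).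
Qed.

Lemma C1_exp z f : C1_at z f -> C1_at z (fun w => expR (f w)).
Proof.
move=> [cf df]; split; first exact: (cvg_comp f expR cf (@continuous_expR R (f z))).
move=> i; have [+ _] : is_derive (z i) 1 (expR \o line f z i)
    (expR (line f z i (z i)) * 'D_1 (line f z i) (z i)).
  by apply: is_derive1_comp; exact: derivableP.
by [].
Qed.

Lemma pdD z f g i : C1_at z f -> C1_at z g ->
  pd i (fun w => f w + g w) z = pd i f z + pd i g z.
Proof.
by move=> [_ df] [_ dg]; rewrite /pd !derive1E -(deriveD (df i) (dg i)).
Qed.

Lemma pdM z f g i : C1_at z f -> C1_at z g ->
  pd i (fun w => f w * g w) z = pd i f z * g z + f z * pd i g z.
Proof.
move=> [_ df] [_ dg]; rewrite /pd !derive1E.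
rewrite (deriveM (df i) (dg i)) /line !dfwith_id addrC; congr (_ + _).
exact: mulrC.
Qed.

Lemma pdV z f i : f z != 0 -> C1_at z f ->
  pd i (fun w => (f w)^-1) z = - (f z) ^- 2 * pd i f z.
Proof.
move=> fz [_ df]; rewrite /pd !derive1E.
have fz' : line f z i (z i) != 0 by rewrite /line dfwith_id.
by rewrite (deriveV fz' (df i)) /line dfwith_id.
Qed.

Lemma pd_exp z f i : C1_at z f ->
  pd i (fun w => expR (f w)) z = expR (f z) * pd i f z.
Proof.
move=> [_ df]; rewrite /pd !derive1E.
have [_ ->] : is_derive (z i) 1 (expR \o line f z i)
    (expR (line f z i (z i)) * 'D_1 (line f z i) (z i)).
  by apply: is_derive1_comp; exact: derivableP.
by rewrite /line dfwith_id.
Qed.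

End Basics.
End SmoothFunctions.

(** * Closure of smoothness under arithmetic, the exponential and composition *)

Section SmoothClosure.
Context {R : realType}.

Section Composition.
Context {I J : eqType} (U : set {ptws I -> R}) (V : set {ptws J -> R}).
Context (G : {ptws I -> R} -> {ptws J -> R}) (l : seq J).
Context (oU : open U) (oV : open V) (GUV : forall z, U z -> V (G z)).
Context (sG : forall j, smooth_on U (fun z => G z j)) (ul : uniq l).

Lemma continuous_map z : U z -> {for z, continuous G}.
Proof.
move=> Uz; apply: (@cvg_ptws R J _ (nbhs z) _ G (G z)) => j.
by case: (sG j [::] Uz).
Qed.

Lemma is_derive_comp f z i : smooth_on V f -> depends_on V l f -> U z ->
  is_derive (z i) 1 (line (f \o G) z i)
    (\sum_(j <- l) pd j f (G z) * pd i (fun z => G z j) z).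
Proof.
move=> sf fl Uz.
have [s [e e0 sub]] := nbhs_box (open_nbhs_nbhs (conj oV (GUV Uz))).
have zi : G (dfwith z i (z i)) = G z by rewrite dfwith_id.
have := @is_derive_path R J (fun t => G (dfwith z i t))
  (fun j => pd i (fun z => G z j) z) (z i) e s l f e0 ul.
rewrite zi; apply.
- apply: (cvg_comp _ _ (@line_continuous R I z i (z i))).
  by rewrite dfwith_id; exact: continuous_map.
- move=> j _; have [_ /(_ i) dG] := sG j [::] Uz.
  by rewrite /pd derive1E; exact: derivableP.
- by move=> w w' /sub Vw /sub Vw'; exact: fl.
- by move=> w j /sub Vw _; have [_] := sf [::] w Vw.
- by move=> j _; have [] := sf [:: j] _ (GUV Uz).
Qed.

Lemma pd_comp f z i : smooth_on V f -> depends_on V l f -> U z ->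
  pd i (f \o G) z = \sum_(j <- l) pd j f (G z) * pd i (fun z => G z j) z.
Proof.
by move=> sf fl Uz; have [_ <-] := is_derive_comp i sf fl Uz; rewrite -derive1E.
Qed.

Lemma C1_comp f z : smooth_on V f -> depends_on V l f -> U z ->
  C1_at z (f \o G).
Proof.
move=> sf fl Uz; split; last first.
  by move=> i; have [] := is_derive_comp i sf fl Uz.
have [cf _] := sf [::] _ (GUV Uz).
exact: (cvg_comp G f (continuous_map Uz) cf).
Qed.

End Composition.

(* Closed under [pd] up to equality on [U], hence made of smooth functions. *)
Inductive smooth_expr (I : eqType) (U : set {ptws I -> R}) :
    ({ptws I -> R} -> R) -> Prop :=
| expr_base f of smooth_on U f : smooth_expr U f
| expr_add f g of smooth_expr U f & smooth_expr U g :
    smooth_expr U (fun z => f z + g z)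
| expr_mul f g of smooth_expr U f & smooth_expr U g :
    smooth_expr U (fun z => f z * g z)
| expr_inv f of (forall z, U z -> f z != 0) & smooth_expr U f :
    smooth_expr U (fun z => (f z)^-1)
| expr_exp f of smooth_expr U f : smooth_expr U (fun z => expR (f z))
| expr_comp (J : eqType) (V : set {ptws J -> R}) G l f of
    open V & (forall z, U z -> V (G z)) &
    (forall j, smooth_on U (fun z => G z j)) & uniq l &
    smooth_on V f & depends_on V l f : smooth_expr U (f \o G).

Section Closure.
Context {I : eqType} (U : set {ptws I -> R}) (oU : open U).

Lemma smooth_expr_closed f : smooth_expr U f ->
  (forall z, U z -> C1_at z f) /\
  forall i, exists2 g, smooth_expr U g & forall z, U z -> pd i f z = g z.
Proof.
elim=> {f} [f sf|f g Ef [cf df] Eg [cg dg]|f g Ef [cf df] Eg [cg dg]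
  |f f0 Ef [cf df]|f Ef [cf df]|J V G l f oV GUV sG ul sf fl].
- split=> [z Uz|i]; first exact: (sf [::] z Uz).
  by exists (pd i f) => //; apply: expr_base; exact: smooth_on_pd.
- split=> [z Uz|i]; first by apply: C1D; [exact: cf|exact: cg].
  have [f' Ef' ff'] := df i; have [g' Eg' gg'] := dg i.
  exists (fun z => f' z + g' z); first exact: expr_add.
  by move=> z Uz; rewrite pdD ?ff' ?gg' //; [exact: cf|exact: cg].
- split=> [z Uz|i]; first by apply: C1M; [exact: cf|exact: cg].
  have [f' Ef' ff'] := df i; have [g' Eg' gg'] := dg i.
  exists (fun z => f' z * g z + f z * g' z).
    by apply: expr_add; exact: expr_mul.
  by move=> z Uz; rewrite pdM ?ff' ?gg' //; [exact: cf|exact: cg].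
- split=> [z Uz|i]; first by apply: C1V; [exact: f0|exact: cf].
  have [f' Ef' ff'] := df i.
  exists (fun z => cst (-1) z * ((f z)^-1 * (f z)^-1) * f' z).
    apply: expr_mul => //; apply: expr_mul.
      by apply: expr_base; exact: smooth_on_cst.
    by apply: expr_mul; exact: expr_inv.
  move=> z Uz; rewrite pdV ?ff' //; [|exact: f0|exact: cf].
  by rewrite /cst mulN1r -invfM.
- split=> [z Uz|i]; first by apply: C1_exp; exact: cf.
  have [f' Ef' ff'] := df i.
  exists (fun z => expR (f z) * f' z); first by apply: expr_mul => //; exact: expr_exp.
  by move=> z Uz; rewrite pd_exp ?ff' //; exact: cf.
- split=> [z Uz|i]; first exact: (C1_comp oV GUV sG ul).
  exists (fun z => \sum_(j <- l) pd j f (G z) * pd i (fun z => G z j) z); last first.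
    by move=> z Uz; rewrite (pd_comp oV GUV sG ul i sf fl Uz).
  have : smooth_expr U (fun z => \sum_(j <- [::]) pd j f (G z) * pd i (fun z => G z j) z).
    rewrite (_ : (fun z => _) = cst 0); last by apply/funext => z; rewrite big_nil.
    by apply: expr_base; exact: smooth_on_cst.
  move=> E0; elim: {1}l => [//|j l' IHl].
  rewrite (_ : (fun z => _) = (fun z => pd j f (G z) * pd i (fun z => G z j) z +
    \sum_(j <- l') pd j f (G z) * pd i (fun z => G z j) z)); last first.
    by apply/funext => z; rewrite big_cons.
  apply: expr_add; last exact: IHl.
  apply: expr_mul.
    apply: (expr_comp (f := pd j f) oV GUV sG ul); first exact: smooth_on_pd.
    exact: depends_on_pd.
  by apply: expr_base; exact: smooth_on_pd.
Qed.

Lemma smooth_on_expr f : smooth_expr U f -> smooth_on U f.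
Proof. by apply: smooth_on_coind => //; exact: smooth_expr_closed. Qed.

End Closure.
End SmoothClosure.

(** * Germs of smooth functions *)

Section SmoothNear.
Context {R : realType}.

Section OneSpace.
Context {I : eqType}.
Implicit Types (z w : {ptws I -> R}) (f g : {ptws I -> R} -> R).

(* Unlike [smooth_near], rigid for unification. *)
Variant smooth z f : Prop := Smooth of smooth_near z f.

Lemma smoothP z f : smooth z f <-> exists U l,
  [/\ open U, U z, uniq l, depends_on U l f & smooth_on U f].
Proof.
split=> [[/smooth_nearP//]|fU]; apply: Smooth; exact/smooth_nearP.
Qed.

Lemma smooth_smooth_on U f z : open U -> U z -> smooth z f ->
  exists V l, [/\ open V, V z, V `<=` U & [/\ uniq l, depends_on V l f & smooth_on V f]].
Proof.
move=> oU Uz /smoothP[V [l [oV Vz ul fl sf]]].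
exists (V `&` U), l; split; [exact: openI|by []|by move=> ? []|split=> //].
- by apply: depends_on_sub fl => // ? [].
- by apply: smooth_on_sub sf => ? [].
Qed.

Lemma smooth_C1 z f : smooth z f -> C1_at z f.
Proof. by move=> /smoothP[U [l [oU Uz _ _ /(_ [::] z Uz)]]]. Qed.

Lemma near_smooth z f : smooth z f -> \forall w \near z, smooth w f.
Proof.
move=> /smoothP[U [l [oU Uz ul fl sf]]].
apply: filterS (open_nbhs_nbhs (conj oU Uz)) => w Uw.
by apply/smoothP; exists U, l.
Qed.

Lemma smooth_eq z f g : (\forall w \near z, f w = g w) ->
  smooth z f -> smooth z g.
Proof.
move=> /nbhs_interior/nbhs_singleton fgz.
move=> /(smooth_smooth_on (@open_interior _ _) fgz)[V [l [oV Vz VU [ul fl sf]]]].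
have fg w : V w -> f w = g w by move=> /VU/interior_subset.
apply/smoothP; exists V, l.
by split; [| | |exact: depends_on_eq fl|exact: smooth_on_eq sf].
Qed.

Lemma smooth_cst z (c : R) : smooth z (cst c).
Proof.
apply/smoothP; exists setT, [::]; split=> //; first exact: openT.
by apply: smooth_on_cst; exact: openT.
Qed.

Lemma smooth_coord z i : smooth z (fun w => w i).
Proof.
apply/smoothP; exists setT, [:: i]; split=> //; first exact: openT.
  by move=> w w' _ _; apply; rewrite mem_head.
by apply: smooth_on_coord; exact: openT.
Qed.

Lemma smooth_pd z f i : smooth z f -> smooth z (pd i f).
Proof.
move=> /smoothP[U [l [oU Uz ul fl sf]]]; apply/smoothP.
by exists U, l; split; [| | |exact: depends_on_pd|exact: smooth_on_pd].
Qed.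

Lemma smooth2 (op : R -> R -> R) z f g :
  (forall U, open U -> smooth_on U f -> smooth_on U g ->
    smooth_on U (fun w => op (f w) (g w))) ->
  smooth z f -> smooth z g -> smooth z (fun w => op (f w) (g w)).
Proof.
move=> opP /smoothP[U [l [oU Uz ul fl sf]]].
move=> /(smooth_smooth_on oU Uz)[V [l' [oV Vz VU [ul' gl sg]]]].
apply/smoothP; exists V, (undup (l ++ l')).
split; [exact: oV|exact: Vz|exact: undup_uniq| |].
  move=> w w' Vw Vw' ww'; congr op.
    by apply: fl => //; [exact: VU|exact: VU|move=> i il; apply: ww';
      rewrite mem_undup mem_cat il].
  by apply: gl => // i il; apply: ww'; rewrite mem_undup mem_cat il orbT.
apply: opP oV _ sg; exact: smooth_on_sub sf.
Qed.

Lemma smoothD z f g : smooth z f -> smooth z g ->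
  smooth z (fun w => f w + g w).
Proof.
apply: (@smooth2 +%R) => U oU sf sg; apply: smooth_on_expr => //.
by apply: expr_add; exact: expr_base.
Qed.

Lemma smoothM z f g : smooth z f -> smooth z g ->
  smooth z (fun w => f w * g w).
Proof.
apply: (@smooth2 *%R) => U oU sf sg; apply: smooth_on_expr => //.
by apply: expr_mul; exact: expr_base.
Qed.

Lemma smoothN z f : smooth z f -> smooth z (fun w => - f w).
Proof.
move=> sf; have := smoothM (smooth_cst z (-1)) sf.
by apply: smooth_eq; near=> w; rewrite /cst mulN1r.
Unshelve. all: by end_near.
Qed.

Lemma smooth_exp z f : smooth z f -> smooth z (fun w => expR (f w)).
Proof.
move=> sf; refine (@smooth2 (fun a _ => expR a) z f f _ sf sf) => U oU sfU _.
by apply: (smooth_on_expr oU); apply: expr_exp; exact: expr_base.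
Qed.

Lemma smoothV z f : f z != 0 -> smooth z f ->
  smooth z (fun w => (f w)^-1).
Proof.
move=> fz sf; have [cf _] := smooth_C1 sf.
have [U [oU Uz U0]] : exists U, [/\ open U, U z & forall w, U w -> f w != 0].
  exists [set w | f w != 0]^°; split; first exact: open_interior.
    exact: (cf _ (open_nbhs_nbhs (conj (@open_neq R 0) fz))).
  by move=> w /interior_subset.
have [V [l [oV Vz VU [ul fl sfV]]]] := smooth_smooth_on oU Uz sf.
apply/smoothP; exists V, l; split; [exact: oV|exact: Vz|exact: ul| |].
  by move=> w w' Vw Vw' ww'; rewrite (fl w w').
apply: smooth_on_expr => //; apply: expr_inv; last exact: expr_base.
by move=> w /VU; exact: U0.
Qed.

Lemma smooth_sum (T : Type) (s : seq T) (F : T -> {ptws I -> R} -> R) z :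
  (forall t, smooth z (F t)) -> smooth z (fun w => \sum_(t <- s) F t w).
Proof.
move=> sF; elim: s => [|t s IHs].
  rewrite (_ : (fun w => _) = cst 0); first exact: smooth_cst.
  by apply/funext => w; rewrite big_nil.
rewrite (_ : (fun w => _) = fun w => F t w + \sum_(t <- s) F t w).
  exact: (smoothD (sF t) IHs).
by apply/funext => w; rewrite big_cons.
Qed.

End OneSpace.

Section TwoSpaces.
Context {I J : eqType} (G : {ptws I -> R} -> {ptws J -> R}) (z : {ptws I -> R}).
Context (sG : forall j, smooth z (fun w => G w j)).

Lemma smooth_continuous : {for z, continuous G}.
Proof.
apply: (@cvg_ptws R J _ (nbhs z) _ G (G z)) => j.
by case: (smooth_C1 (sG j)).
Qed.

(** Each component of [G] is smooth on its own neighborhood of [z], and infinitely many of these may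
    have no common open part. As [f] depends only on the coordinates in [l], [G] is replaced by the
    map [H] that agrees with it on [l] and is constant elsewhere. All components of [H] are smooth
    on one open set, and [f] takes the same values along [H] and along [G] there. *)
Lemma smooth_comp_pd f : smooth (G z) f -> smooth z (f \o G) /\
  exists l, uniq l /\ (forall j, j \notin l -> pd j f (G z) = 0) /\
  forall i, pd i (f \o G) z = \sum_(j <- l) pd j f (G z) * pd i (fun w => G w j) z.
Proof.
move=> /smoothP[V [l [oV Vz ul fl sf]]].
pose H w := mix l (G w) (G z).
have [U [oU Uz UP]] : exists U, [/\ open U, U z & forall w, U w ->
    [/\ V (G w), V (H w) & forall j, j \in l -> smooth w (fun w => G w j)]].
  have HG j : smooth z (fun w => H w j).
    by rewrite /H /mix; case: (j \in l); [exact: sG|exact: smooth_cst].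
  have cG := smooth_continuous (open_nbhs_nbhs (conj oV Vz)).
  have cH : \forall w \near z, V (H w).
    apply: (@cvg_ptws R J _ (nbhs z) _ H (G z)); last exact: open_nbhs_nbhs.
    move=> j; have [] := smooth_C1 (HG j).
    by rewrite /prop_for /continuous_at /H /mix; case: (j \in l).
  have sl : \forall w \near z, forall j, j \in l -> smooth w (fun w => G w j).
    elim: (l) => [|j s IHs]; first by apply: filterS filterT.
    apply: filterS2 IHs (near_smooth (sG j)) => w ws wj k.
    by rewrite inE => /predU1P[->//|]; exact: ws.
  exists [set w | [/\ V (G w), V (H w) &
    forall j, j \in l -> smooth w (fun w => G w j)]]^°.
  split; [exact: open_interior| |by move=> w /interior_subset].
  exact: (@filterS3 _ (nbhs z) _ _ _ _ _ (fun w a b c => And3 a b c) cG cH sl).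
have sH j : smooth_on U (fun w => H w j).
  rewrite /H /mix; case: (boolP (j \in l)) => jl; last exact: smooth_on_cst.
  move=> s w /UP[_ _ /(_ j jl)]; move=> /smoothP[W [k [oW Ww _ _ sW]]].
  exact: (sW s w Ww).
have UVH w : U w -> V (H w) by move=> /UP[].
have fE w : U w -> f (H w) = f (G w).
  by move=> /UP[Gw Hw _]; apply: fl => // j jl; rewrite /H /mix jl.
have near_fE : \forall w \near z, (f \o H) w = (f \o G) w.
  by apply: filterS (open_nbhs_nbhs (conj oU Uz)); exact: fE.
have Hz : H z = G z by apply/funext => j; rewrite /H /mix; case: ifP.
split; last first.
  exists l; split=> //; split; first by move=> j; exact: pd_notin fl Vz.
  move=> i; rewrite -(eq_pd i near_fE) (pd_comp oV UVH sH ul i sf fl Uz) Hz.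
  by apply: eq_big_seq => j jl; rewrite /H /mix jl.
apply: (smooth_eq near_fE).
(* [f \o H] depends on the coordinates on which the components of [G] indexed by [l] depend. *)
have [W [k [oW Wz WU Gk]]] : exists W k, [/\ open W, W z, W `<=` U &
    forall j, j \in l -> depends_on W k (fun w => G w j)].
  elim: (l) => [|j s [W [k [oW Wz WU Wk]]]]; first by exists U, [::]; split=> // j.
  have [W' [k' [oW' Wz' WW' [_ Wk' _]]]] := smooth_smooth_on oW Wz (sG j).
  exists W', (k' ++ k); split=> //; first exact: subset_trans WU.
  move=> i; rewrite inE => /predU1P[->|/Wk is_].
    by apply: depends_on_sub Wk' => // x xk; rewrite mem_cat xk.
  by apply: depends_on_sub is_ => // x xk; rewrite mem_cat xk orbT.
apply/smoothP; exists W, (undup k).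
split; [exact: oW|exact: Wz|exact: undup_uniq| |].
  move=> w w' Ww Ww' ww'; rewrite /= /H; congr f; apply/funext => j; rewrite /mix.
  case: ifP => // jl; apply: Gk => // i ik; apply: ww'; by rewrite mem_undup.
apply: smooth_on_sub WU _; apply: smooth_on_expr => //.
exact: (expr_comp oV UVH sH ul sf fl).
Qed.

Lemma smooth_comp f : smooth (G z) f -> smooth z (f \o G).
Proof. by move=> /smooth_comp_pd[]. Qed.

End TwoSpaces.

Lemma smooth_pdC (I : eqType) (f : {ptws I -> R} -> R) z i j :
  smooth z f -> pd j (pd i f) z = pd i (pd j f) z.
Proof.
move=> /smoothP[U [l [oU Uz ul fl sf]]].
have [s [e e0 sub]] := nbhs_box (open_nbhs_nbhs (conj oU Uz)).
apply: (@pdC _ _ f z s e) => //.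
- by move=> w k /sub Uw _; have [_] := sf [::] w Uw.
- by move=> w k k' /sub Uw _ _; have [_] := sf [:: k] w Uw.
- by move=> k k' _ _; have [] := sf [:: k'; k] z Uz.
Qed.

End SmoothNear.

(** * Vector fields *)

Section VectorFields.
Context {R : realType}.

Section OneSpace.
Context {I : choiceType}.
Implicit Types (z w : {ptws I -> R}) (f g : {ptws I -> R} -> R).
Implicit Types (X Y : I -> {ptws I -> R} -> R).

(* The derivation with components [X]; on smooth functions the sum is finite. *)
Definition vf X f : {ptws I -> R} -> R := fun z =>
  \sum_(i \in [set: I]) X i z * pd i f z.

Lemma vf_seq l X f z : uniq l -> (forall i, i \notin l -> pd i f z = 0) ->
  vf X f z = \sum_(i <- l) X i z * pd i f z.
Proof.
move=> ul f0; rewrite /vf (fsbigE l) //; last first.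
  by move=> i _ /f0 ->; rewrite mulr0.
by apply: eq_bigl => i; rewrite in_setT.
Qed.

Lemma smooth_support f z : smooth z f ->
  exists l, uniq l /\ \forall w \near z, forall i, i \notin l -> pd i f w = 0.
Proof.
move=> /smoothP[U [l [oU Uz ul fl sf]]]; exists l; split=> //.
apply: filterS (open_nbhs_nbhs (conj oU Uz)) => w Uw i.
exact: pd_notin fl Uw.
Qed.

Lemma smooth_support2 f g z : smooth z f -> smooth z g ->
  exists l, [/\ uniq l, forall i, i \notin l -> pd i f z = 0 &
    forall i, i \notin l -> pd i g z = 0].
Proof.
move=> /smooth_support[l [ul /nbhs_singleton fl]].
move=> /smooth_support[l' [ul' /nbhs_singleton gl]].
exists (undup (l ++ l')); split; first exact: undup_uniq.
  by move=> i; rewrite mem_undup mem_cat negb_or => /andP[/fl].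
by move=> i; rewrite mem_undup mem_cat negb_or => /andP[_ /gl].
Qed.

Lemma vf_near f z : smooth z f -> exists l, uniq l /\
  \forall w \near z, forall X, vf X f w = \sum_(i <- l) X i w * pd i f w.
Proof.
move=> /smooth_support[l [ul lf]]; exists l; split=> //.
by apply: filterS lf => w lw X; exact: vf_seq.
Qed.

Lemma vf_eq X f g z : (\forall w \near z, f w = g w) -> vf X f z = vf X g z.
Proof. by move=> fg; apply: eq_fsbigr => i _; rewrite (eq_pd i fg). Qed.

Lemma vf_ext X Y f z : (forall i, X i z = Y i z) -> vf X f z = vf Y f z.
Proof. by move=> XY; apply: eq_fsbigr => i _; rewrite XY. Qed.

Lemma vf_zero X f z : (forall i, X i z = 0) -> vf X f z = 0.
Proof. by move=> X0; apply: fsbig1 => i _; rewrite X0 mul0r. Qed.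

Lemma vf_coord X j z : vf X (fun w => w j) z = X j z.
Proof.
rewrite (@vf_seq [:: j]) //.
  by rewrite big_seq1 pd_coord eqxx mulr1.
by move=> i; rewrite inE => ij; rewrite pd_coord (negbTE ij).
Qed.

Lemma vf_cst X (c : R) z : vf X (cst c) z = 0.
Proof. by rewrite (@vf_seq [::]) ?big_nil // => i _; exact: pdcst. Qed.

Lemma vfD X f g z : smooth z f -> smooth z g ->
  vf X (fun w => f w + g w) z = vf X f z + vf X g z.
Proof.
move=> sf sg; have [l [ul fl gl]] := smooth_support2 sf sg.
have [cf cg] := (smooth_C1 sf, smooth_C1 sg).
rewrite (vf_seq X ul fl) (vf_seq X ul gl) (@vf_seq l); last 2 first.
- exact: ul.
- by move=> i il; rewrite pdD // fl // gl // addr0.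
by rewrite -big_split; apply: eq_bigr => i _; rewrite pdD // mulrDr.
Qed.

Lemma vfM X f g z : smooth z f -> smooth z g ->
  vf X (fun w => f w * g w) z = vf X f z * g z + f z * vf X g z.
Proof.
move=> sf sg; have [l [ul fl gl]] := smooth_support2 sf sg.
have [cf cg] := (smooth_C1 sf, smooth_C1 sg).
rewrite (vf_seq X ul fl) (vf_seq X ul gl) (@vf_seq l); last 2 first.
- exact: ul.
- by move=> i il; rewrite pdM // fl // gl // mul0r mulr0 addr0.
rewrite mulr_suml mulr_sumr -big_split; apply: eq_bigr => i _ /=.
by rewrite pdM // mulrDr mulrA mulrCA.
Qed.

Lemma vfZ X (c : R) f z : smooth z f ->
  vf X (fun w => c * f w) z = c * vf X f z.
Proof.
move=> sf; rewrite (vfM X (smooth_cst z c) sf) (vf_cst X c z).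
by rewrite mul0r add0r.
Qed.

Lemma vfN X f z : smooth z f -> vf X (fun w => - f w) z = - vf X f z.
Proof.
move=> sf; rewrite -[RHS]mulN1r -(vfZ X (-1) sf); apply: vf_eq.
by near=> w; rewrite mulN1r.
Unshelve. all: by end_near. Qed.

Lemma vf_exp X f z : smooth z f ->
  vf X (fun w => expR (f w)) z = expR (f z) * vf X f z.
Proof.
move=> sf; have [l [ul /nbhs_singleton fl]] := smooth_support sf.
have cf := smooth_C1 sf.
rewrite (vf_seq X ul fl) (@vf_seq l); last 2 first.
- exact: ul.
- by move=> i il; rewrite pd_exp // fl // mulr0.
by rewrite mulr_sumr; apply: eq_bigr => i _; rewrite pd_exp // mulrCA.
Qed.

Lemma vfV X f z : f z != 0 -> smooth z f ->
  vf X (fun w => (f w)^-1) z = - (f z) ^- 2 * vf X f z.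
Proof.
move=> f0 sf; have [l [ul /nbhs_singleton fl]] := smooth_support sf.
have cf := smooth_C1 sf.
rewrite (vf_seq X ul fl) (@vf_seq l); last 2 first.
- exact: ul.
- by move=> i il; rewrite pdV // fl // mulr0.
by rewrite mulr_sumr; apply: eq_bigr => i _; rewrite pdV // mulrCA.
Qed.

Lemma vf_sum X (T : Type) (s : seq T) (F : T -> {ptws I -> R} -> R) z :
  (forall t, smooth z (F t)) ->
  vf X (fun w => \sum_(t <- s) F t w) z = \sum_(t <- s) vf X (F t) z.
Proof.
move=> sF; elim: s => [|t s IHs].
  rewrite big_nil (_ : (fun w => _) = cst 0) ?vf_cst //.
  by apply/funext => w; rewrite big_nil.
rewrite big_cons -IHs -(vfD X (sF t) (smooth_sum s sF)).
by apply: vf_eq; near=> w; rewrite big_cons.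
Unshelve. all: by end_near. Qed.

Lemma vf_linear X Y (a b : {ptws I -> R} -> R) f z : smooth z f ->
  vf (fun i w => a w * X i w + b w * Y i w) f z = a z * vf X f z + b z * vf Y f z.
Proof.
move=> /vf_near[l [_ /nbhs_singleton fl]]; rewrite !fl.
rewrite !mulr_sumr -big_split; apply: eq_bigr => i _ /=.
by rewrite mulrDl !mulrA.
Qed.

Lemma pd_vf i f z : smooth z f -> pd i f z = vf (fun j => cst (j == i)%:R) f z.
Proof.
move=> /smooth_support[l [ul /nbhs_singleton fl]].
rewrite (@vf_seq (undup (i :: l))) ?undup_uniq //; last first.
  by move=> j; rewrite mem_undup inE negb_or => /andP[_ /fl].
rewrite (bigD1_seq i) ?undup_uniq ?mem_undup ?mem_head //= /cst eqxx mul1r.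
by rewrite big1 ?addr0 // => j /negbTE ->; rewrite mul0r.
Qed.

Lemma smooth_vf X f z : (forall i, smooth z (X i)) ->
  smooth z f -> smooth z (vf X f).
Proof.
move=> sX sf; have [l [_ fl]] := vf_near sf.
have E : \forall w \near z, \sum_(i <- l) X i w * pd i f w = vf X f w.
  by apply: filterS fl => w ->.
apply: (smooth_eq E); apply: smooth_sum => i.
exact: (smoothM (sX i) (smooth_pd i sf)).
Qed.

(** The second-order terms cancel by the symmetry of mixed derivatives, so only derivatives of the
    components survive. *)
Lemma vf_comm X Y f z : (forall i, smooth z (X i)) ->
  (forall i, smooth z (Y i)) -> smooth z f ->
  vf X (vf Y f) z - vf Y (vf X f) z =
  vf (fun i w => vf X (Y i) w - vf Y (X i) w) f z.
Proof.
move=> sX sY sf.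
have [l [ul lf]] := smooth_support sf.
have l0 i j : i \notin l -> pd i (pd j f) z = 0.
  move=> il; rewrite (smooth_pdC j i sf) -(pdcst 0 j z); apply: eq_pd.
  by apply: filterS lf => w; exact.
have E (W X' : I -> _) : (forall i, smooth z (W i)) ->
    vf X' (vf W f) z = \sum_(i <- l) (vf X' (W i) z * pd i f z +
      \sum_(j <- l) W i z * X' j z * pd j (pd i f) z).
  move=> sW; have Wf : \forall w \near z, vf W f w = \sum_(i <- l) W i w * pd i f w.
    by apply: filterS lf => w lw; exact: vf_seq.
  rewrite (vf_eq _ Wf) vf_sum; last first.
    by move=> i; exact: (smoothM (sW i) (smooth_pd i sf)).
  apply: eq_bigr => i _; rewrite (vfM X' (sW i) (smooth_pd i sf)).
  rewrite (@vf_seq l X' (pd i f)) //; last by move=> j jl; exact: l0.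
  by congr (_ + _); rewrite mulr_sumr; apply: eq_bigr => j _; rewrite mulrA.
rewrite (E Y X sY) (E X Y sX) (@vf_seq l) //; last exact: (nbhs_singleton lf).
rewrite !big_split /= opprD addrACA.
rewrite [X in _ + (X - _)]exchange_big /= [X in _ + X](_ : _ = 0) ?addr0.
  by rewrite -sumrB; apply: eq_bigr => i _; rewrite mulrBl.
apply/eqP; rewrite subr_eq0; apply/eqP; apply: eq_bigr => i _; apply: eq_bigr => j _.
by rewrite (smooth_pdC i j sf) (mulrC (Y j z)).
Qed.

End OneSpace.

(** Chain rule for [G]-related vector fields. Only first derivatives enter, so relatedness is asked
    at the single point [z]. *)
Lemma vf_comp (I J : choiceType) (G : {ptws I -> R} -> {ptws J -> R}) z
    (X : I -> {ptws I -> R} -> R) (Y : J -> {ptws J -> R} -> R) f :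
  (forall j, smooth z (fun w => G w j)) -> smooth (G z) f ->
  (forall j, vf X (fun w => G w j) z = Y j (G z)) ->
  vf X (f \o G) z = vf Y f (G z).
Proof.
move=> sG sf XY; have [sfG [l [ul [l0 fG]]]] := smooth_comp_pd sG sf.
have [k [uk k0 Gk]] : exists k, [/\ uniq k, forall i, i \notin k -> pd i (f \o G) z = 0 &
    forall j, j \in l -> forall i, i \notin k -> pd i (fun w => G w j) z = 0].
  have [k0 [_ /nbhs_singleton fk0]] := smooth_support sfG.
  suff [k Gk] : exists k : seq I, forall j, j \in l ->
      forall i, i \notin k -> pd i (fun w => G w j) z = 0.
    exists (undup (k0 ++ k)); split; first exact: undup_uniq.
      by move=> i; rewrite mem_undup mem_cat negb_or => /andP[/fk0].
    by move=> j jl i; rewrite mem_undup mem_cat negb_or => /andP[_ ik]; exact: (Gk j jl i ik).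
  elim: (l) => [|j s [k Gk]]; first by exists [::].
  have [k1 [_ /nbhs_singleton Gj]] := smooth_support (sG j).
  exists (k1 ++ k) => j'; rewrite inE => /predU1P[->|/Gk jk] i.
    by rewrite mem_cat negb_or => /andP[/Gj].
  by rewrite mem_cat negb_or => /andP[_ /jk].
rewrite (vf_seq X uk k0) (vf_seq Y ul l0).
under eq_bigr => i _ do rewrite fG mulr_sumr.
rewrite exchange_big /= [LHS]big_seq [RHS]big_seq; apply: eq_bigr => j jl.
rewrite -XY (vf_seq X uk (Gk j jl)) mulr_suml.
by apply: eq_bigr => i _; rewrite mulrAC -mulrA.
Qed.

End VectorFields.

(** A hook, redefined by [::=] as functions of known smoothness accumulate. The tactic [smooth]
    decomposes a function along its syntax and calls the hook at the leaves. *)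
Ltac smooth_lemma := fail.

Ltac smooth :=
  lazymatch goal with
  | |- smooth ?z (fun _ => ?c) => exact (@smooth_cst _ _ z c)
  | |- smooth ?z (fun w => @?f w + @?g w) =>
      refine (@smoothD _ _ z f g _ _); cbv beta; smooth
  | |- smooth ?z (fun w => @?f w * @?g w) =>
      refine (@smoothM _ _ z f g _ _); cbv beta; smooth
  | |- smooth ?z (fun w => - @?f w) =>
      refine (@smoothN _ _ z f _); cbv beta; smooth
  | |- smooth ?z (fun w => (@?f w)^-1) =>
      refine (@smoothV _ _ z f _ _); cbv beta; smooth
  | |- smooth ?z (fun w => expR (@?f w)) =>
      refine (@smooth_exp _ _ z f _); cbv beta; smooth
  | |- smooth ?z (fun w => w ?i) => exact (@smooth_coord _ _ z i)
  | |- smooth ?z (fun w => cst ?c w) => exact (@smooth_cst _ _ z c)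
  | |- smooth ?z (cst ?c) => exact (@smooth_cst _ _ z c)
  | |- smooth ?z (fun w => vf ?X ?f w) =>
      refine (@smooth_vf _ _ X f z _ _); smooth
  | |- smooth ?z (vf ?X ?f) =>
      refine (@smooth_vf _ _ X f z _ _); smooth
  | |- smooth ?z (pd ?i ?f) =>
      refine (@smooth_pd _ _ z f i _); smooth
  | |- smooth _ _ =>
      first [match goal with
        | H : smooth _ _ |- _ => simple apply H
        | H : forall _, smooth _ _ |- _ => simple apply H
        end | smooth_lemma]
  | |- forall _, _ => intro; smooth
  | |- _ => match goal with H : is_true ?P |- is_true ?P => exact H end
  end.

Ltac vf_expand :=
  repeat (match goal with
  | |- context [vf ?X (fun _ => ?c) ?z] => rewrite (@vf_cst _ _ X c z)
  | |- context [vf ?X (fun w => @?f w + @?g w) ?z] =>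
      rewrite (@vfD _ _ X f g z); [|smooth|smooth]
  | |- context [vf ?X (fun w => @?f w * @?g w) ?z] =>
      rewrite (@vfM _ _ X f g z); [|smooth|smooth]
  | |- context [vf ?X (fun w => - @?f w) ?z] =>
      rewrite (@vfN _ _ X f z); [|smooth]
  | |- context [vf ?X (fun w => (@?f w)^-1) ?z] =>
      rewrite (@vfV _ _ X f z); [|cbv beta; smooth|smooth]
  | |- context [vf ?X (fun w => expR (@?f w)) ?z] =>
      rewrite (@vf_exp _ _ X f z); [|smooth]
  | |- context [vf ?X (fun w => w ?i) ?z] => rewrite (@vf_coord _ _ X i z)
  | |- context [vf ?X (cst ?c) ?z] => rewrite (@vf_cst _ _ X c z)
  end; cbv beta).

(** * Total derivatives on jets *)

HB.instance Definition _ := gen_choiceMixin jetvar.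

(** If [X, Y] = 0, then [A, B] = (A c - B a) X + (A d - B b) Y. Commutation of combinations with
    variable coefficients is thus reduced to two scalar identities. *)
Lemma vf_comm_combination (R : realType) (I : choiceType)
    (X Y : I -> {ptws I -> R} -> R) (a b c d : {ptws I -> R} -> R) f z
    (A := fun i w => a w * X i w + b w * Y i w)
    (B := fun i w => c w * X i w + d w * Y i w) :
  (forall i, smooth z (X i)) -> (forall i, smooth z (Y i)) ->
  smooth z a -> smooth z b -> smooth z c -> smooth z d ->
  smooth z f ->
  (forall i, vf X (Y i) z = vf Y (X i) z) ->
  vf A c z = vf B a z -> vf A d z = vf B b z ->
  vf A (vf B f) z = vf B (vf A f) z.
Proof.
move=> sX sY sa sb sc sd sf XY Ac Ad; apply/eqP; rewrite -subr_eq0; apply/eqP.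
have sA i : smooth z (A i) by rewrite /A; smooth.
have sB i : smooth z (B i) by rewrite /B; smooth.
rewrite (vf_comm sA sB sf); apply: vf_zero => i; change (vf A (fun w => c w * X i w + d w * Y i w) z -
  vf B (fun w => a w * X i w + b w * Y i w) z = 0).
have AE g : smooth z g -> vf A g z = a z * vf X g z + b z * vf Y g z.
  exact: vf_linear.
have BE g : smooth z g -> vf B g z = c z * vf X g z + d z * vf Y g z.
  exact: vf_linear.
vf_expand; rewrite Ac Ad (AE _ (sX i)) (AE _ (sY i)) (BE _ (sX i)) (BE _ (sY i)).
rewrite XY /A /B; ring.
Qed.

Section JetSpace.
Context {R : realType}.
Local Notation jet := {ptws jetvar -> R}.
Implicit Types (j : jet) (f g : jet -> R).

Definition Xx (v : jetvar) : jet -> R :=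
  match v with Jt => cst 0 | Jx => cst 1 | Jr i k => fun j => j (Jr i k.+1) end.

Definition Xt (v : jetvar) : jet -> R :=
  match v with
  | Jt => cst 1 | Jx => cst 0
  | Jr i k => fun j => - iter k Dx (fun j' => V i j' * r i 1 j') j
  end.

(** Total derivatives are defined by a sum over orders and then over the three unknowns, [vf] by a
    sum over all jet variables. A smooth germ involves finitely many orders, so the two agree and
    the calculus of vector fields applies to D_x and D_t. *)
Lemma vf_jets (X : jetvar -> jet -> R) f j : smooth j f ->
  vf X f j = X Jt j * pd Jt f j + X Jx j * pd Jx f j +
  \sum_(k \in [set: nat]) \sum_(i < 3) X (Jr i k) j * pd (Jr i k) f j.
Proof.
move=> /smooth_support[l [ul /nbhs_singleton lf]].
pose n := (\max_(v <- l) (if v is Jr _ k then k.+1 else 0))%N.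
have ln i k : (n <= k)%N -> pd (Jr i k) f j = 0.
  move=> nk; apply: lf; apply: contraTN nk => il; rewrite -ltnNge.
  exact: (@leq_bigmax_seq _ l xpredT (fun v => if v is Jr _ k then k.+1 else 0)%N _ il).
rewrite (fsbigE (index_iota 0 n)) ?iota_uniq //; last first.
  move=> k _; rewrite mem_index_iota /= -leqNgt => nk.
  by rewrite big1 // => i _; rewrite ln ?mulr0.
rewrite (@vf_seq _ _ (Jt :: Jx :: [seq Jr i k | k <- index_iota 0 n, i <- enum 'I_3])).
- rewrite !big_cons addrA; congr (_ + _).
  rewrite big_allpairs_dep /=; under [RHS]eq_bigl do rewrite in_setT.
  by apply: eq_bigr => k _; rewrite big_enum.
- rewrite /= inE negb_or; apply/and3P; split.
  + by apply/andP; split; [apply/eqP|apply/allpairsPdep => -[k [i [_ _]]]].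
  + by apply/allpairsPdep => -[k [i [_ _]]].
  + apply: allpairs_uniq_dep; [exact: iota_uniq|by move=> *; exact: enum_uniq|].
    by move=> [k i] [k' i'] _ _ /= [-> ->].
- case=> [||i k]; rewrite !inE ?eqxx ?orbT // !negb_or => /and3P[_ _].
  move=> /allpairsPdep ik; apply: ln; rewrite leqNgt; apply/negP => kn; apply: ik.
  by exists k, i; rewrite mem_index_iota mem_enum.
Qed.

Lemma Dx_vf f j : smooth j f -> Dx f j = vf Xx f j.
Proof. by move=> sf; rewrite vf_jets //= /cst mul0r mul1r add0r. Qed.

Lemma Dt_vf f j : smooth j f -> Dt f j = vf Xt f j.
Proof.
move=> sf; rewrite vf_jets //= /cst mul0r mul1r addr0 /Dt; congr (_ + _).
rewrite -mulN1r mulr_fsumr; apply: eq_fsbigr => k _.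
by rewrite mulr_sumr; apply: eq_bigr => i _; rewrite mulN1r mulNr.
Qed.

Lemma smooth_Xx j v : smooth j (Xx v).
Proof. by case: v => [||i k] /=; smooth. Qed.
Ltac smooth_lemma ::= first [simple apply smooth_Xx]; smooth.

Lemma near_Dx f j : smooth j f -> \forall w \near j, vf Xx f w = Dx f w.
Proof.
by move=> sf; apply: filterS (near_smooth sf) => w sfw; rewrite Dx_vf.
Qed.

Lemma smooth_Dx f j : smooth j f -> smooth j (Dx f).
Proof.
move=> sf; apply: (smooth_eq (near_Dx sf)).
by apply: smooth_vf => // v; exact: smooth_Xx.
Qed.
Ltac smooth_lemma ::= first [simple apply smooth_Xx | simple apply smooth_Dx]; smooth.

Lemma smooth_iter_Dx k f j : (forall j, smooth j f) -> smooth j (iter k Dx f).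
Proof. by move=> sf; elim: k => [|k IHk]; [exact: sf|exact: smooth_Dx]. Qed.

Lemma smooth_r i k j : smooth j (r i k).
Proof. exact: smooth_coord. Qed.

Lemma smooth_V i j : smooth j (V i).
Proof. by cbv beta delta [V r]; smooth. Qed.
Ltac smooth_lemma ::= first [simple apply smooth_Xx | simple apply smooth_Dx |
  simple apply smooth_r | simple apply smooth_V]; smooth.

Lemma smooth_Xt j v : smooth j (Xt v).
Proof.
case: v => [||i k] /=; [exact: smooth_cst|exact: smooth_cst|].
apply: smoothN; apply: smooth_iter_Dx => j'.
by apply: smoothM; [exact: smooth_V|exact: smooth_coord].
Qed.
Ltac smooth_lemma ::= first [simple apply smooth_Xx | simple apply smooth_Dx |
  simple apply smooth_r | simple apply smooth_V | simple apply smooth_Xt]; smooth.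

Lemma near_Dt f j : smooth j f -> \forall w \near j, vf Xt f w = Dt f w.
Proof.
by move=> sf; apply: filterS (near_smooth sf) => w sfw; rewrite Dt_vf.
Qed.

Lemma smooth_Dt f j : smooth j f -> smooth j (Dt f).
Proof.
move=> sf; apply: (smooth_eq (near_Dt sf)).
by apply: smooth_vf => // v; exact: smooth_Xt.
Qed.
Ltac smooth_lemma ::= first [simple apply smooth_Xx | simple apply smooth_Dx |
  simple apply smooth_r | simple apply smooth_V | simple apply smooth_Xt |
  simple apply smooth_Dt]; smooth.

(** True by construction: the component of D_t at order k + 1 is D_x of its component at order k. *)
Lemma vf_XtXx j v : vf Xt (Xx v) j = vf Xx (Xt v) j.
Proof.
case: v => [||i k] /=; rewrite ?vf_cst // vf_coord /=.
set g := fun j' => V i j' * r i 1 j'.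
have sg j' : smooth j' (iter k Dx g).
  apply: smooth_iter_Dx => j2.
  by apply: smoothM; [exact: smooth_V|exact: smooth_coord].
by rewrite vfN // -Dx_vf.
Qed.

Definition Xy (v : jetvar) : jet -> R := fun j =>
  - (j (Jr i1 1))^-1 * Xt v j + - (j (Jr i1 1))^-1 * V i2 j * Xx v j.

Definition Xz (v : jetvar) : jet -> R := fun j =>
  - (j (Jr i2 1))^-1 * Xt v j + - (j (Jr i2 1))^-1 * V i1 j * Xx v j.

Lemma Dy_vf f j : smooth j f -> Dy f j = vf Xy f j.
Proof.
by move=> sf; rewrite (vf_linear _ _ _ _ sf) /Dy Dt_vf // Dx_vf // mulrDr mulrA.
Qed.

Lemma Dz_vf f j : smooth j f -> Dz f j = vf Xz f j.
Proof.
by move=> sf; rewrite (vf_linear _ _ _ _ sf) /Dz Dt_vf // Dx_vf // mulrDr mulrA.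
Qed.

Lemma vf_Xt_r i k j : vf Xt (fun j => j (Jr i k)) j =
  - iter k Dx (fun j' => V i j' * r i 1 j') j.
Proof. by rewrite vf_coord. Qed.

Lemma vf_Xx_r i k j : vf Xx (fun j => j (Jr i k)) j = j (Jr i k.+1).
Proof. by rewrite vf_coord. Qed.

Lemma V1E : V i1 = (fun j => j (Jr i1 0) + j (Jr i2 0) + 1).
Proof. by apply/funext => j; rewrite /V (tnth_nth 0). Qed.

Lemma V2E : V i2 = (fun j => j (Jr i1 0) + j (Jr i2 0) + -1).
Proof. by apply/funext => j; rewrite /V (tnth_nth 0). Qed.

Lemma V3E : V i3 = (fun j => j (Jr i1 0) + j (Jr i2 0)).
Proof. by apply/funext => j; rewrite /V (tnth_nth 0) /= addr0. Qed.

Lemma vf_Xx_V i j : vf Xx (V i) j = j (Jr i1 1) + j (Jr i2 1).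
Proof. by cbv beta delta [V r]; vf_expand; rewrite addr0. Qed.

Lemma vf_Xt_V i j : vf Xt (V i) j = - (V i1 j * j (Jr i1 1) + V i2 j * j (Jr i2 1)).
Proof. by cbv beta delta [V r]; vf_expand; rewrite addr0 opprD. Qed.

Lemma vf_Xt_r1 i j : vf Xt (fun j => j (Jr i 1)) j =
  - ((j (Jr i1 1) + j (Jr i2 1)) * j (Jr i 1) + V i j * j (Jr i 2)).
Proof.
rewrite vf_Xt_r /=; congr (- _); rewrite Dx_vf; last by smooth.
rewrite vfM; [|smooth|smooth].
by rewrite vf_Xx_V; have -> : vf Xx (r i 1) j = j (Jr i 2) by exact: vf_coord.
Qed.

Definition jet_regular j : Prop := j (Jr i1 1) != 0 /\ j (Jr i2 1) != 0.

Lemma near_coord_neq0 v j : j v != 0 -> \forall w \near j, w v != 0.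
Proof.
move=> jv; have cv := @continuous_coord R jetvar v j.
exact: (cv _ (open_nbhs_nbhs (conj (@open_neq R 0) jv))).
Qed.

Lemma near_jet_regular j : jet_regular j -> \forall w \near j, jet_regular w.
Proof.
move=> [/near_coord_neq0 uj /near_coord_neq0 vj].
exact: (@filterS2 _ (nbhs j) _ _ _ _ (fun w a b => conj a b) uj vj).
Qed.

Lemma smooth_Xy j v : jet_regular j -> smooth j (Xy v).
Proof. by case=> u0 v0; rewrite /Xy; smooth. Qed.

Lemma smooth_Xz j v : jet_regular j -> smooth j (Xz v).
Proof. by case=> u0 v0; rewrite /Xz; smooth. Qed.

Lemma near_Dy f j : smooth j f -> \forall w \near j, vf Xy f w = Dy f w.
Proof. by move=> sf; apply: filterS (near_smooth sf) => w sfw; rewrite Dy_vf. Qed.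

Lemma near_Dz f j : smooth j f -> \forall w \near j, vf Xz f w = Dz f w.
Proof. by move=> sf; apply: filterS (near_smooth sf) => w sfw; rewrite Dz_vf. Qed.

Lemma smooth_Dy f j : jet_regular j -> smooth j f -> smooth j (Dy f).
Proof.
move=> nj sf; apply: (smooth_eq (near_Dy sf)).
by apply: smooth_vf => // v; exact: smooth_Xy.
Qed.

Lemma smooth_Dz f j : jet_regular j -> smooth j f -> smooth j (Dz f).
Proof.
move=> nj sf; apply: (smooth_eq (near_Dz sf)).
by apply: smooth_vf => // v; exact: smooth_Xz.
Qed.

Lemma Dy_eq f g j : smooth j f -> (\forall w \near j, f w = g w) -> Dy f j = Dy g j.
Proof.
by move=> sf fg; rewrite !Dy_vf //; [exact: vf_eq|exact: smooth_eq sf].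
Qed.

Lemma Dz_eq f g j : smooth j f -> (\forall w \near j, f w = g w) -> Dz f j = Dz g j.
Proof.
by move=> sf fg; rewrite !Dz_vf //; [exact: vf_eq|exact: smooth_eq sf].
Qed.

Lemma Dx_eq f g j : smooth j f -> (\forall w \near j, f w = g w) -> Dx f j = Dx g j.
Proof.
by move=> sf fg; rewrite !Dx_vf //; [exact: vf_eq|exact: smooth_eq sf].
Qed.

Lemma V1V2 j : V i1 j = V i2 j + 2.
Proof. by rewrite V1E V2E; ring. Qed.

(** The two scalar identities of [vf_comm_combination] follow from V^1 - V^2 = 2 and from the
    formula for D_t r^i_1 that the system provides. *)
Lemma DyDz f j : jet_regular j -> smooth j f -> Dy (Dz f) j = Dz (Dy f) j.
Proof.
move=> nj sf; have [u0 v0] := nj.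
rewrite -(Dy_eq _ (near_Dz sf)) -?(Dz_eq _ (near_Dy sf)); last 2 first.
- by apply: smooth_vf => // w; exact: smooth_Xy.
- by apply: smooth_vf => // w; exact: smooth_Xz.
rewrite Dy_vf ?Dz_vf; last 2 first.
- by apply: smooth_vf => // w; exact: smooth_Xy.
- by apply: smooth_vf => // w; exact: smooth_Xz.
have AE g : smooth j g -> vf Xy g j = - (j (Jr i1 1))^-1 * vf Xt g j +
    - (j (Jr i1 1))^-1 * V i2 j * vf Xx g j by exact: vf_linear.
have BE g : smooth j g -> vf Xz g j = - (j (Jr i2 1))^-1 * vf Xt g j +
    - (j (Jr i2 1))^-1 * V i1 j * vf Xx g j by exact: vf_linear.
apply: (@vf_comm_combination R jetvar Xt Xx (fun j => - (j (Jr i1 1))^-1)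
  (fun j => - (j (Jr i1 1))^-1 * V i2 j) (fun j => - (j (Jr i2 1))^-1)
  (fun j => - (j (Jr i2 1))^-1 * V i1 j) f j); [smooth|smooth|smooth|smooth|smooth|smooth|exact: sf|move=> w; exact: vf_XtXx| |].
- rewrite AE ?BE; [|smooth|smooth].
  vf_expand; rewrite -!vf_coord !vf_Xt_r1 !vf_Xx_r !V1V2; field.
  by rewrite u0 v0.
- rewrite AE ?BE; [|smooth|smooth].
  vf_expand; rewrite -!vf_coord !vf_Xt_r1 !vf_Xx_r !vf_Xt_V !vf_Xx_V !V1V2; field.
  by rewrite u0 v0.
Qed.

Definition half_gap j : R := expR ((r i1 0 j - r i2 0 j) / 2).

Lemma smooth_half_gap j : smooth j half_gap.
Proof. by cbv beta delta [half_gap r]; smooth. Qed.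

Lemma smooth_qt j : smooth j qt.
Proof. by cbv beta delta [qt r]; smooth. Qed.

Ltac smooth_lemma ::= first [simple apply smooth_Xx | simple apply smooth_Dx |
  simple apply smooth_r | simple apply smooth_V | simple apply smooth_Xt |
  simple apply smooth_Dt | simple apply smooth_half_gap | simple apply smooth_qt]; smooth.

Lemma vf_Xx_half_gap j :
  vf Xx half_gap j = half_gap j * ((j (Jr i1 1) - j (Jr i2 1)) / 2).
Proof. by cbv beta delta [half_gap r]; vf_expand; rewrite mulr0 addr0. Qed.

Lemma vf_Xt_half_gap j : vf Xt half_gap j =
  half_gap j * ((V i2 j * j (Jr i2 1) - V i1 j * j (Jr i1 1)) / 2).
Proof.
cbv beta delta [half_gap r]; vf_expand; rewrite mulr0 addr0 /Xt /= /r; congr (_ * _).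
by rewrite opprK addrC.
Qed.

Lemma qtE : qt = (fun j => half_gap j * (j Jx + - (V i1 j * j Jt))).
Proof. by apply/funext => j; rewrite /qt V1E. Qed.

Lemma DyE f j : jet_regular j -> smooth j f ->
  Dy f j = - (j (Jr i1 1))^-1 * (vf Xt f j + V i2 j * vf Xx f j).
Proof. by move=> nj sf; rewrite -Dx_vf // -Dt_vf. Qed.

Lemma DzE f j : jet_regular j -> smooth j f ->
  Dz f j = - (j (Jr i2 1))^-1 * (vf Xt f j + V i1 j * vf Xx f j).
Proof. by move=> nj sf; rewrite -Dx_vf // -Dt_vf. Qed.

Ltac jet_field := vf_expand; rewrite ?vf_Xt_half_gap ?vf_Xx_half_gap
  ?vf_Xt_V ?vf_Xx_V /= /cst ?V1V2; field.

Lemma Dz_qt j : jet_regular j -> Dz qt j = qt j + 2 * (j Jt * half_gap j).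
Proof.
move=> nj; have [u0 v0] := nj; rewrite (DzE nj); last by smooth.
by rewrite qtE; jet_field; exact: v0.
Qed.

Lemma Dy_qt j : jet_regular j ->
  Dy qt j = qt j - 2 * (j Jt * half_gap j) + 2 * half_gap j / j (Jr i1 1).
Proof.
move=> nj; have [u0 v0] := nj; rewrite (DyE nj); last by smooth.
by rewrite qtE; jet_field; exact: u0.
Qed.

Lemma near_Dz_qt j : jet_regular j ->
  \forall w \near j, qt w + 2 * (w Jt * half_gap w) = Dz qt w.
Proof.
move=> nj; apply: filterS (near_jet_regular nj) => w nw.
by rewrite Dz_qt.
Qed.

Lemma Dy_Dz_qt j : jet_regular j -> Dy (Dz qt) j = qt j.
Proof.
move=> nj; have [u0 v0] := nj.
rewrite -(Dy_eq _ (near_Dz_qt nj)); last by smooth.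
rewrite (DyE nj); last by smooth.
by rewrite qtE; jet_field; exact: u0.
Qed.

Lemma Dz_Dz_qt j : jet_regular j -> Dz (Dz qt) j =
  qt j + 4 * (j Jt * half_gap j) - 2 * half_gap j / j (Jr i2 1).
Proof.
move=> nj; have [u0 v0] := nj.
rewrite -(Dz_eq _ (near_Dz_qt nj)); last by smooth.
rewrite (DzE nj); last by smooth.
by rewrite qtE; jet_field; exact: v0.
Qed.

Definition qk (k : int) : jet -> R :=
  match k with Posz n => iter n Dy qt | Negz n => iter n.+1 Dz qt end.

Lemma smooth_qk k j : jet_regular j -> smooth j (qk k).
Proof.
case: k => n nj.
  elim: n => [|n IHn]; [exact: smooth_qt|exact: smooth_Dy].
suff : smooth j (iter n.+1 Dz qt) by [].
elim: n.+1 => [|m IHm]; [exact: smooth_qt|exact: smooth_Dz].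
Qed.

(** For negative k, D_y is moved past the powers of D_z and cancels one of them by D_y D_z q = q. On
    the two-sided sequence of the q_k the operators D_y and D_z are therefore inverse shifts. *)
Lemma Dy_qk k j : jet_regular j -> Dy (qk k) j = qk (k + 1) j.
Proof.
case: k => n; first by rewrite addrC; have -> : 1 + n%:Z = Posz n.+1 by lia.
have -> : Negz n + 1 = - n%:Z by rewrite NegzE; lia.
have -> : qk (- n%:Z) = iter n Dz qt by case: n.
elim: n j => [|n IHn] j nj; first exact: Dy_Dz_qt.
change (Dy (Dz (qk (Negz n))) j = iter n.+1 Dz qt j).
rewrite (DyDz nj (smooth_qk _ nj)); apply: Dz_eq.
  by apply: smooth_Dy => //; exact: smooth_qk.
by apply: filterS (near_jet_regular nj) => w; exact: IHn.
Qed.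

Lemma Dz_qk k j : jet_regular j -> Dz (qk k) j = qk (k - 1) j.
Proof.
case: k => n; last first.
  by have -> : Negz n - 1 = Negz n.+1 by rewrite !NegzE; lia.
case: n => [|n]; first by [].
have -> : Posz n.+1 - 1 = n by lia.
elim: n j => [|n IHn] j nj.
  by rewrite -(DyDz nj (smooth_qk 0 nj)) Dy_Dz_qt.
change (Dz (Dy (qk (Posz n.+1))) j = iter n.+1 Dy qt j).
rewrite -(DyDz nj (smooth_qk _ nj)); apply: Dy_eq.
  by apply: smooth_Dz => //; exact: smooth_qk.
by apply: filterS (near_jet_regular nj) => w; exact: IHn.
Qed.

Definition D3 f j : R := Dt f j + V i3 j * Dx f j.

Lemma vf_D3 f j : smooth j f ->
  D3 f j = vf (fun v j => cst 1 j * Xt v j + V i3 j * Xx v j) f j.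
Proof.
by move=> sf; rewrite (vf_linear _ _ _ _ sf) /D3 Dt_vf // Dx_vf // mul1r.
Qed.

Lemma smooth_omega k j : smooth j (omega k).
Proof.
elim: k => [|k IHk]; first exact: smooth_coord.
rewrite /omega iterS -/(omega k); cbv beta delta [r]; smooth.
Qed.

(** The operators D_t + V^3 D_x and e^(r2 - r1) D_x commute: the derivative of e^(r2 - r1) along the
    third characteristic equals e^(r2 - r1) D_x V^3. As r^3 is constant along this characteristic,
    so is every omega^k. *)
Lemma D3_omega k j : D3 (omega k) j = 0.
Proof.
elim: k j => [|k IHk] j.
  rewrite /D3 Dt_vf ?Dx_vf; [|exact: smooth_coord|exact: smooth_coord].
  by rewrite /omega /= !vf_coord /= /r addNr.
have sk := smooth_omega k j.
pose A v (j : jet) : R := (cst 1 j * Xt v j + V i3 j * Xx v j).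
pose B v (j : jet) : R := (cst 0 j * Xt v j + expR (j (Jr i2 0) - j (Jr i1 0)) * Xx v j).
have sA v : smooth j (A v) by rewrite /A; smooth.
have sB v : smooth j (B v) by rewrite /B; smooth.
have BE f w : smooth w f -> vf B f w = expR (w (Jr i2 0) - w (Jr i1 0)) * vf Xx f w.
  by move=> sf; rewrite (vf_linear _ _ _ _ sf) mul0r add0r.
have AE f w : smooth w f -> vf A f w = vf Xt f w + V i3 w * vf Xx f w.
  by move=> sf; rewrite (vf_linear _ _ _ _ sf) mul1r.
rewrite vf_D3; last exact: smooth_omega.
have -> : vf A (omega k.+1) j = vf A (vf B (omega k)) j.
  apply: vf_eq; near=> w; rewrite BE; last exact: smooth_omega.
  by rewrite /omega iterS -/(omega k) Dx_vf //; exact: smooth_omega.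
have -> : vf A (vf B (omega k)) j = vf B (vf A (omega k)) j.
  apply: (@vf_comm_combination R jetvar Xt Xx (cst 1) (V i3) (cst 0)
    (fun j => expR (j (Jr i2 0) - j (Jr i1 0))) (omega k) j);
    [smooth|smooth|smooth|smooth|smooth|smooth|exact: sk|move=> v; exact: vf_XtXx| |].
    by rewrite !vf_cst.
  rewrite -/A -/B AE ?BE; [|smooth|smooth].
  vf_expand; rewrite vf_Xx_V /= !V3E /r V1V2 V2E; ring.
have : \forall w \near j, vf A (omega k) w = cst 0 w.
  by near=> w; rewrite -(IHk w) vf_D3 //; exact: smooth_omega.
by move/vf_eq ->; exact: vf_cst.
Unshelve. all: by end_near. Qed.

Lemma Dx_omega k j : Dx (omega k) j = expR (j (Jr i1 0) - j (Jr i2 0)) * omega k.+1 j.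
Proof.
rewrite /omega iterS -/(omega k) mulrA -expRD /r.
by rewrite -opprB addNr expR0 mul1r.
Qed.

(** On functions constant along the third characteristic D_t = -V^3 D_x. With V^2 - V^3 = -1 and V^1
    - V^3 = 1, D_y and D_z become multiples of D_x there. *)
Lemma Dy_omega k j : jet_regular j ->
  Dy (omega k) j = expR (j (Jr i1 0) - j (Jr i2 0)) / j (Jr i1 1) * omega k.+1 j.
Proof.
move=> [u0 _]; have := D3_omega k j; rewrite /D3 => /(canRL (addrK _)).
rewrite /Dy /r => ->; rewrite V3E V2E !Dx_omega; field; exact: u0.
Qed.

Lemma Dz_omega k j : jet_regular j ->
  Dz (omega k) j = - (expR (j (Jr i1 0) - j (Jr i2 0)) / j (Jr i2 1) * omega k.+1 j).
Proof.
move=> [_ v0]; have := D3_omega k j; rewrite /D3 => /(canRL (addrK _)).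
rewrite /Dz /r => ->; rewrite V3E V1E !Dx_omega; field; exact: v0.
Qed.

End JetSpace.

(** * Klein-Gordon coordinates *)

(* [Ny] = r1/2, [Nz] = -r2/2; [Nq k] is D_y^k q for k >= 0 and D_z^(-k) q for
   k <= 0, where q_yz = q; [Nw k] is omega^k. *)
Inductive kgvar := Ny | Nz | Nq of int | Nw of nat.
HB.instance Definition _ := gen_eqMixin kgvar.
HB.instance Definition _ := gen_choiceMixin kgvar.

Section KleinGordonSpace.
Context {R : realType}.
Local Notation kg := {ptws kgvar -> R}.
Implicit Types (w : kg) (f g : kg -> R).

Definition Ek w : R := expR (w Ny + w Nz).
(** The formulas D_y q = q - 2 t E + 2 E / r1_x, D_z q = q + 2 t E and D_z^2 q = q + 4 t E - 2 E /
    r2_x, with t eliminated, express -E^2 / r1_x and -E^2 / r2_x as E times linear combinations of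
    the q_k. *)
Definition Sk w : R := Ek w * (2 * w (Nq 0) - w (Nq 1) - w (Nq (-1))) / 2.
Definition Tk w : R := Ek w * (w (Nq (-2)) - 2 * w (Nq (-1)) + w (Nq 0)) / 2.

Definition Yy (v : kgvar) : kg -> R :=
  match v with
  | Ny => cst 1 | Nz => cst 0 | Nq k => fun w => w (Nq (k + 1))
  | Nw k => fun w => - Sk w * w (Nw k.+1)
  end.

Definition Yz (v : kgvar) : kg -> R :=
  match v with
  | Ny => cst 0 | Nz => cst 1 | Nq k => fun w => w (Nq (k - 1))
  | Nw k => fun w => Tk w * w (Nw k.+1)
  end.

(** The operator hat A of the first family, acting on functions of all coordinates. *)
Definition Ya (v : kgvar) : kg -> R :=
  if v is Nw k then fun w => w (Nw k.+1) else cst 0.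

Local Notation hDy := (vf Yy).
Local Notation hDz := (vf Yz).

Lemma smooth_Ek w : smooth w Ek.
Proof. by cbv beta delta [Ek]; smooth. Qed.
Ltac smooth_lemma ::= first [simple apply smooth_Ek]; smooth.

Lemma smooth_Sk w : smooth w Sk.
Proof. by cbv beta delta [Sk]; smooth. Qed.

Lemma smooth_Tk w : smooth w Tk.
Proof. by cbv beta delta [Tk]; smooth. Qed.
Ltac smooth_lemma ::= first [simple apply smooth_Ek | simple apply smooth_Sk |
  simple apply smooth_Tk]; smooth.

Lemma smooth_Yy w v : smooth w (Yy v).
Proof. by case: v => [||k|k] /=; smooth. Qed.

Lemma smooth_Yz w v : smooth w (Yz v).
Proof. by case: v => [||k|k] /=; smooth. Qed.

Lemma smooth_Ya w v : smooth w (Ya v).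
Proof. by case: v => [||k|k] /=; smooth. Qed.
Ltac smooth_lemma ::= first [simple apply smooth_Ek | simple apply smooth_Sk |
  simple apply smooth_Tk | simple apply smooth_Yy | simple apply smooth_Yz |
  simple apply smooth_Ya]; smooth.

Lemma vf_Yy_Ek w : hDy Ek w = Ek w.
Proof. by cbv beta delta [Ek]; vf_expand; rewrite /= addr0 mulr1. Qed.

Lemma vf_Yz_Ek w : hDz Ek w = Ek w.
Proof. by cbv beta delta [Ek]; vf_expand; rewrite /= add0r mulr1. Qed.

Lemma small_int : [/\ 0 - 1 = -1 :> int, 1 - 1 = 0 :> int, -1 - 1 = -2 :> int &
  [/\ 0 + 1 = 1 :> int, -1 + 1 = 0 :> int & -2 + 1 = -1 :> int]].
Proof. by []. Qed.

Lemma vf_Yz_Sk w : hDz Sk w = Sk w - Tk w.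
Proof.
cbv beta delta [Sk]; have [e1 e2 e3 _] := small_int.
by vf_expand; rewrite vf_Yz_Ek /= /Tk e1 e2 e3; field.
Qed.

Lemma vf_Yy_Tk w : hDy Tk w = Tk w - Sk w.
Proof.
cbv beta delta [Tk]; have [_ _ _ [e1 e2 e3]] := small_int.
by vf_expand; rewrite vf_Yy_Ek /= /Sk e1 e2 e3; field.
Qed.

(** At q_k the two shifts commute; at omega^k the identity amounts to D_y T = -D_z S. Both hold on
    the whole coordinate space, also where S or T vanishes. *)
Lemma hDyhDz_coord v w : vf Yy (Yz v) w = vf Yz (Yy v) w.
Proof.
case: v => [||k|k] /=; rewrite ?vf_cst // ?vf_coord /= ?subrK ?addrK //.
by vf_expand; rewrite vf_Yy_Tk vf_Yz_Sk /=; ring.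
Qed.

Lemma hDyhDz f w : smooth w f -> hDy (hDz f) w = hDz (hDy f) w.
Proof.
move=> sf; apply/eqP; rewrite -subr_eq0; apply/eqP.
rewrite (vf_comm (@smooth_Yy w) (@smooth_Yz w) sf).
by apply: vf_zero => v; rewrite hDyhDz_coord subrr.
Qed.

(** [hr1x], [hr2x] and [hV] are r1_x, r2_x and V^3 = r1 + r2 in the new coordinates. *)
Definition hr1x w : R := - (Ek w ^+ 2 / Sk w).
Definition hr2x w : R := - (Ek w ^+ 2 / Tk w).
Definition hV w : R := 2 * w Ny - 2 * w Nz.

Definition kg_regular w : Prop := Sk w != 0 /\ Tk w != 0.

Lemma near_neq0 (I : choiceType) (f : {ptws I -> R} -> R) z : smooth z f -> f z != 0 ->
  \forall w \near z, f w != 0.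
Proof.
move=> /smooth_C1[cf _] fz; exact: (cf _ (open_nbhs_nbhs (conj (@open_neq R 0) fz))).
Qed.

Lemma near_kg_regular w : kg_regular w ->
  \forall w' \near w, kg_regular w'.
Proof.
move=> [/(near_neq0 (smooth_Sk w)) Sw /(near_neq0 (smooth_Tk w)) Tw].
exact: (@filterS2 _ (nbhs w) _ _ _ _ (fun w a b => conj a b) Sw Tw).
Qed.

Lemma smooth_hr1x w : kg_regular w -> smooth w hr1x.
Proof. by move=> [S0 T0]; cbv beta delta [hr1x]; under eq_fun do rewrite expr2; smooth. Qed.

Lemma smooth_hr2x w : kg_regular w -> smooth w hr2x.
Proof. by move=> [S0 T0]; cbv beta delta [hr2x]; under eq_fun do rewrite expr2; smooth. Qed.

Lemma smooth_hV w : smooth w hV.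
Proof. by cbv beta delta [hV]; smooth. Qed.

Lemma hr1x_neq0 w : kg_regular w -> hr1x w != 0.
Proof.
by move=> [S0 T0]; rewrite oppr_eq0 mulf_neq0 ?invr_eq0 // expf_neq0 // gt_eqF ?expR_gt0.
Qed.

Lemma hr2x_neq0 w : kg_regular w -> hr2x w != 0.
Proof.
by move=> [S0 T0]; rewrite oppr_eq0 mulf_neq0 ?invr_eq0 // expf_neq0 // gt_eqF ?expR_gt0.
Qed.

Lemma vf_Yz_hr1x w : kg_regular w ->
  hDz hr1x w = hr1x w * (hr1x w + hr2x w) / hr2x w.
Proof.
move=> [S0 T0]; have E0 : Ek w != 0 by rewrite gt_eqF ?expR_gt0.
have -> : hDz hr1x w = hDz (fun w => - (Ek w * Ek w * (Sk w)^-1)) w.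
  by apply: vf_eq; near=> w'; rewrite /hr1x expr2.
vf_expand; rewrite vf_Yz_Ek vf_Yz_Sk /hr1x /hr2x; field.
by rewrite S0 T0 E0.
Unshelve. all: by end_near. Qed.

Lemma vf_Yy_hr2x w : kg_regular w ->
  hDy hr2x w = hr2x w * (hr1x w + hr2x w) / hr1x w.
Proof.
move=> [S0 T0]; have E0 : Ek w != 0 by rewrite gt_eqF ?expR_gt0.
have -> : hDy hr2x w = hDy (fun w => - (Ek w * Ek w * (Tk w)^-1)) w.
  by apply: vf_eq; near=> w'; rewrite /hr2x expr2.
vf_expand; rewrite vf_Yy_Ek vf_Yy_Tk /hr1x /hr2x; field.
by rewrite S0 T0 E0.
Unshelve. all: by end_near. Qed.

End KleinGordonSpace.

(** * Passage between jets and Klein-Gordon coordinates *)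

Section ChangeOfCoordinates.
Context {R : realType}.
Local Notation kg := {ptws kgvar -> R}.
Local Notation jet := {ptws jetvar -> R}.
Local Notation hDy := (vf (@Yy R)).
Local Notation hDz := (vf (@Yz R)).
Implicit Types (w : kg) (j : jet).

(** The definitions of D_y and D_z solved for D_x and D_t: since V^1 - V^2 = 2, one has 2 D_x = r1_x
    D_y - r2_x D_z, and D_t follows. *)
Definition Xhx (v : kgvar) w : R :=
  hr1x w * 2^-1 * Yy v w + - hr2x w * 2^-1 * Yz v w.
Definition Xht (v : kgvar) w : R :=
  - (hV w + 1) * hr1x w * 2^-1 * Yy v w + (hV w + -1) * hr2x w * 2^-1 * Yz v w.
Local Notation hDx := (vf Xhx).
Local Notation hDt := (vf Xht).

Ltac smooth_lemma ::= first [simple apply smooth_Ek | simple apply smooth_Sk |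
  simple apply smooth_Tk | simple apply smooth_Yy | simple apply smooth_Yz |
  simple apply smooth_Ya | simple apply smooth_hV |
  simple apply smooth_hr1x; assumption | simple apply smooth_hr2x; assumption]; smooth.

Lemma smooth_Xhx v w : kg_regular w -> smooth w (Xhx v).
Proof. by move=> nw; cbv beta delta [Xhx]; smooth. Qed.

Lemma hDxE f w : smooth w f ->
  hDx f w = hr1x w * 2^-1 * hDy f w + - hr2x w * 2^-1 * hDz f w.
Proof. exact: vf_linear. Qed.

Lemma hDtE f w : smooth w f ->
  hDt f w = - (hV w + 1) * hr1x w * 2^-1 * hDy f w +
            (hV w + -1) * hr2x w * 2^-1 * hDz f w.
Proof. exact: vf_linear. Qed.

Lemma vf_Yy_hV w : hDy hV w = 2.
Proof. by cbv beta delta [hV]; vf_expand => /=; rewrite /cst; ring. Qed.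

Lemma vf_Yz_hV w : hDz hV w = - 2.
Proof. by cbv beta delta [hV]; vf_expand => /=; rewrite /cst; ring. Qed.

Lemma hDthDx f w : kg_regular w -> smooth w f -> hDt (hDx f) w = hDx (hDt f) w.
Proof.
move=> nw sf; have [u0 v0] := (hr1x_neq0 nw, hr2x_neq0 nw).
apply: (@vf_comm_combination R kgvar Yy Yz (fun w => - (hV w + 1) * hr1x w * 2^-1)
  (fun w => (hV w + -1) * hr2x w * 2^-1) (fun w => hr1x w * 2^-1)
  (fun w => - hr2x w * 2^-1) f w);
  [smooth|smooth|smooth|smooth|smooth|smooth|exact: sf|move=> v; exact: hDyhDz_coord| |].
- rewrite -/(hDt _ _) -/(hDx _ _) hDtE; last by smooth.
  rewrite hDxE; last by smooth.
  vf_expand; rewrite vf_Yy_hV vf_Yz_hV vf_Yz_hr1x //; field; exact: v0.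
- rewrite -/(hDt _ _) -/(hDx _ _) hDtE; last by smooth.
  rewrite hDxE; last by smooth.
  vf_expand; rewrite vf_Yy_hV vf_Yz_hV vf_Yy_hr2x //; field; exact: u0.
Qed.

(** The relation D_z q = q + 2 t E is solved for t, and the definition of q for x; [hV w + 1] is
    V^1. *)
Definition ht w : R := (w (Nq (-1)) - w (Nq 0)) * (2 * Ek w)^-1.
Definition hx w : R := w (Nq 0) * (Ek w)^-1 + (hV w + 1) * ht w.
Definition hr0 (i : 'I_3) : kg -> R :=
  tnth [tuple (fun w => 2 * w Ny); (fun w => - 2 * w Nz); (fun w => w (Nw 0))] i.

(** Only r^1, r^2, r^3 are prescribed and higher jets are their images under powers of D_x, so that
    on the jets of the unknowns [Psi] respects D_x by definition. *)
Definition Psi w : jet := fun v =>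
  match v with Jt => ht w | Jx => hx w | Jr i k => iter k hDx (hr0 i) w end.

Lemma Ek_neq0 w : Ek w != 0.
Proof. by rewrite gt_eqF ?expR_gt0. Qed.

Lemma Ek2_neq0 w : 2 * Ek w != 0.
Proof. by rewrite mulf_neq0 ?Ek_neq0 // pnatr_eq0. Qed.

Lemma smooth_ht w : smooth w ht.
Proof. by have := Ek2_neq0 w; cbv beta delta [ht] => E0; smooth. Qed.

Lemma smooth_hx w : smooth w hx.
Proof.
have E0 := Ek_neq0 w; have st := smooth_ht w.
by cbv beta delta [hx]; smooth.
Qed.

Lemma smooth_hr0 i w : smooth w (hr0 i).
Proof. by case: i => [[|[|[|//]]] i3]; rewrite /hr0 (tnth_nth (cst 0)) /=; smooth. Qed.

Lemma smooth_iter_hDx k f w : kg_regular w ->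
  (forall w, kg_regular w -> smooth w f) -> smooth w (iter k hDx f).
Proof.
move=> nw sf; elim: k => [|k IHk]; first exact: sf.
by apply: smooth_vf => // v; exact: smooth_Xhx.
Qed.

Lemma iter_hDx_eq k f g w : kg_regular w ->
  (forall w, kg_regular w -> f w = g w) -> iter k hDx f w = iter k hDx g w.
Proof.
move=> nw fg; elim: k w nw => [|k IHk] w nw; first exact: fg.
by apply: vf_eq; apply: filterS (near_kg_regular nw) => w'; exact: IHk.
Qed.

Lemma smooth_Psi v w : kg_regular w -> smooth w (fun w => Psi w v).
Proof.
move=> nw; case: v => [||i k] /=; [exact: smooth_ht|exact: smooth_hx|].
by apply: smooth_iter_hDx => // w' _; exact: smooth_hr0.
Qed.

Lemma vf_Yy_ht w : hDy ht w = Sk w / Ek w ^+ 2.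
Proof.
have E0 := Ek_neq0 w; have E20 := Ek2_neq0 w; have [_ _ _ [e1 e2 e3]] := small_int.
cbv beta delta [ht]; vf_expand; rewrite vf_Yy_Ek /= /Sk e1 e2; field; exact: E0.
Qed.

Lemma vf_Yz_ht w : hDz ht w = Tk w / Ek w ^+ 2.
Proof.
have E0 := Ek_neq0 w; have E20 := Ek2_neq0 w; have [e1 e2 e3 _] := small_int.
cbv beta delta [ht]; vf_expand; rewrite vf_Yz_Ek /= /Tk e1 e3; field; exact: E0.
Qed.

Lemma vf_Yy_hx w : hDy hx w = (hV w - 1) * (Sk w / Ek w ^+ 2).
Proof.
have E0 := Ek_neq0 w; have st := smooth_ht w; have [_ _ _ [e1 e2 e3]] := small_int.
cbv beta delta [hx]; vf_expand.
rewrite vf_Yy_Ek vf_Yy_hV vf_Yy_ht /= /ht /Sk e1; field; exact: E0.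
Qed.

Lemma vf_Yz_hx w : hDz hx w = (hV w + 1) * (Tk w / Ek w ^+ 2).
Proof.
have E0 := Ek_neq0 w; have st := smooth_ht w; have [e1 e2 e3 _] := small_int.
cbv beta delta [hx]; vf_expand.
rewrite vf_Yz_Ek vf_Yz_hV vf_Yz_ht /= /ht /Tk e1; field; exact: E0.
Qed.

Lemma Psi_Xx v w : kg_regular w -> vf Xhx (fun w => Psi w v) w = Xx v (Psi w).
Proof.
move=> nw; have [S0 T0] := nw; have E0 := Ek_neq0 w.
case: v => [||i k] //=.
- rewrite (hDxE (smooth_ht w)) vf_Yy_ht vf_Yz_ht /hr1x /hr2x /cst; field.
  by rewrite S0 T0 E0.
- rewrite (hDxE (smooth_hx w)) vf_Yy_hx vf_Yz_hx /hr1x /hr2x /cst; field.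
  by rewrite S0 T0 E0.
Qed.

Lemma iter_Dx_Psi k g w : kg_regular w -> (forall j, smooth j g) ->
  iter k Dx g (Psi w) = iter k hDx (g \o Psi) w.
Proof.
move=> nw sg; elim: k w nw => [//|k IHk] w nw.
rewrite !iterS Dx_vf; last exact: smooth_iter_Dx.
rewrite -(vf_comp (X := Xhx) (fun v => smooth_Psi v nw) _ (fun v => Psi_Xx v nw)).
  by apply: vf_eq; apply: filterS (near_kg_regular nw) => w'; exact: IHk.
exact: smooth_iter_Dx.
Qed.

Lemma V_Psi i w : V i (Psi w) = hV w + tnth [tuple 1; -1; 0] i.
Proof. by rewrite /V /r /= /hr0 !(tnth_nth (cst 0)) /= /hV; ring. Qed.

Lemma hDt_hr0 i w : kg_regular w ->
  hDt (hr0 i) w = - (V i (Psi w) * r i 1 (Psi w)).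
Proof.
move=> nw; have [S0 T0] := nw; have E0 := Ek_neq0 w.
rewrite V_Psi /r /= hDtE ?hDxE; [|exact: smooth_hr0|exact: smooth_hr0].
case: i => [[|[|[|//]]] i3]; rewrite /hr0 !(tnth_nth (cst 0)) (tnth_nth 0) /=; vf_expand;
  rewrite /= /cst; [by field|by field|].
rewrite /hr1x /hr2x; field; by rewrite S0 T0.
Qed.

Lemma hDt_iter_hDx k f w : kg_regular w ->
  (forall w, kg_regular w -> smooth w f) ->
  hDt (iter k hDx f) w = iter k hDx (hDt f) w.
Proof.
move=> nw sf; elim: k w nw => [//|k IHk] w nw.
rewrite !iterS hDthDx //; last exact: smooth_iter_hDx.
by apply: vf_eq; apply: filterS (near_kg_regular nw) => w'; exact: IHk.
Qed.

Lemma iter_hDxN k f w : kg_regular w ->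
  (forall w, kg_regular w -> smooth w f) ->
  iter k hDx (fun w => - f w) w = - iter k hDx f w.
Proof.
move=> nw sf; elim: k w nw => [//|k IHk] w nw.
rewrite !iterS -vfN; last exact: smooth_iter_hDx.
by apply: vf_eq; apply: filterS (near_kg_regular nw) => w'; exact: IHk.
Qed.

(** Since D_t and D_x commute, the components at r^i_k follow from those at order zero, which are
    the three equations of the system. *)
Lemma Psi_Xt v w : kg_regular w -> vf Xht (fun w => Psi w v) w = Xt v (Psi w).
Proof.
move=> nw; have [S0 T0] := nw; have E0 := Ek_neq0 w.
case: v => [||i k] /=.
- rewrite (hDtE (smooth_ht w)) vf_Yy_ht vf_Yz_ht /hr1x /hr2x /cst; field.
  by rewrite S0 T0 E0.
- rewrite (hDtE (smooth_hx w)) vf_Yy_hx vf_Yz_hx /hr1x /hr2x /cst; field.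
  by rewrite S0 T0 E0.
- have sg j : smooth j (fun j => V i j * r i 1 j).
    by apply: smoothM; [exact: smooth_V|exact: smooth_r].
  have sgP w' : kg_regular w' -> smooth w' ((fun j => V i j * r i 1 j) \o Psi).
    by move=> nw'; apply: smooth_comp => // v; exact: smooth_Psi.
  rewrite iter_Dx_Psi // -iter_hDxN // hDt_iter_hDx //; last first.
    by move=> w' _; exact: smooth_hr0.
  by apply: iter_hDx_eq => // w' nw'; exact: hDt_hr0.
Qed.

Definition Phi j : kg := fun v =>
  match v with
  | Ny => j (Jr i1 0) * 2^-1 | Nz => - j (Jr i2 0) * 2^-1
  | Nq k => qk k j | Nw k => omega k j
  end.

Lemma smooth_Phi v j : jet_regular j -> smooth j (fun j => Phi j v).
Proof.
move=> nj; case: v => [||k|k] /=; [by smooth|by smooth|exact: smooth_qk|exact: smooth_omega].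
Qed.

Lemma Ek_Phi j : Ek (Phi j) = half_gap j.
Proof. by rewrite /Ek /half_gap /= /r; congr expR; field. Qed.

Lemma half_gap_sq j : half_gap j ^+ 2 = expR (j (Jr i1 0) - j (Jr i2 0)).
Proof. by rewrite /half_gap expr2 -expRD -splitr. Qed.

Lemma Phi_q j : [/\ Phi j (Nq 0) = qt j, Phi j (Nq 1) = Dy qt j,
  Phi j (Nq (-1)) = Dz qt j & Phi j (Nq (-2)) = Dz (Dz qt) j].
Proof. by []. Qed.

Lemma Sk_Phi j : jet_regular j -> Sk (Phi j) = - half_gap j ^+ 2 / j (Jr i1 1).
Proof.
move=> nj; have [u0 v0] := nj; have [q0 q1 qm1 _] := Phi_q j.
by rewrite /Sk Ek_Phi q0 q1 qm1 Dy_qt // Dz_qt //; field; exact: u0.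
Qed.

Lemma Tk_Phi j : jet_regular j -> Tk (Phi j) = - half_gap j ^+ 2 / j (Jr i2 1).
Proof.
move=> nj; have [u0 v0] := nj; have [q0 _ qm1 qm2] := Phi_q j.
by rewrite /Tk Ek_Phi q0 qm1 qm2 Dz_Dz_qt // Dz_qt //; field; exact: v0.
Qed.

Lemma half_gap_neq0 j : half_gap j != 0.
Proof. by rewrite gt_eqF ?expR_gt0. Qed.

Lemma Phi_regular j : jet_regular j -> kg_regular (Phi j).
Proof.
move=> nj; have [u0 v0] := nj; split.
  by rewrite Sk_Phi // mulf_neq0 ?invr_eq0 // oppr_eq0 expf_neq0 // half_gap_neq0.
by rewrite Tk_Phi // mulf_neq0 ?invr_eq0 // oppr_eq0 expf_neq0 // half_gap_neq0.
Qed.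

Lemma hr1x_Phi j : jet_regular j -> hr1x (Phi j) = j (Jr i1 1).
Proof.
move=> nj; have [u0 v0] := nj; have h0 := half_gap_neq0 j.
by rewrite /hr1x Sk_Phi // Ek_Phi; field; rewrite h0 u0.
Qed.

Lemma hr2x_Phi j : jet_regular j -> hr2x (Phi j) = j (Jr i2 1).
Proof.
move=> nj; have [u0 v0] := nj; have h0 := half_gap_neq0 j.
by rewrite /hr2x Tk_Phi // Ek_Phi; field; rewrite h0 v0.
Qed.

Lemma Phi_Yy v j : jet_regular j -> vf Xy (fun j => Phi j v) j = Yy v (Phi j).
Proof.
move=> nj; have [u0 v0] := nj; rewrite -Dy_vf; last exact: smooth_Phi.
case: v => [||k|k] /=.
- rewrite DyE //; last by smooth.
  by vf_expand; rewrite /= /r V1V2 /cst; field; exact: u0.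
- rewrite DyE //; last by smooth.
  by vf_expand; rewrite /= /r /cst; field; exact: u0.
- exact: Dy_qk.
- rewrite -[X in _ * X]/(omega k.+1 j) Dy_omega // Sk_Phi // -half_gap_sq.
  by field; exact: u0.
Qed.

Lemma Phi_Yz v j : jet_regular j -> vf Xz (fun j => Phi j v) j = Yz v (Phi j).
Proof.
move=> nj; have [u0 v0] := nj; rewrite -Dz_vf; last exact: smooth_Phi.
case: v => [||k|k] /=.
- rewrite DzE //; last by smooth.
  by vf_expand; rewrite /= /r /cst; field; exact: v0.
- rewrite DzE //; last by smooth.
  by vf_expand; rewrite /= /r V1V2 /cst; field; exact: v0.
- exact: Dz_qk.
- rewrite -[X in _ * X]/(omega k.+1 j) Dz_omega // Tk_Phi // -half_gap_sq.
  by field; exact: v0.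
Qed.

Lemma Dy_comp_Phi f j : jet_regular j -> smooth (Phi j) f ->
  Dy (f \o Phi) j = hDy f (Phi j).
Proof.
move=> nj sf; rewrite Dy_vf; last by apply: smooth_comp => // v; exact: smooth_Phi.
by apply: vf_comp => // v; [exact: smooth_Phi|exact: Phi_Yy].
Qed.

Lemma Dz_comp_Phi f j : jet_regular j -> smooth (Phi j) f ->
  Dz (f \o Phi) j = hDz f (Phi j).
Proof.
move=> nj sf; rewrite Dz_vf; last by apply: smooth_comp => // v; exact: smooth_Phi.
by apply: vf_comp => // v; [exact: smooth_Phi|exact: Phi_Yz].
Qed.

Lemma Dx_Dy_Dz f j : jet_regular j ->
  Dx f j = j (Jr i1 1) * 2^-1 * Dy f j + - j (Jr i2 1) * 2^-1 * Dz f j.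
Proof.
by move=> [u0 v0]; rewrite /Dy /Dz /r V1V2; field; rewrite u0 v0.
Qed.

Lemma iter_hDx_Phi k f j : jet_regular j ->
  (forall w, kg_regular w -> smooth w f) ->
  iter k hDx f (Phi j) = iter k Dx (f \o Phi) j.
Proof.
move=> nj sf; elim: k j nj => [//|k IHk] j nj.
have sk w : kg_regular w -> smooth w (iter k hDx f).
  by move=> nw; exact: smooth_iter_hDx.
have skj := sk _ (Phi_regular nj).
rewrite !iterS hDxE // hr1x_Phi // hr2x_Phi // -Dy_comp_Phi // -Dz_comp_Phi //.
rewrite -Dx_Dy_Dz //; apply: Dx_eq.
  by apply: smooth_comp => // v; exact: smooth_Phi.
by apply: filterS (near_jet_regular nj) => j'; exact: IHk.
Qed.

Lemma iter_Dx_r i k : iter k Dx (@r R i 0) = r i k.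
Proof.
elim: k => [//|k IHk]; apply/funext => j; rewrite iterS IHk Dx_vf ?vf_coord //.
exact: smooth_coord.
Qed.

(** [Phi] carries D_y and D_z to their coordinate forms, hence also D_x; the iterates defining the
    jets in [Psi], taken at [Phi j], are then iterated D_x-derivatives of r^i at [j]. Through this
    identity a decomposition found in the new coordinates returns to jets. *)
Lemma PsiK j : jet_regular j -> Psi (Phi j) = j.
Proof.
move=> nj; have h0 := half_gap_neq0 j; have [q0 _ qm1 _] := Phi_q j.
have tE : ht (Phi j) = j Jt by rewrite /ht Ek_Phi q0 qm1 Dz_qt //; field; exact: h0.
apply/funext => -[||i k]; first exact: tE.
- rewrite /= /hx tE /hV Ek_Phi q0 qtE V1E /=; field; exact: h0.
- rewrite /= iter_hDx_Phi //; last by move=> w _; exact: smooth_hr0.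
  rewrite (_ : hr0 i \o Phi = r i 0) ?iter_Dx_r //; apply/funext => j'.
  case: i => [[|[|[|//]]] i3]; rewrite /= /hr0 !(tnth_nth (cst 0)) /= /r;
    rewrite ?(mulrC 2) ?mulNr ?mulrN ?opprK ?(mulrC 2) ?divfK ?pnatr_eq0 //;
    by congr (j' (Jr _ _)); apply/val_inj.
Qed.

End ChangeOfCoordinates.

(** * Solution of the system in Klein-Gordon coordinates *)

Section BoxFunctions.
Context {R : realType} {I : choiceType}.
Context (c : {ptws I -> R}) (s : seq I) (e : R) (e0 : 0 < e).
Local Notation B := (box c s e).
Implicit Types (f g : {ptws I -> R} -> R) (w : {ptws I -> R}).

(** Smoothness at each point gives dependence on finitely many coordinates only near that point. One
    list for the whole box is what lets the descending inductions start. *)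
Variant reg f : Prop :=
  Reg of (forall w, B w -> smooth w f) & (exists l, depends_on B l f).

Lemma reg_smooth f w : reg f -> B w -> smooth w f.
Proof. by case=> sf _ /sf. Qed.

Lemma reg_cst x : reg (cst x).
Proof. by split=> [w _|]; [exact: smooth_cst|exists [::]]. Qed.

Lemma reg_coord i : reg (fun w => w i).
Proof.
split=> [w _|]; first exact: smooth_coord.
by exists [:: i] => w w' _ _; apply; rewrite mem_head.
Qed.

Lemma depends_on2 (op : R -> R -> R) f g :
  (exists l, depends_on B l f) -> (exists l, depends_on B l g) ->
  exists l, depends_on B l (fun w => op (f w) (g w)).
Proof.
move=> [l fl] [l' gl]; exists (l ++ l') => w w' Bw Bw' ww'; congr op.
  by apply: fl => // i il; apply: ww'; rewrite mem_cat il.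
by apply: gl => // i il; apply: ww'; rewrite mem_cat il orbT.
Qed.

Lemma regD f g : reg f -> reg g -> reg (fun w => f w + g w).
Proof.
move=> [sf lf] [sg lg]; split; last exact: (depends_on2 +%R).
by move=> w Bw; exact: (smoothD (sf w Bw) (sg w Bw)).
Qed.

Lemma regM f g : reg f -> reg g -> reg (fun w => f w * g w).
Proof.
move=> [sf lf] [sg lg]; split; last exact: (depends_on2 *%R).
by move=> w Bw; exact: (smoothM (sf w Bw) (sg w Bw)).
Qed.

Lemma regN f : reg f -> reg (fun w => - f w).
Proof.
move=> [sf lf]; split; last exact: (depends_on2 (fun x _ => - x) lf lf).
by move=> w Bw; exact: (smoothN (sf w Bw)).
Qed.

Lemma reg_pd i f : reg f -> reg (pd i f).
Proof.
move=> [sf [l lf]]; split=> [w Bw|]; first exact: (smooth_pd i (sf w Bw)).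
by exists l; apply: depends_on_pd => //; exact: open_box.
Qed.

Lemma box_vf_eq X f g : (forall w, B w -> f w = g w) ->
  forall w, B w -> vf X f w = vf X g w.
Proof.
move=> fg w Bw; apply: vf_eq.
by apply: filterS (open_nbhs_nbhs (conj (@open_box _ _ c s e) Bw)); exact: fg.
Qed.

Lemma box_pd_eq i f g : (forall w, B w -> f w = g w) ->
  forall w, B w -> pd i f w = pd i g w.
Proof. by move=> fg w Bw; apply: (pd_eq _ fg) => //; exact: open_box. Qed.

Lemma box_smooth_eq f g : (forall w, B w -> f w = g w) ->
  forall w, B w -> smooth w f -> smooth w g.
Proof.
move=> fg w Bw; apply: smooth_eq.
by apply: filterS (open_nbhs_nbhs (conj (@open_box _ _ c s e) Bw)); exact: fg.
Qed.

Lemma reg_eq f g : (forall w, B w -> f w = g w) -> reg f -> reg g.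
Proof.
move=> fg [sf [l lf]]; split; last by exists l; exact: depends_on_eq lf.
by move=> w Bw; apply: (box_smooth_eq fg) => //; exact: sf.
Qed.

Lemma reg_sum (T : Type) (r : seq T) (F : T -> {ptws I -> R} -> R) :
  (forall t, reg (F t)) -> reg (fun w => \sum_(t <- r) F t w).
Proof.
move=> rF; elim: r => [|t r IHr].
  by apply: reg_eq (reg_cst 0) => w _; rewrite big_nil.
by apply: reg_eq (regD (rF t) IHr) => w _; rewrite big_cons.
Qed.

Lemma reg_vf X f : (forall i, reg (X i)) -> reg f -> reg (vf X f).
Proof.
move=> rX rf; have [sf [l lf]] := rf.
have vE w : B w -> \sum_(i <- undup l) X i w * pd i f w = vf X f w.
  move=> Bw; rewrite (vf_seq _ (undup_uniq l)) // => i; rewrite mem_undup => il.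
  by apply: (pd_notin _ lf) => //; exact: open_box.
apply: (reg_eq vE); apply: reg_sum => i; exact: (regM (rX i) (reg_pd i rf)).
Qed.

(** Coordinates are changed one at a time without leaving the box. By the mean value theorem a
    change of a coordinate outside [P] leaves the value of [f] fixed. *)
Lemma box_indep (P : pred I) f : reg f ->
  (forall i, ~~ P i -> forall w, B w -> pd i f w = 0) ->
  forall w w', B w -> B w' -> (forall i, P i -> w i = w' i) -> f w = f w'.
Proof.
move=> rf f0 w w' Bw Bw' ww'; have [_ [l lf]] := rf.
have mB l' : B (mix l' w' w).
  by move=> i is_; rewrite /mix; case: ifP => _; [exact: Bw'|exact: Bw].
suff fE l' : f (mix l' w' w) = f w.
  by rewrite -(fE l); apply: lf => // i il; rewrite /mix il.
elim: l' => [|i l' IHl].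
  by congr f; apply/funext.
have -> : mix (i :: l') w' w = dfwith (mix l' w' w) i (w' i).
  apply/funext => j; rewrite /mix inE; case: (eqVneq j i) => [->|ji /=].
    by rewrite dfwithin.
  by rewrite dfwithout // eq_sym.
have [Pi|Pi] := boolP (P i).
  have -> : w' i = mix l' w' w i by rewrite /mix -ww' //; case: ifP.
  by rewrite dfwith_id.
have [|||t [_ tB E]] := @mvt_line _ _ f c s e (mix l' w' w) i (w' i).
- exact: mB.
- exact: Bw'.
- by move=> z Bz; have [_] := smooth_C1 (reg_smooth rf Bz).
apply/eqP; rewrite -IHl -subr_eq0 E f0 ?mul0r //.
by apply: box_dfwith => //; exact: mB.
Qed.

(** A partial derivative is a vector field with constant components, so the formula for commutators
    applies and one of its two terms vanishes. *)
Lemma pd_vf_comm i Y f w : (forall j, smooth w (Y j)) -> smooth w f ->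
  pd i (vf Y f) w = vf Y (pd i f) w + vf (fun j => pd i (Y j)) f w.
Proof.
move=> sY sf; set d := fun j : I => @cst {ptws I -> R} R (j == i)%:R.
have sd j : smooth w (d j) by exact: smooth_cst.
rewrite (pd_vf i (smooth_vf sY sf)) -/d.
have near_d : \forall w' \near w, vf d f w' = pd i f w'.
  by apply: filterS (near_smooth sf) => w' sw'; rewrite (pd_vf i sw').
rewrite -(vf_eq Y near_d) addrC; apply/eqP; rewrite -subr_eq; apply/eqP.
rewrite (vf_comm sd sY sf); apply: vf_ext => j.
by rewrite {2}/d vf_cst subr0 (pd_vf i (sY j)).
Qed.

Lemma vf_eq_terms X Z f w : (forall i, X i w * pd i f w = Z i w * pd i f w) ->
  vf X f w = vf Z f w.
Proof. by move=> XZ; apply: eq_fsbigr => i _; exact: XZ. Qed.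

End BoxFunctions.

(** * Commutators of D_y and D_z with coordinate derivatives *)

Section Classification.
Context {R : realType}.
Local Notation kg := {ptws kgvar -> R}.
Local Notation hDy := (vf (@Yy R)).
Local Notation hDz := (vf (@Yz R)).
Local Notation hA := (vf (@Ya R)).
Implicit Types (w : kg) (f g h : kg -> R).

(* The derivative of T with respect to q_k is E * tau k. *)
Definition tau (k : int) : R :=
  if k == 0 then 2^-1 else if k == -1 then -1 else if k == -2 then 2^-1 else 0.

Lemma eq_Nq k l : (Nq k == Nq l) = (k == l).
Proof. by apply/eqP/eqP => [[]|->]. Qed.

Lemma eq_Nw k l : (Nw k == Nw l) = (k == l).
Proof. by apply/eqP/eqP => [[]|->]. Qed.

Lemma neq_Nq k : (((Ny == Nq k) = false) * ((Nz == Nq k) = false) *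
  ((Nq k == Ny) = false) * ((Nq k == Nz) = false))%type.
Proof. by do !split; apply/eqP. Qed.

Lemma neq_Nw k : (((Ny == Nw k) = false) * ((Nz == Nw k) = false) *
  ((Nw k == Ny) = false) * ((Nw k == Nz) = false))%type.
Proof. by do !split; apply/eqP. Qed.

Lemma neq_Nqw k l : (((Nq k == Nw l) = false) * ((Nw l == Nq k) = false))%type.
Proof. by do !split; apply/eqP. Qed.

Lemma neq_Nyz : (((Ny == Nz) = false) * ((Nz == Ny) = false))%type.
Proof. by do !split; apply/eqP. Qed.

Lemma bool_natr : ((false%:R = 0 :> R) * (true%:R = 1 :> R))%type.
Proof. by []. Qed.

Definition kgE := (eq_Nq, eq_Nw, neq_Nq, neq_Nw, neq_Nqw, neq_Nyz, eqxx, bool_natr).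

Ltac smooth_lemma ::= first [simple apply smooth_Ek | simple apply smooth_Sk |
  simple apply smooth_Tk | simple apply smooth_Yy | simple apply smooth_Yz |
  simple apply smooth_Ya]; smooth.

Lemma pd_Nq_Ek k w : pd (Nq k) (@Ek R) w = 0.
Proof.
rewrite (pd_vf _ (smooth_Ek w)); cbv beta delta [Ek]; vf_expand.
by rewrite /cst /= !kgE addr0 mulr0.
Qed.

Lemma pd_Nw_Ek k w : pd (Nw k) (@Ek R) w = 0.
Proof.
rewrite (pd_vf _ (smooth_Ek w)); cbv beta delta [Ek]; vf_expand.
by rewrite /cst /= !kgE addr0 mulr0.
Qed.

Lemma pd_Nq_Tk k w : pd (Nq k) (@Tk R) w = Ek w * tau k.
Proof.
rewrite (pd_vf _ (smooth_Tk w)); cbv beta delta [Tk]; vf_expand.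
rewrite -(pd_vf _ (smooth_Ek w)) pd_Nq_Ek /cst /= !kgE /tau.
have [->|k0] := eqVneq k 0; first by rewrite /=; field.
have [->|k1] := eqVneq k (-1); first by rewrite /=; field.
by have [_|k2] := eqVneq k (-2); rewrite /=; field.
Qed.

Lemma pd_Nq_Sk k w : pd (Nq k) (@Sk R) w = - (Ek w * tau (k - 1)).
Proof.
rewrite (pd_vf _ (smooth_Sk w)); cbv beta delta [Sk]; vf_expand.
rewrite -(pd_vf _ (smooth_Ek w)) pd_Nq_Ek /cst /= !kgE /tau.
have [e1 e2 e3 _] := small_int.
have [->|k0] := eqVneq k 0; first by rewrite e1 /=; field.
have [->|k1] := eqVneq k 1; first by rewrite e2 /=; field.
have [->|k2] := eqVneq k (-1); first by rewrite e3 /=; field.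
have -> : (k - 1 == 0) = false by apply/eqP => ?; move/eqP: k1; lia.
have -> : (k - 1 == -1) = false by apply/eqP => ?; move/eqP: k0; lia.
have -> : (k - 1 == -2) = false by apply/eqP => ?; move/eqP: k2; lia.
by field.
Qed.

Lemma pd_Nw_Tk k w : pd (Nw k) (@Tk R) w = 0.
Proof.
rewrite (pd_vf _ (smooth_Tk w)); cbv beta delta [Tk]; vf_expand.
by rewrite -(pd_vf _ (smooth_Ek w)) pd_Nw_Ek /cst /= !kgE; field.
Qed.

Lemma pd_Nw_Sk k w : pd (Nw k) (@Sk R) w = 0.
Proof.
rewrite (pd_vf _ (smooth_Sk w)); cbv beta delta [Sk]; vf_expand.
by rewrite -(pd_vf _ (smooth_Ek w)) pd_Nw_Ek /cst /= !kgE; field.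
Qed.

Lemma C1_coord v w : C1_at w (fun w : kg => w v).
Proof. exact: smooth_C1 (smooth_coord _ _). Qed.

(** D_z has the component q_k at q_(k+1), which produces the shifted derivative, and T omega^(l+1)
    at omega^l, which produces A times the q_k-derivative E tau_k of T. *)
Lemma pd_Nq_hDz k f w : smooth w f -> pd (Nq k) (hDz f) w =
  hDz (pd (Nq k) f) w + pd (Nq (k + 1)) f w + Ek w * tau k * hA f w.
Proof.
move=> sf; rewrite (pd_vf_comm _ (@smooth_Yz R w) sf) -addrA; congr (_ + _).
rewrite (pd_vf (Nq (k + 1)) sf) -[X in X + _]mul1r.
rewrite -(vf_linear _ _ (cst 1) (cst (Ek w * tau k)) sf); apply: vf_ext => v.
case: v => [||l|l] /=; rewrite /cst ?pdcst ?kgE ?mulr0 ?addr0 ?mul1r //.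
- rewrite pd_coord !kgE; congr (nat_of_bool _)%:R.
  by apply/eqP/eqP; lia.
- rewrite pdM; [|exact: smooth_C1 (smooth_Tk w)|exact: C1_coord].
  by rewrite pd_Nq_Tk pd_coord !kgE mulr0 addr0 add0r.
Qed.

Lemma pd_Nq_hDy k f w : smooth w f -> pd (Nq k) (hDy f) w =
  hDy (pd (Nq k) f) w + pd (Nq (k - 1)) f w + Ek w * tau (k - 1) * hA f w.
Proof.
move=> sf; rewrite (pd_vf_comm _ (@smooth_Yy R w) sf) -addrA; congr (_ + _).
rewrite (pd_vf (Nq (k - 1)) sf) -[X in X + _]mul1r.
rewrite -(vf_linear _ _ (cst 1) (cst (Ek w * tau (k - 1))) sf); apply: vf_ext => v.
case: v => [||l|l] /=; rewrite /cst ?pdcst ?kgE ?mulr0 ?addr0 ?mul1r //.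
- rewrite pd_coord !kgE; congr (nat_of_bool _)%:R.
  by apply/eqP/eqP; lia.
- rewrite pdM; [|by apply: smooth_C1; smooth|exact: C1_coord].
  rewrite pd_coord !kgE mulr0 addr0 add0r (pd_vf _ (smoothN (smooth_Sk w))) vfN; last by smooth.
  by rewrite -(pd_vf _ (smooth_Sk w)) pd_Nq_Sk opprK.
Qed.

(** The component of D_z at omega^(k-1) is T omega^k, so differentiating in omega^k brings in the
    derivative in omega^(k-1). At k = 0 no component contains omega^0, whence the value 0. *)
Definition pd_pred_w k f : kg -> R := if k is l.+1 then pd (Nw l) f else cst 0.

Lemma pd_Nw_hDz k f w : smooth w f -> pd (Nw k) (hDz f) w =
  hDz (pd (Nw k) f) w + Tk w * pd_pred_w k f w.
Proof.
move=> sf; rewrite (pd_vf_comm _ (@smooth_Yz R w) sf); congr (_ + _).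
case: k => [|k] /=.
  rewrite /cst mulr0; apply: vf_zero => -[||l|l] /=; rewrite ?pdcst ?pd_coord ?kgE //.
  rewrite pdM; [|exact: smooth_C1 (smooth_Tk w)|exact: C1_coord].
  by rewrite pd_Nw_Tk pd_coord !kgE /= mul0r mulr0 addr0.
rewrite (pd_vf _ sf) -[RHS]addr0 -[X in _ + X](mul0r (hA f w)).
rewrite -(vf_linear _ _ (cst (Tk w)) (cst 0) sf); apply: vf_ext => v.
case: v => [||l|l] /=; rewrite /cst ?pdcst ?pd_coord ?kgE ?mulr0 ?mul0r ?addr0 //.
rewrite pdM; [|exact: smooth_C1 (smooth_Tk w)|exact: C1_coord].
by rewrite pd_Nw_Tk pd_coord mul0r add0r !kgE eqSS eq_sym.
Qed.

Lemma pd_Nw_hDy k f w : smooth w f -> pd (Nw k) (hDy f) w =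
  hDy (pd (Nw k) f) w - Sk w * pd_pred_w k f w.
Proof.
move=> sf; rewrite (pd_vf_comm _ (@smooth_Yy R w) sf); congr (_ + _).
have SE m : pd (Nw m) (fun w => - @Sk R w) w = 0.
  rewrite (pd_vf _ (smoothN (smooth_Sk w))) vfN; last by smooth.
  by rewrite -(pd_vf _ (smooth_Sk w)) pd_Nw_Sk oppr0.
case: k => [|k] /=.
  rewrite /cst mulr0 oppr0; apply: vf_zero => -[||l|l] /=; rewrite ?pdcst ?pd_coord ?kgE //.
  rewrite pdM; [|by apply: smooth_C1; smooth|exact: C1_coord].
  by rewrite SE pd_coord !kgE /= mul0r mulr0 addr0.
rewrite (pd_vf _ sf) -mulNr -[RHS]addr0 -[X in _ + X](mul0r (hA f w)).
rewrite -(vf_linear _ _ (cst (- Sk w)) (cst 0) sf); apply: vf_ext => v.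
case: v => [||l|l] /=; rewrite /cst ?pdcst ?pd_coord ?kgE ?mulr0 ?mul0r ?addr0 //.
rewrite pdM; [|by apply: smooth_C1; smooth|exact: C1_coord].
by rewrite SE pd_coord mul0r add0r !kgE eqSS eq_sym.
Qed.

End Classification.

Lemma int_downward (P : int -> Prop) (n lo : int) :
  (forall k, n <= k -> P k) -> (forall k, lo <= k -> P (k + 1) -> P k) ->
  forall k, lo <= k -> P k.
Proof.
move=> Pn PS; have H (m : nat) : forall k, n <= k + m%:Z -> lo <= k -> P k.
  elim: m => [|m IHm] k nk lok; first by apply: Pn; lia.
  by apply: PS => //; apply: IHm; lia.
by move=> k lok; apply: (H `|n - k|%N) => //; lia.
Qed.

Lemma int_upward (P : int -> Prop) (n hi : int) :
  (forall k, k <= n -> P k) -> (forall k, k <= hi -> P (k - 1) -> P k) ->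
  forall k, k <= hi -> P k.
Proof.
move=> Pn PS k khi; rewrite -(opprK k).
apply: (@int_downward (fun k => P (- k)) (- n) (- hi)); last by lia.
  by move=> l nl; apply: Pn; lia.
move=> l hil Pl; apply: PS; first by lia.
by have -> : - l - 1 = - (l + 1) by lia.
Qed.

(** * The third component, the dependence on the omega^k, affineness in the q_k *)

Section BoxStages.
Context {R : realType}.
Local Notation kg := {ptws kgvar -> R}.
Local Notation hDy := (vf (@Yy R)).
Local Notation hDz := (vf (@Yz R)).
Local Notation hA := (vf (@Ya R)).
Implicit Types (w : kg) (f g h : kg -> R).

Context (c : kg) (s : seq kgvar) (e : R) (e0 : 0 < e).
Local Notation B := (box c s e).
Local Notation reg := (reg c s e).

Ltac smooth_lemma ::= first [simple apply smooth_Ek | simple apply smooth_Sk |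
  simple apply smooth_Tk | simple apply smooth_Yy | simple apply smooth_Yz |
  simple apply smooth_Ya |
  match goal with H : reg _ |- _ => simple apply (reg_smooth H); assumption end ]; smooth.

Definition wfree f := forall k w, B w -> pd (Nw k) f w = 0.
Definition qfree f := forall k w, B w -> pd (Nq k) f w = 0.

Lemma hA_wfree f w : wfree f -> B w -> hA f w = 0.
Proof.
move=> wf Bw; rewrite -(vf_zero (X := fun _ => cst 0) f (z := w)) //.
apply: vf_eq_terms => v; case: v => [||k|k] //=.
by rewrite wf // !mulr0.
Qed.

Lemma hDz_qfree f w : qfree f -> B w -> smooth w f ->
  hDz f w = pd Nz f w + Tk w * hA f w.
Proof.
move=> qf Bw sf; rewrite (pd_vf Nz sf) -[X in X + _]mul1r.
rewrite -(vf_linear _ _ (cst 1) (cst (Tk w)) sf); apply: vf_eq_terms => v.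
case: v => [||k|k]; rewrite /= /cst ?kgE ?(mulr0, mul1r, addr0, add0r) //.
by rewrite (qf k w Bw) !mulr0.
Qed.

Lemma hDy_qfree f w : qfree f -> B w -> smooth w f ->
  hDy f w = pd Ny f w - Sk w * hA f w.
Proof.
move=> qf Bw sf; rewrite (pd_vf Ny sf) -mulNr -[X in X + _]mul1r.
rewrite -(vf_linear _ _ (cst 1) (cst (- Sk w)) sf); apply: vf_eq_terms => v.
case: v => [||k|k]; rewrite /= /cst ?kgE ?(mulr0, mul1r, addr0, add0r) //.
by rewrite (qf k w Bw) !mulr0.
Qed.

Lemma hDz_yz f w : wfree f -> qfree f -> B w -> smooth w f -> hDz f w = pd Nz f w.
Proof. by move=> wf qf Bw sf; rewrite hDz_qfree // hA_wfree // mulr0 addr0. Qed.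

Lemma hDy_yz f w : wfree f -> qfree f -> B w -> smooth w f -> hDy f w = pd Ny f w.
Proof. by move=> wf qf Bw sf; rewrite hDy_qfree // hA_wfree // mulr0 subr0. Qed.

Lemma reg_bound f : reg f -> exists n : nat,
  (forall k : int, (n <= `|k|)%N -> forall w, B w -> pd (Nq k) f w = 0) /\
  (forall k : nat, (n <= k)%N -> forall w, B w -> pd (Nw k) f w = 0).
Proof.
move=> [_ [l lf]].
pose m v := (match v with Nq k => `|k|.+1 | Nw k => k.+1 | _ => 0 end)%N.
have le v : v \in l -> (m v <= \max_(v <- l) m v)%N.
  by move=> vl; exact: (@leq_bigmax_seq _ l xpredT m v vl).
have f0 v : (\max_(v <- l) m v < m v)%N -> forall w, B w -> pd v f w = 0.
  move=> mv w Bw; apply: (pd_notin (@open_box _ _ c s e) lf Bw).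
  by apply: contraTN mv => /le; rewrite -leqNgt.
exists (\max_(v <- l) m v)%N; split=> k nk; apply: f0; exact: nk.
Qed.

Lemma vf0_box X f w : (forall w, B w -> f w = 0) -> B w -> vf X f w = 0.
Proof. by move=> f0 Bw; rewrite (@box_vf_eq _ _ c s e X f (cst 0)) // vf_cst. Qed.

Lemma pd0_box i f w : (forall w, B w -> f w = 0) -> B w -> pd i f w = 0.
Proof. by move=> f0 Bw; rewrite (@box_pd_eq _ _ c s e i f (cst 0)) // pdcst. Qed.

Lemma reg_hDz f : reg f -> reg (hDz f).
Proof.
move=> rf; apply: reg_vf => // v; split=> [w _|]; first exact: smooth_Yz.
case: v => [||k|k] /=; [by exists [::]|by exists [::]| |].
  by exists [:: Nq (k - 1)] => w w' _ _; apply; rewrite mem_head.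
exists [:: Ny; Nz; Nq 0; Nq (-1); Nq (-2); Nw k.+1] => w w' _ _ ww'.
by rewrite /Tk /Ek !ww' // !inE eqxx ?orbT.
Qed.

Lemma reg_hDy f : reg f -> reg (hDy f).
Proof.
move=> rf; apply: reg_vf => // v; split=> [w _|]; first exact: smooth_Yy.
case: v => [||k|k] /=; [by exists [::]|by exists [::]| |].
  by exists [:: Nq (k + 1)] => w w' _ _; apply; rewrite mem_head.
exists [:: Ny; Nz; Nq 0; Nq 1; Nq (-1); Nw k.+1] => w w' _ _ ww'.
by rewrite /Sk /Ek !ww' // !inE eqxx ?orbT.
Qed.

Hypothesis Breg : forall w, B w -> kg_regular w.

Lemma tau_far (k : int) : 0 < k \/ k < -2 -> tau k = 0 :> R.
Proof.
rewrite /tau => h; case: eqP => [|_]; first by lia.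
by case: eqP => [|_]; [lia|case: eqP => [|_]; [lia|]].
Qed.

(** Up to the factor E^2 / (2 S T) this is differentiation along the third characteristic. *)
Definition transport h w := Sk w * hDz h w + Tk w * hDy h w.

Lemma pd_Nq_transport k h w : reg h -> B w ->
  pd (Nq k) (transport h) w = transport (pd (Nq k) h) w
    - Ek w * tau (k - 1) * (hDz h w - Tk w * hA h w)
    + Ek w * tau k * (hDy h w + Sk w * hA h w)
    + Sk w * pd (Nq (k + 1)) h w + Tk w * pd (Nq (k - 1)) h w.
Proof.
move=> rh Bw.
have sh := reg_smooth rh Bw.
have sz : smooth w (hDz h) by smooth.
have sy : smooth w (hDy h) by smooth.
have C1 f : smooth w f -> C1_at w f by exact: smooth_C1.
rewrite /transport (@pdD _ _ w (fun w => Sk w * hDz h w) (fun w => Tk w * hDy h w));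
  [|by apply: C1; smooth|by apply: C1; smooth].
rewrite (@pdM _ _ w Sk (hDz h));
  [|exact: C1 (smooth_Sk w)|exact: C1 sz].
rewrite (@pdM _ _ w Tk (hDy h)); [|exact: C1 (smooth_Tk w)|exact: C1 sy].
rewrite pd_Nq_Sk pd_Nq_Tk pd_Nq_hDz // pd_Nq_hDy //; ring.
Qed.

(** The equation is differentiated in q_k; write h_k for the derivative of h. For k >= 2 and k <= -3
    the coefficients tau drop out, and descent from both ends kills every h_k except h_0 and h_(-1).
    The equations at k = 1 and k = -2 express D_z h - T A h through h_0 and D_y h + S A h through
    h_(-1). Inserted into the undifferentiated equation they give h_(-1) = h_0, and the equations at
    k = 0 and k = -1 finish the argument. *)
Lemma transport_kernel h : reg h -> (forall w, B w -> transport h w = 0) ->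
  [/\ qfree h, forall w, B w -> pd Ny h w = 0 & forall w, B w -> pd Nz h w = 0].
Proof.
move=> rh Lh; have [n [hn _]] := reg_bound rh.
have Lk k w : B w -> 0 = transport (pd (Nq k) h) w
    - Ek w * tau (k - 1) * (hDz h w - Tk w * hA h w)
    + Ek w * tau k * (hDy h w + Sk w * hA h w)
    + Sk w * pd (Nq (k + 1)) h w + Tk w * pd (Nq (k - 1)) h w.
  by move=> Bw; rewrite -pd_Nq_transport //; exact/esym/(pd0_box _ Lh).
have L0 f w : (forall w, B w -> f w = 0) -> B w -> transport f w = 0.
  by move=> f0 Bw; rewrite /transport !(vf0_box _ f0) // !mulr0 addr0.
have S0 w : B w -> Sk w != 0 by move=> /Breg[].
have T0 w : B w -> Tk w != 0 by move=> /Breg[].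
have E0 w : Ek w != 0 by exact: Ek_neq0.
have up k : 1 <= k -> forall w, B w -> pd (Nq k) h w = 0.
  pose P k := forall w, B w -> pd (Nq k) h w = 0 /\ pd (Nq (k + 1)) h w = 0.
  suff HP : forall k, 1 <= k -> P k by move=> k1 w Bw; have [] := HP k k1 w Bw.
  apply: (@int_downward P n%:Z) => [{}k nk w Bw|{}k k1 Pk w Bw].
    by split; apply: hn => //; lia.
  have [h1 h2] := Pk w Bw; split=> //; move: (Lk (k + 1) w Bw).
  rewrite !tau_far; [|by lia|by lia].
  rewrite h2 addrK (L0 _ _ _ Bw); last by move=> w' Bw'; have [] := Pk w' Bw'.
  by move=> E; apply: (mulfI (T0 w Bw)); rewrite mulr0 [RHS]E; ring.
have down k : k <= -2 -> forall w, B w -> pd (Nq k) h w = 0.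
  pose P k := forall w, B w -> pd (Nq k) h w = 0 /\ pd (Nq (k - 1)) h w = 0.
  suff HP : forall k, k <= -2 -> P k by move=> k1 w Bw; have [] := HP k k1 w Bw.
  apply: (@int_upward P (- n%:Z)) => [{}k nk w Bw|{}k k1 Pk w Bw].
    by split; apply: hn => //; lia.
  have [h1 h2] := Pk w Bw; split=> //; move: (Lk (k - 1) w Bw).
  rewrite !tau_far; [|by lia|by lia].
  rewrite h2 subrK (L0 _ _ _ Bw); last by move=> w' Bw'; have [] := Pk w' Bw'.
  by move=> E; apply: (mulfI (S0 w Bw)); rewrite mulr0 [RHS]E; ring.
pose h0 := pd (Nq 0) h; pose hm := pd (Nq (-1)) h.
pose M w := hDz h w - Tk w * hA h w; pose N w := hDy h w + Sk w * hA h w.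
have [e1 e2 e3 [e4 e5 e6]] := small_int.
have tau0 : tau 0 = 2^-1 :> R by [].
have tau1 : tau (-1) = -1 :> R by [].
have tau2 : tau (-2) = 2^-1 :> R by [].
have ME w : B w -> M w = 2 * Tk w * h0 w / Ek w.
  move=> Bw; move: (Lk 1 w Bw); rewrite e2 tau0 (@tau_far 1); last by left.
  rewrite (up (1 + 1)) // (L0 _ _ (up 1 _) Bw) // -/(M w) -/(h0 w) => E.
  apply: (mulfI (E0 w)); rewrite mulrCA divff // mulr1.
  by rewrite -[LHS]addr0 -[X in _ + X](mulr0 2) [X in _ + 2 * X]E; field.
have NE w : B w -> N w = - (2 * Sk w * hm w / Ek w).
  move=> Bw; move: (Lk (-2) w Bw); rewrite e6 tau2 (@tau_far (-2 - 1)); last by right.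
  rewrite (down (-2 - 1)) // (L0 _ _ (down (-2) _) Bw) // -/(N w) -/(hm w) => E.
  apply: (mulfI (E0 w)); rewrite mulrN mulrCA divff // mulr1.
  by rewrite -[RHS]addr0 -[X in _ + X](mulr0 2) [X in _ + 2 * X]E; field.
have hm0 w : B w -> hm w = h0 w.
  move=> Bw; have ST : 2 * Sk w * Tk w != 0.
    by apply: mulf_neq0; [apply: mulf_neq0; [rewrite pnatr_eq0|exact: S0]|exact: T0].
  apply: (mulfI ST); have := Lh w Bw; rewrite /transport.
  have -> : hDz h w = M w + Tk w * hA h w by rewrite /M subrK.
  have -> : hDy h w = N w - Sk w * hA h w by rewrite /N addrK.
  rewrite ME // NE // => E.
  have : Ek w * (Sk w * (2 * Tk w * h0 w / Ek w + Tk w * hA h w) +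
    Tk w * (- (2 * Sk w * hm w / Ek w) - Sk w * hA h w)) = 0 by rewrite E mulr0.
  rewrite (_ : Ek w * _ = 2 * Sk w * Tk w * h0 w - 2 * Sk w * Tk w * hm w).
    by move/eqP; rewrite subr_eq0 => /eqP.
  by field; exact: E0.
(* The equations at k = 0 and k = -1 contain the same transport term of h_0 and differ by 4 (T - S)
   h_0. *)
have TSh0 w : B w -> (Tk w - Sk w) * h0 w = 0.
  move=> Bw; have := Lk 0 w Bw; have := Lk (-1) w Bw.
  rewrite e1 e3 e4 e5 tau0 tau1 tau2 (up 1) // (down (-2)) // -/h0 -/hm -/(M w) -/(N w).
  have -> : transport hm w = transport h0 w.
    by rewrite /transport !(box_vf_eq _ hm0 Bw).
  rewrite ME // NE // !hm0 // => Em E0'; apply: (@mulfI _ 4); first by rewrite pnatr_eq0.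
  have := congr1 (fun x => x - 0) E0'; rewrite {1}Em => /esym/eqP.
  rewrite -subr_eq0 => /eqP Ef; rewrite mulr0 -[RHS]Ef; field; exact: E0.
(* Differentiation of (T - S) h_0 = 0 in q_1: h_0 does not depend on q_1 because h_1 = 0, and T - S
   has the derivative E / 2. *)
have h00 w : B w -> h0 w = 0.
  move=> Bw; have := pd0_box (Nq 1) TSh0 Bw.
  have rh0 : reg h0 by exact: reg_pd.
  have C1 f : smooth w f -> C1_at w f by exact: smooth_C1.
  have sh0 := reg_smooth rh0 Bw.
  rewrite (@pdM _ _ w (fun w => Tk w - Sk w) h0); [|by apply: C1; smooth|exact: C1].
  rewrite (@pdD _ _ w Tk (fun w => - Sk w)); [|exact: C1 (smooth_Tk w)|by apply: C1; smooth].
  rewrite pd_Nq_Tk (pd_vf _ (smoothN (smooth_Sk w))) vfN; last by smooth.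
  rewrite -(pd_vf _ (smooth_Sk w)) pd_Nq_Sk e2 tau0 (@tau_far 1); last by left.
  rewrite /h0 (smooth_pdC (Nq 0) (Nq 1) (reg_smooth rh Bw)) (pd0_box _ (up 1 _)) //.
  rewrite !(mulr0, addr0, add0r) opprK => /eqP.
  by rewrite !mulf_eq0 (negbTE (E0 w)) invr_eq0 pnatr_eq0 => /eqP.
have qh : qfree h.
  move=> k w Bw; have [k1|k1] := leP 1 k; first exact: up.
  have [k2|k2] := leP k (-2); first exact: down.
  have [->|k0] := eqVneq k 0; first exact: h00.
  have -> : k = -1 by move/eqP: k0; lia.
  by rewrite -/(hm w) hm0 // h00.
split=> // w Bw.
- have := NE w Bw; rewrite /N hm0 // h00 // hDy_qfree ?subrK //; last exact: reg_smooth Bw.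
  by move=> ->; rewrite mulr0 mul0r oppr0.
- have := ME w Bw; rewrite /M h00 // hDz_qfree ?addrK //; last exact: reg_smooth Bw.
  by move=> ->; rewrite mulr0 mul0r.
Qed.

Definition wonly f := [/\ qfree f, forall w, B w -> pd Ny f w = 0 &
  forall w, B w -> pd Nz f w = 0].

Lemma hDz_wonly f w : wonly f -> B w -> smooth w f -> hDz f w = Tk w * hA f w.
Proof. by move=> [qf _ zf] Bw sf; rewrite hDz_qfree // zf // add0r. Qed.

Lemma hDy_wonly f w : wonly f -> B w -> smooth w f -> hDy f w = - (Sk w * hA f w).
Proof. by move=> [qf yf _] Bw sf; rewrite hDy_qfree // yf // add0r. Qed.

Lemma wonlyP f : (forall i, (forall k, i <> Nw k) -> forall w, B w -> pd i f w = 0) ->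
  wonly f.
Proof. by move=> f0; split=> [k|w|w]; [|exact: f0|exact: f0]; move=> w; exact: f0. Qed.

Lemma wonly0 f i w : wonly f -> (forall k, i <> Nw k) -> B w -> pd i f w = 0.
Proof.
move=> [qf yf zf] iw Bw; case: i iw => [_|_|k _|k /(_ k)//]; [exact: yf|exact: zf|exact: qf].
Qed.

Lemma reg_hA f : reg f -> reg (hA f).
Proof.
move=> rf; apply: reg_vf => // v; split=> [w _|]; first exact: smooth_Ya.
case: v => [||k|k] /=; [by exists [::]|by exists [::]|by exists [::]|].
by exists [:: Nw k.+1] => w w' _ _; apply; rewrite mem_head.
Qed.

Lemma wonly_hA f : reg f -> wonly f -> wonly (hA f).
Proof.
move=> rf wf; apply: wonlyP => i iw w Bw.
rewrite (pd_vf_comm i (@smooth_Ya R w) (reg_smooth rf Bw)).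
rewrite (@vf0_box _ (pd i f)) ?add0r //; last by move=> w' Bw'; exact: wonly0.
apply: vf_zero => -[||k|k] /=; rewrite ?pdcst // pd_coord.
by case: eqP => // iE; case: (iw k.+1).
Qed.

Lemma wonly_pd f k : reg f -> wonly f -> wonly (pd (Nw k) f).
Proof.
move=> rf wf; apply: wonlyP => i iw w Bw.
rewrite (smooth_pdC (Nw k) i (reg_smooth rf Bw)).
by apply: pd0_box => // w' Bw'; exact: wonly0.
Qed.

Lemma wonlyB f g : reg f -> reg g -> wonly f -> wonly g -> wonly (fun w => f w - g w).
Proof.
move=> rf rg wf wg; apply: wonlyP => i iw w Bw.
have [sf sg] := (reg_smooth rf Bw, reg_smooth rg Bw).
have ndg : smooth w (fun w => - g w) by smooth.
rewrite (@pdD _ _ w f (fun w => - g w)); [|exact: smooth_C1 sf|exact: smooth_C1 ndg].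
by rewrite (pd_vf i ndg) vfN // -(pd_vf i sg) !wonly0 // oppr0 addr0.
Qed.

Lemma reg_Ek : reg Ek.
Proof.
split=> [w _|]; first exact: smooth_Ek.
by exists [:: Ny; Nz] => w w' _ _ ww'; rewrite /Ek !ww' // !inE eqxx ?orbT.
Qed.

Lemma pd_Ek_mul i f w : smooth w f -> pd i (fun w => Ek w * f w) w =
  pd i Ek w * f w + Ek w * pd i f w.
Proof. by move=> sf; rewrite (@pdM _ _ w Ek f); [|exact: smooth_C1 (smooth_Ek w)|exact: smooth_C1 sf]. Qed.

(** Restriction to the slice through the centre on which only the omega^k vary. It allows F to be
    read off from a instead of being integrated from its derivatives. *)
Definition frz w : kg := fun i => if i is Nw k then w (Nw k) else c i.

Lemma frzB w : B w -> B (frz w).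
Proof.
by move=> Bw [||k|k] is_ /=; rewrite ?subrr ?normr0 //; exact: Bw.
Qed.

Lemma smooth_frz i w : smooth w (fun w => frz w i).
Proof. by case: i => [||k|k] /=; smooth. Qed.

Lemma reg_frz f : reg f -> reg (f \o frz).
Proof.
move=> [sf [l lf]]; split=> [w Bw|].
  by apply: smooth_comp => [i|]; [exact: smooth_frz|apply: sf; exact: frzB].
exists l => w w' Bw Bw' ww'; apply: lf; [exact: frzB|exact: frzB|].
by move=> [||k|k] il //=; exact: ww'.
Qed.

Lemma pd_Nw_frz k f w : pd (Nw k) (f \o frz) w = pd (Nw k) f (frz w).
Proof.
rewrite /pd /=; congr (derive1 _ _); apply/funext => t; rewrite /line /=; congr f.
apply/funext => i; case: (eqVneq (Nw k) i) => [<-|ki].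
  by rewrite /= !dfwithin.
rewrite dfwithout //; case: i ki => [||l|l] //= ki.
by rewrite dfwithout.
Qed.

Lemma wonly_frz f : wonly (f \o frz).
Proof.
apply: wonlyP => i iw w Bw; rewrite /pd.
rewrite (_ : line _ _ _ = cst (f (frz w))) ?derive1_cst //.
apply/funext => t; rewrite /line /=; congr f; apply/funext => j.
case: j => [||l|l] //=; rewrite dfwithout //; apply/eqP; exact: iw.
Qed.

Lemma wonly_frzE f w : reg f -> wonly f -> B w -> f (frz w) = f w.
Proof.
move=> rf wf Bw; apply: (box_indep (P := fun i => if i is Nw _ then true else false) rf).
- by move=> i iP w' Bw'; apply: wonly0 => // k ik; rewrite ik in iP.
- exact: frzB.
- exact: Bw.
- by case.
Qed.

(** By descent in k, the derivatives of a and b in omega^k are E h_k and -E h_k, where h_k depends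
    on the omegas only. Indeed D_z (E h) = E h + E T A h, so the first equation differentiated in
    omega^(k+1) yields h_k as the derivative of g in omega^(k+1) minus A h_(k+1). On the slice E is
    constant, so F has the derivatives h_k and removes the omegas from a and b simultaneously. The
    remainder g - A F depends on the omegas only, but by the equations it is also free of them,
    hence constant. *)
Lemma omega_elimination a b g : reg a -> reg b -> reg g -> wonly g ->
  (forall w, B w -> hDz a w + b w = Ek w * Tk w * g w) ->
  (forall w, B w -> hDy b w + a w = Ek w * Sk w * g w) ->
  let F w := a (frz w) / Ek c in
  [/\ reg F, wonly F, wfree (fun w => a w - Ek w * F w),
     wfree (fun w => b w + Ek w * F w) &
  exists x, forall w, B w -> [/\ g w = hA F w + x,
    hDz (fun w => a w - Ek w * F w) w + (b w + Ek w * F w) = x * (Ek w * Tk w) &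
    hDy (fun w => b w + Ek w * F w) w + (a w - Ek w * F w) = x * (Ek w * Sk w)]].
Proof.
move=> ra rb rg wg eqz eqy F.
have S0 w : B w -> Sk w != 0 by move=> /Breg[].
have T0 w : B w -> Tk w != 0 by move=> /Breg[].
have E0 w : Ek w != 0 by exact: Ek_neq0.
have [na [_ an]] := reg_bound ra; have [nb [_ bn]] := reg_bound rb.
have C1 f w : smooth w f -> C1_at w f by exact: smooth_C1.
have pdET k w : B w -> pd (Nw k) (fun w => Ek w * Tk w * g w) w = Ek w * Tk w * pd (Nw k) g w.
  move=> Bw; have sg := reg_smooth rg Bw.
  rewrite (@pdM _ _ w (fun w => Ek w * Tk w) g); [|by apply: C1; smooth|exact: C1].
  rewrite pd_Ek_mul ?pd_Nw_Ek ?pd_Nw_Tk; last exact: smooth_Tk.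
  by rewrite !(mul0r, mulr0, add0r).
have pdES k w : B w -> pd (Nw k) (fun w => Ek w * Sk w * g w) w = Ek w * Sk w * pd (Nw k) g w.
  move=> Bw; have sg := reg_smooth rg Bw.
  rewrite (@pdM _ _ w (fun w => Ek w * Sk w) g); [|by apply: C1; smooth|exact: C1].
  rewrite pd_Ek_mul ?pd_Nw_Ek ?pd_Nw_Sk; last exact: smooth_Sk.
  by rewrite !(mul0r, mulr0, add0r).
have eqzk k w : B w -> hDz (pd (Nw k) a) w + Tk w * pd_pred_w k a w + pd (Nw k) b w =
    Ek w * Tk w * pd (Nw k) g w.
  move=> Bw; have [sa sb] := (reg_smooth ra Bw, reg_smooth rb Bw).
  rewrite -pdET // -(box_pd_eq _ eqz Bw).
  rewrite (@pdD _ _ w (hDz a) b); [|by apply: C1; smooth|exact: C1].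
  by rewrite pd_Nw_hDz.
have eqyk k w : B w -> hDy (pd (Nw k) b) w - Sk w * pd_pred_w k b w + pd (Nw k) a w =
    Ek w * Sk w * pd (Nw k) g w.
  move=> Bw; have [sa sb] := (reg_smooth ra Bw, reg_smooth rb Bw).
  rewrite -pdES // -(box_pd_eq _ eqy Bw).
  rewrite (@pdD _ _ w (hDy b) a); [|by apply: C1; smooth|exact: C1].
  by rewrite pd_Nw_hDy.
pose P k := exists h, [/\ reg h, wonly h &
  forall w, B w -> pd (Nw k) a w = Ek w * h w /\ pd (Nw k) b w = - (Ek w * h w)].
have hDzE h w : reg h -> wonly h -> B w ->
    hDz (fun w => Ek w * h w) w = Ek w * h w + Ek w * (Tk w * hA h w).
  move=> rh wh Bw; have sh := reg_smooth rh Bw.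
  by rewrite (@vfM _ _ _ Ek h); [rewrite vf_Yz_Ek hDz_wonly|exact: smooth_Ek|].
have hDyE h w : reg h -> wonly h -> B w ->
    hDy (fun w => Ek w * h w) w = Ek w * h w - Ek w * (Sk w * hA h w).
  move=> rh wh Bw; have sh := reg_smooth rh Bw.
  by rewrite (@vfM _ _ _ Ek h); [rewrite vf_Yy_Ek hDy_wonly // mulrN|exact: smooth_Ek|].
have Pk k : P k.
  suff : forall m k, (maxn na nb <= k + m)%N -> P k by apply; exact: leq_addl.
  elim=> [|m IHm] {}k nk.
    rewrite addn0 geq_max in nk; case/andP: nk => nak nbk; exists (cst 0); split.
    - exact: reg_cst.
    - by apply: wonlyP => i _ w _; exact: pdcst.
    - by move=> w Bw; rewrite an // bn // mulr0 oppr0.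
  have [|h [rh wh hk]] := IHm k.+1; first by rewrite addSnnS.
  exists (fun w => pd (Nw k.+1) g w - hA h w); split.
  - by apply: regD; [exact: reg_pd|apply: regN; exact: reg_hA].
  - apply: wonlyB; [exact: reg_pd|exact: reg_hA|exact: wonly_pd|exact: wonly_hA].
  - have ak w : B w -> pd (Nw k.+1) a w = Ek w * h w by move=> /hk[].
    have bk w : B w -> pd (Nw k.+1) b w = - (Ek w * h w) by move=> /hk[].
    move=> w Bw; have sh := reg_smooth rh Bw; have sE : smooth w (fun w => Ek w * h w) by smooth.
    split.
      have := eqzk k.+1 w Bw; rewrite (box_vf_eq _ ak Bw) bk // hDzE // /= => E.
      apply: (mulfI (T0 w Bw));
      have -> (x y : R) : Tk w * (Ek w * (x - y)) = Ek w * Tk w * x - Ek w * Tk w * y by ring.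
      by rewrite -E; ring.
    have := eqyk k.+1 w Bw; rewrite (box_vf_eq _ bk Bw) ak // vfN // hDyE // /= => E.
    apply: (mulfI (S0 w Bw)).
    have -> (x y : R) : Sk w * - (Ek w * (x - y)) = Ek w * Sk w * y - Ek w * Sk w * x by ring.
    by rewrite -E; ring.
have rF : reg F by apply: regM; [exact: reg_frz|exact: reg_cst].
have EF w : Ek (frz w) = Ek c by [].
have pdF i w : B w -> pd i F w = pd i (a \o frz) w / Ek c.
  move=> Bw; have sf := reg_smooth (reg_frz ra) Bw.
  rewrite (@pdM _ _ w (a \o frz) (cst (Ek c)^-1)); [|exact: C1|exact: C1_cst].
  by rewrite pdcst mulr0 addr0.
have wF : wonly F.
  apply: wonlyP => i iw w Bw; rewrite pdF //.
  by rewrite (wonly0 (wonly_frz a) iw Bw) mul0r.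
have ckF k w : B w -> pd (Nw k) a w = Ek w * pd (Nw k) F w /\ pd (Nw k) b w = - (Ek w * pd (Nw k) F w).
  move=> Bw; have [h [rh wh hk]] := Pk k.
  have -> : pd (Nw k) F w = h w.
    rewrite pdF // pd_Nw_frz (hk _ (frzB Bw)).1 EF wonly_frzE //.
    by rewrite mulrAC divff ?mul1r.
  exact: hk.
set a' := fun w => a w - Ek w * F w; set b' := fun w => b w + Ek w * F w.
have rEF : reg (fun w => Ek w * F w) by apply: regM => //; exact: reg_Ek.
have ra' : reg a' by apply: regD => //; exact: regN.
have rb' : reg b' by exact: regD.
have wa' : wfree a'.
  move=> k w Bw; have [sa sF] := (reg_smooth ra Bw, reg_smooth rF Bw).
  have sEF := reg_smooth rEF Bw.
  rewrite (@pdD _ _ w a (fun w => - (Ek w * F w))); [|exact: C1|by apply: C1; smooth].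
  rewrite (pd_vf _ (smoothN sEF)) vfN // -(pd_vf _ sEF) pd_Ek_mul // pd_Nw_Ek mul0r add0r.
  by rewrite (ckF k w Bw).1 subrr.
have wb' : wfree b'.
  move=> k w Bw; have [sb sF] := (reg_smooth rb Bw, reg_smooth rF Bw).
  have sEF := reg_smooth rEF Bw.
  rewrite (@pdD _ _ w b (fun w => (Ek w * F w))); [|exact: C1|exact: C1].
  rewrite pd_Ek_mul // pd_Nw_Ek mul0r add0r.
  by rewrite (ckF k w Bw).2 addNr.
have eqz' w : B w -> hDz a' w + b' w = Ek w * Tk w * (g w - hA F w).
  move=> Bw; have sa := reg_smooth ra Bw; have sEF := reg_smooth rEF Bw.
  rewrite /a' (@vfD _ _ _ a (fun w => - (Ek w * F w))) ?vfN //; last exact: smoothN.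
  rewrite hDzE // mulrBr -eqz // /b'; ring.
have eqy' w : B w -> hDy b' w + a' w = Ek w * Sk w * (g w - hA F w).
  move=> Bw; have sb := reg_smooth rb Bw; have sEF := reg_smooth rEF Bw.
  rewrite /b' (@vfD _ _ _ b (fun w => (Ek w * F w))) //.
  rewrite hDyE // mulrBr -eqy // /a'; ring.
split=> //.
pose g' w := g w - hA F w.
have rg' : reg g' by apply: regD => //; apply: regN; exact: reg_hA.
have wg' : wonly g' by apply: wonlyB => //; [exact: reg_hA|exact: wonly_hA].
have g'k k w : B w -> pd (Nw k) g' w = 0.
  move=> Bw; have [sa sb] := (reg_smooth ra' Bw, reg_smooth rb' Bw).
  have sg := reg_smooth rg' Bw.
  have ET0 : Ek w * Tk w != 0 by apply: mulf_neq0 => //; exact: T0.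
  apply: (mulfI ET0); rewrite mulr0.
  have <- : pd (Nw k) (fun w => Ek w * Tk w * g' w) w = Ek w * Tk w * pd (Nw k) g' w.
    rewrite (@pdM _ _ w (fun w => Ek w * Tk w) g'); [|by apply: C1; smooth|exact: C1].
    rewrite pd_Ek_mul ?pd_Nw_Ek ?pd_Nw_Tk; last exact: smooth_Tk.
    by rewrite !(mul0r, mulr0, add0r).
  rewrite -(box_pd_eq _ eqz' Bw) (@pdD _ _ w (hDz a') b'); [|by apply: C1; smooth|exact: C1].
  rewrite pd_Nw_hDz // wb' // addr0 (vf0_box _ (wa' k) Bw) add0r.
  by case: k => [|k]; rewrite /= /cst ?wa' ?mulr0.
exists (g' c) => w Bw.
have -> : g' c = g' w.
  apply: (box_indep (P := xpred0) rg') => //; last exact: box_center.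
  by move=> i _ w' Bw'; case: i => [||k|k]; [exact: wonly0|exact: wonly0|exact: wonly0|exact: g'k].
by split; [rewrite /g' addrC subrK|rewrite eqz' // mulrC|rewrite eqy' // mulrC].
Qed.

Definition yzonly f := wfree f /\ qfree f.

Lemma yzonlyP f : (forall i, i <> Ny -> i <> Nz -> forall w, B w -> pd i f w = 0) -> yzonly f.
Proof. by move=> f0; split=> k w; apply: f0. Qed.

Lemma yzonly0 f i w : yzonly f -> i <> Ny -> i <> Nz -> B w -> pd i f w = 0.
Proof.
by move=> [wf qf]; case: i => [//|//|k|k] _ _ Bw; [exact: qf|exact: wf].
Qed.

Lemma yzonly_pd i f : reg f -> yzonly f -> yzonly (pd i f).
Proof.
move=> rf yf; apply: yzonlyP => j jy jz w Bw.
rewrite (smooth_pdC i j (reg_smooth rf Bw)).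
by apply: pd0_box => // w' Bw'; exact: yzonly0.
Qed.

Lemma box_pdD i f g w : reg f -> reg g -> B w ->
  pd i (fun w => f w + g w) w = pd i f w + pd i g w.
Proof.
by move=> rf rg Bw; apply: pdD; apply: smooth_C1; [exact: reg_smooth rf Bw|exact: reg_smooth rg Bw].
Qed.

Lemma box_pdZ i x f w : reg f -> B w -> pd i (fun w => x * f w) w = x * pd i f w.
Proof.
move=> rf Bw; rewrite (@pdM _ _ w (cst x) f); [|exact: C1_cst|].
  by rewrite pdcst mul0r add0r.
by apply: smooth_C1; exact: reg_smooth rf Bw.
Qed.

Lemma regZ x f : reg f -> reg (fun w => x * f w).
Proof. by move=> rf; apply: regM => //; exact: reg_cst. Qed.

Lemma yzonly_comb x y f g h : reg f -> reg g -> yzonly f -> yzonly g ->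
  (forall w, B w -> h w = x * f w + y * g w) -> yzonly h.
Proof.
move=> rf rg yf yg hE; apply: yzonlyP => i iy iz w Bw.
rewrite (box_pd_eq _ hE Bw) box_pdD ?box_pdZ //; [|exact: regZ|exact: regZ].
by rewrite !yzonly0 // !mulr0 addr0.
Qed.

(** The right-hand sides x E T and x E S have the q_k-derivatives x tau_k E^2 and -x tau_(k-1) E^2,
    so E^2 is the only function that enters the equations for the coefficients from outside. *)
Definition Ek2 w : R := Ek w * Ek w.

Lemma reg_Ek2 : reg Ek2.
Proof. by apply: regM; exact: reg_Ek. Qed.

Lemma yzonly_Ek2 : yzonly Ek2.
Proof.
split=> k w _; rewrite /Ek2 pd_Ek_mul; try exact: smooth_Ek.
  by rewrite pd_Nw_Ek mul0r mulr0 addr0.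
by rewrite pd_Nq_Ek mul0r mulr0 addr0.
Qed.

Lemma pd_yz_Ek2 v w : v = Ny \/ v = Nz -> pd v Ek2 w = 2 * Ek2 w.
Proof.
move=> vyz; rewrite /Ek2 pd_Ek_mul; last exact: smooth_Ek.
have -> : pd v Ek w = Ek w.
  rewrite (pd_vf _ (smooth_Ek w)); cbv beta delta [Ek]; vf_expand.
  by case: vyz => ->; rewrite /cst /= !kgE ?addr0 ?add0r mulr1.
ring.
Qed.

Lemma wfree_pd i f : reg f -> wfree f -> wfree (pd i f).
Proof.
move=> rf wf k w Bw; rewrite (smooth_pdC i (Nw k) (reg_smooth rf Bw)).
by apply: pd0_box => // w' Bw'; exact: wf.
Qed.

Lemma pd_Nq_hDz_wfree k f w : reg f -> wfree f -> B w ->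
  pd (Nq k) (hDz f) w = hDz (pd (Nq k) f) w + pd (Nq (k + 1)) f w.
Proof.
by move=> rf wf Bw; rewrite pd_Nq_hDz ?hA_wfree ?mulr0 ?addr0 //; exact: reg_smooth rf Bw.
Qed.

Lemma pd_Nq_hDy_wfree k f w : reg f -> wfree f -> B w ->
  pd (Nq k) (hDy f) w = hDy (pd (Nq k) f) w + pd (Nq (k - 1)) f w.
Proof.
by move=> rf wf Bw; rewrite pd_Nq_hDy ?hA_wfree ?mulr0 ?addr0 //; exact: reg_smooth rf Bw.
Qed.

(** Differentiating D_z h = u in q_(k-1) gives D_z h_(k-1) + h_k = 0 for the derivatives h_k, so
    vanishing spreads upward from the lowest index. *)
Lemma qfree_of_hDz h u : reg h -> wfree h -> yzonly u ->
  (forall w, B w -> hDz h w = u w) -> qfree h.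
Proof.
move=> rh wh [_ qu] hu k; have [n [hn _]] := reg_bound rh.
apply: (@int_upward (fun k => forall w, B w -> pd (Nq k) h w = 0) (- n%:Z) k _ _ k) => //.
  by move=> l ln w Bw; apply: hn => //; lia.
move=> l _ Pl w Bw; have := pd_Nq_hDz_wfree (l - 1) rh wh Bw.
by rewrite (box_pd_eq _ hu Bw) qu // (vf0_box _ Pl) // add0r subrK.
Qed.

(** Descent on the pair a_(k+1), b_k, the derivatives in q_(k+1) and q_k. The first equation makes
    D_z a_(k+1) a function of y and z, so a_(k+1) is free of the q_l by [qfree_of_hDz]; the second
    then gives b_k without any integration. *)
Lemma affine_coefficients a b x : reg a -> reg b -> wfree a -> wfree b ->
  (forall w, B w -> hDz a w + b w = x * (Ek w * Tk w)) ->
  (forall w, B w -> hDy b w + a w = x * (Ek w * Sk w)) ->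
  forall k, [/\ yzonly (pd (Nq k) a), yzonly (pd (Nq k) b),
    forall w, B w -> pd Nz (pd (Nq k) a) w + pd (Nq (k + 1)) a w + pd (Nq k) b w =
      x * tau k * Ek2 w &
    forall w, B w -> pd Ny (pd (Nq k) b) w + pd (Nq (k - 1)) b w + pd (Nq k) a w =
      - (x * tau (k - 1)) * Ek2 w].
Proof.
move=> ra rb wa wb eqz eqy.
have C1 f w : smooth w f -> C1_at w f by exact: smooth_C1.
have eqzk k w : B w -> hDz (pd (Nq k) a) w + pd (Nq (k + 1)) a w + pd (Nq k) b w =
    x * tau k * Ek2 w.
  move=> Bw; rewrite -pd_Nq_hDz_wfree // -box_pdD //; last exact: reg_hDz.
  rewrite (box_pd_eq _ eqz Bw) (@pdM _ _ w (cst x) (fun w => Ek w * Tk w));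
    [|exact: C1_cst|by apply: C1; smooth].
  rewrite pdcst mul0r add0r /cst pd_Ek_mul ?pd_Nq_Ek ?pd_Nq_Tk; last exact: smooth_Tk.
  by rewrite /Ek2; ring.
have eqyk k w : B w -> hDy (pd (Nq k) b) w + pd (Nq (k - 1)) b w + pd (Nq k) a w =
    - (x * tau (k - 1)) * Ek2 w.
  move=> Bw; rewrite -pd_Nq_hDy_wfree // -box_pdD //; last exact: reg_hDy.
  rewrite (box_pd_eq _ eqy Bw) (@pdM _ _ w (cst x) (fun w => Ek w * Sk w));
    [|exact: C1_cst|by apply: C1; smooth].
  rewrite pdcst mul0r add0r /cst pd_Ek_mul ?pd_Nq_Ek ?pd_Nq_Sk; last exact: smooth_Sk.
  by rewrite /Ek2; ring.
have [na [an _]] := reg_bound ra; have [nb [bn _]] := reg_bound rb.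
have yz0 f : (forall w, B w -> f w = 0) -> yzonly f.
  by move=> f0; apply: yzonlyP => i _ _ w Bw; exact: pd0_box.
have HQ k : yzonly (pd (Nq (k + 1)) a) /\ yzonly (pd (Nq k) b).
  apply: (@int_downward (fun k => yzonly (pd (Nq (k + 1)) a) /\ yzonly (pd (Nq k) b))
    (na + nb)%N%:Z k _ _ k (lexx k)).
    by move=> l ln; split; apply: yz0; [apply: an|apply: bn]; lia.
  move=> l _ [ya yb].
  have ya1 : yzonly (pd (Nq (l + 1)) a).
    split; first exact: wfree_pd.
    pose u w := 1 * (x * tau (l + 1) * Ek2 w + -1 * pd (Nq (l + 1)) b w) +
      -1 * pd (Nq (l + 1 + 1)) a w.
    have ru : reg (fun w => x * tau (l + 1) * Ek2 w + -1 * pd (Nq (l + 1)) b w).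
      by apply: regD; apply: regZ; [exact: reg_Ek2|exact: reg_pd].
    have yu : yzonly u.
      apply: (yzonly_comb (x := 1) (y := -1) ru (reg_pd (Nq (l + 1 + 1)) ra) _ ya) => [|w _ //].
      by apply: (yzonly_comb (x := x * tau (l + 1)) (y := -1) reg_Ek2 (reg_pd (Nq (l + 1)) rb) yzonly_Ek2 yb).
    apply: (qfree_of_hDz (reg_pd _ ra) (wfree_pd _ ra wa) yu) => w Bw.
    by rewrite /u -eqzk //; ring.
  split; first exact: ya1.
  have ryb : reg (pd Ny (pd (Nq (l + 1)) b)) by do 2!apply: reg_pd => //.
  have rya : reg (fun w => 1 * pd Ny (pd (Nq (l + 1)) b) w + 1 * pd (Nq (l + 1)) a w).
    by apply: regD; apply: regZ => //; exact: reg_pd.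
  have yya : yzonly (fun w => 1 * pd Ny (pd (Nq (l + 1)) b) w + 1 * pd (Nq (l + 1)) a w).
    apply: (yzonly_comb (x := 1) (y := 1) ryb (reg_pd (Nq (l + 1)) ra) _ ya1 (fun w _ => erefl)).
    by apply: yzonly_pd => //; exact: reg_pd.
  apply: (yzonly_comb (x := -1) (y := - (x * tau l)) rya reg_Ek2 yya yzonly_Ek2) => w Bw.
  have := eqyk (l + 1) w Bw; rewrite addrK => <-.
  rewrite hDy_yz //; [ring|exact: yb.1|exact: yb.2|].
  exact: reg_smooth (reg_pd _ rb) Bw.
move=> k; have [_ yb] := HQ k; have [ya _] := HQ (k - 1); rewrite subrK in ya.
split=> // w Bw.
  rewrite -eqzk // hDz_yz //; [exact: ya.1|exact: ya.2|].
  exact: reg_smooth (reg_pd _ ra) Bw.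
rewrite -eqyk // hDy_yz //; [exact: yb.1|exact: yb.2|].
exact: reg_smooth (reg_pd _ rb) Bw.
Qed.

End BoxStages.

(** * Vanishing of the constant x *)

Section LinearStage.
Context {R : realType}.
Local Notation kg := {ptws kgvar -> R}.
Local Notation hDy := (vf (@Yy R)).
Local Notation hDz := (vf (@Yz R)).
Implicit Types (w : kg) (f g h : kg -> R).

Context (c : kg) (s : seq kgvar) (e : R) (e0 : 0 < e).
Local Notation B := (box c s e).
Local Notation reg := (reg c s e).
Local Notation wfree := (wfree c s e).
Local Notation yzonly := (yzonly c s e).

Lemma reg_iter_pd m v f : reg f -> reg (iter m (pd v) f).
Proof. by move=> rf; elim: m => [//|m IHm]; exact: reg_pd. Qed.

Lemma iter_pd_comb m v x y f g h : reg f -> reg g ->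
  (forall w, B w -> h w = x * f w + y * g w) ->
  forall w, B w -> iter m (pd v) h w = x * iter m (pd v) f w + y * iter m (pd v) g w.
Proof.
move=> rf rg hE; elim: m => [//|m IHm] w Bw /=.
have [rfm rgm] := (reg_iter_pd m v rf, reg_iter_pd m v rg).
rewrite (box_pd_eq _ IHm Bw) (box_pdD _ (regZ x rfm) (regZ y rgm) Bw).
by rewrite (box_pdZ _ _ rfm Bw) (box_pdZ _ _ rgm Bw).
Qed.

Lemma iter_pdC m v i f : reg f -> forall w, B w ->
  iter m (pd v) (pd i f) w = pd i (iter m (pd v) f) w.
Proof.
move=> rf; elim: m => [//|m IHm] w Bw /=.
rewrite (box_pd_eq _ IHm Bw).
exact: (smooth_pdC i v (reg_smooth (reg_iter_pd m v rf) Bw)).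
Qed.

Lemma iter_pd0 m v f : (forall w, B w -> f w = 0) ->
  forall w, B w -> iter m (pd v) f w = 0.
Proof.
move=> f0; elim: m => [//|m IHm] w Bw.
exact: (pd0_box _ IHm Bw).
Qed.

Lemma iter_pd_Ek2 m w : B w -> iter m (pd Nz) (@Ek2 R) w = 2 ^+ m * Ek2 w.
Proof.
elim: m w => [|m IHm] w Bw; first by rewrite mul1r.
rewrite /= (box_pd_eq _ IHm Bw) (box_pdZ _ _ (reg_Ek2 c s e) Bw).
by rewrite pd_yz_Ek2 ?exprS; [ring|right].
Qed.

(* [f] agrees with [x * Ek2] up to a term killed by [m] derivatives in z. *)
Definition Ek2_mod m x f := forall w, B w -> iter m (pd Nz) f w = x * (2 ^+ m * Ek2 w).

Lemma Ek2_modS m x f : Ek2_mod m x f -> Ek2_mod m.+1 x f.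
Proof.
move=> fx w Bw; rewrite /= (box_pd_eq _ fx Bw).
rewrite (box_pdZ _ x (regZ _ (reg_Ek2 c s e)) Bw) (box_pdZ _ _ (reg_Ek2 c s e) Bw).
by rewrite pd_yz_Ek2 ?exprS; [ring|right].
Qed.

Lemma Ek2_mod_comb m x y a b f g h : reg f -> reg g -> Ek2_mod m x f -> Ek2_mod m y g ->
  (forall w, B w -> h w = a * f w + b * g w) -> Ek2_mod m (a * x + b * y) h.
Proof.
move=> rf rg fx gy hE w Bw.
by rewrite (iter_pd_comb m Nz rf rg hE Bw) fx // gy //; ring.
Qed.

Lemma Ek2_mod_Ek2 m : Ek2_mod m 1 Ek2.
Proof. by move=> w Bw; rewrite iter_pd_Ek2 // mul1r. Qed.

Lemma Ek2_mod_pdy m x f : reg f -> Ek2_mod m x f -> Ek2_mod m (2 * x) (pd Ny f).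
Proof.
move=> rf fx w Bw; rewrite iter_pdC // (box_pd_eq _ fx Bw).
rewrite (box_pdZ _ x (regZ _ (reg_Ek2 c s e)) Bw) (box_pdZ _ _ (reg_Ek2 c s e) Bw).
by rewrite pd_yz_Ek2; [ring|left].
Qed.

(** One integration in z: E^2 is half of its z-derivative, and the unknown function of y is killed
    by the additional derivative. *)
Lemma Ek2_mod_pdz m x f : Ek2_mod m (2 * x) (pd Nz f) -> Ek2_mod m.+1 x f.
Proof. by move=> fx w Bw; rewrite iterSr fx // exprS; ring. Qed.

Lemma Ek2_mod0 m f : (forall w, B w -> f w = 0) -> Ek2_mod m 0 f.
Proof. by move=> f0 w Bw; rewrite iter_pd0 // mul0r. Qed.

(* The coefficients of the expansion at lambda = oo of
   (1/2) (1 - 1/lambda)^2 / (1 + 1/lambda); [tau] is that of the numerator. *)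
Definition useq (k : int) : R :=
  if 0 < k then 0 else if k == 0 then 2^-1 else if k == -1 then - (3 / 2)
  else 2 * (-1) ^+ absz k.

Lemma useqD k : useq k + useq (k + 1) = tau k.
Proof.
rewrite /useq /tau.
have [k0|k0] := ltP 0 k.
  have -> : 0 < k + 1 by lia.
  have -> : (k == 0) = false by apply/eqP; lia.
  have -> : (k == -1) = false by apply/eqP; lia.
  have -> : (k == -2) = false by apply/eqP; lia.
  by rewrite addr0.
have [->|k1] := eqVneq k 0; first by rewrite /= addr0.
have [->|k2] := eqVneq k (-1); first by rewrite /=; field.
have [->|k3] := eqVneq k (-2); first by rewrite /=; field.
have -> : (0 < k + 1) = false by apply/negP; lia.
have -> : (k + 1 == 0) = false by apply/eqP; move/eqP: k2; lia.
have -> : (k + 1 == -1) = false by apply/eqP; move/eqP: k3; lia.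
have -> : absz k = (absz (k + 1)).+1 by lia.
by rewrite exprS; ring.
Qed.

(** On multiples of E^2 the derivatives in y and z both act as 2. With lambda^k in place of q_k the
    coefficient equations read (2 + 1/lambda) a + b = x tau and (2 + lambda) b + a = -x lambda tau,
    with the solution a = -b = x u, u = tau / (1 + 1/lambda). The coefficients of u are [useq]; they
    never become zero as k decreases, whereas b involves finitely many q_k. Each step down
    integrates once in z, so the comparison is made modulo terms killed by some number of
    z-derivatives. *)
Lemma inhomogeneity_eq0 a b x : reg a -> reg b -> wfree a -> wfree b ->
  (forall w, B w -> hDz a w + b w = x * (Ek w * Tk w)) ->
  (forall w, B w -> hDy b w + a w = x * (Ek w * Sk w)) -> x = 0.
Proof.
move=> ra rb wa wb eqz eqy.
have H := affine_coefficients e0 ra rb wa wb eqz eqy.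
have [na [an _]] := reg_bound ra; have [nb [bn _]] := reg_bound rb.
have rak k : reg (pd (Nq k) a) by exact: reg_pd.
have rbk k : reg (pd (Nq k) b) by exact: reg_pd.
have rE := reg_Ek2 c s e.
pose P k := exists m, Ek2_mod m (x * useq (k + 1)) (pd (Nq (k + 1)) a) /\
  Ek2_mod m (- (x * useq k)) (pd (Nq k) b).
have HP k : P k.
  apply: (@int_downward P (na + nb).+1%N%:Z k _ _ k (lexx k)).
    move=> l ln; exists 0%N.
    have [u0 u1] : useq l = 0 /\ useq (l + 1) = 0 by rewrite /useq !ifT //; lia.
    rewrite u0 u1 mulr0 oppr0; split; apply: Ek2_mod0; [apply: an|apply: bn]; lia.
  move=> l _ [m [am bm]].
  have am1 : Ek2_mod m.+1 (x * useq (l + 1)) (pd (Nq (l + 1)) a).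
    apply: Ek2_mod_pdz; have [_ _ eqa _] := H (l + 1).
    pose h w := -1 * pd (Nq (l + 1 + 1)) a w + -1 * pd (Nq (l + 1)) b w.
    have hm : Ek2_mod m (-1 * (x * useq (l + 1 + 1)) + -1 * - (x * useq (l + 1))) h.
      exact: (Ek2_mod_comb (rak _) (rbk _) am bm).
    have rh : reg h by apply: regD; exact: regZ.
    have hE w : B w -> pd Nz (pd (Nq (l + 1)) a) w = 1 * h w + x * tau (l + 1) * Ek2 w.
      by move=> Bw; rewrite /h -eqa //; ring.
    have := Ek2_mod_comb rh rE hm (@Ek2_mod_Ek2 m) hE.
    by rewrite -(useqD (l + 1)); congr Ek2_mod; ring.
  exists m.+1; split; first exact: am1.
  have [_ _ _ eqb] := H (l + 1); rewrite addrK in eqb.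
  pose h w := -1 * pd Ny (pd (Nq (l + 1)) b) w + -1 * pd (Nq (l + 1)) a w.
  have rpb : reg (pd Ny (pd (Nq (l + 1)) b)) by exact: reg_pd.
  have hm : Ek2_mod m.+1 (-1 * (2 * - (x * useq (l + 1))) + -1 * (x * useq (l + 1))) h.
    by apply: (Ek2_mod_comb rpb (rak _) _ am1) => //; apply: Ek2_mod_pdy => //; exact: Ek2_modS.
  have rh : reg h by apply: regD; exact: regZ.
  have hE w : B w -> pd (Nq l) b w = 1 * h w + - (x * tau l) * Ek2 w.
    by move=> Bw; rewrite /h -eqb //; ring.
  have := Ek2_mod_comb rh rE hm (@Ek2_mod_Ek2 m.+1) hE.
  by rewrite -(useqD l); congr Ek2_mod; ring.
(* So far down b has no coefficient, while [useq k] is 2 or -2. Taking [nb.+2] keeps k below 0 and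
   -1, the exceptional values of [useq]. *)
pose k : int := - (nb.+2)%:Z; have [m [_ bk]] := HP k.
have Bc : B c by exact: box_center.
have := bk c Bc; rewrite iter_pd0 //; last by apply: bn; rewrite /k; lia.
have -> : useq k = 2 * (-1) ^+ absz k.
  rewrite /useq; have -> : (0 < k) = false by apply/negP; rewrite /k; lia.
  have -> : (k == 0) = false by apply/eqP; rewrite /k; lia.
  by have -> : (k == -1) = false by apply/eqP; rewrite /k; lia.
have n0 : 2 * (-1) ^+ absz k * (2 ^+ m * Ek2 c) != 0.
  have t0 : 2 != 0 :> R by rewrite pnatr_eq0.
  apply: mulf_neq0; first by apply: mulf_neq0 => //; rewrite signr_eq0.
  by apply: mulf_neq0; [exact: expf_neq0|apply: mulf_neq0; exact: Ek_neq0].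
by move=> E; apply: (mulIf n0); rewrite mul0r -oppr0 [in RHS]E; ring.
Qed.

End LinearStage.

(** * Solutions of the Klein-Gordon equation affine in the q_k *)

Section SolutionsOfKleinGordon.
Context {R : realType}.
Local Notation kg := {ptws kgvar -> R}.
Local Notation hDy := (vf (@Yy R)).
Local Notation hDz := (vf (@Yz R)).
Implicit Types (w : kg) (f g h : kg -> R).

(** The generator of Lorentz boosts of the Klein-Gordon equation. It corresponds to [Jop]; the minus
    sign stems from r2 / 2 = -z. *)
Definition hJ f w : R := w Ny * hDy f w + - (w Nz * hDz f w).

Definition boost (k : nat) (m : int) : kg -> R := iter k hJ (fun w => w (Nq m)).

Ltac smooth_lemma ::= first [simple apply smooth_Yy | simple apply smooth_Yz]; smooth.

Lemma smooth_hJ f w : smooth w f -> smooth w (hJ f).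
Proof. by move=> sf; cbv beta delta [hJ]; smooth. Qed.

Lemma smooth_boost k m w : smooth w (boost k m).
Proof. by elim: k => [|k IHk]; [exact: smooth_coord|exact: smooth_hJ]. Qed.

(** From [D_y, J] = D_y and [D_z, J] = -D_z it follows that J commutes with D_z D_y. *)
Lemma hDzhDy_hJ f : (forall w, smooth w f) -> hDz (hDy f) = f ->
  hDz (hDy (hJ f)) = hJ f.
Proof.
move=> sf fE; apply/funext => w.
have yz : hDy (hDz f) = f by rewrite -[RHS]fE; apply/funext => w'; exact: hDyhDz.
have yE : hDy (hJ f) = fun w => hDy f w + (w Ny * hDy (hDy f) w + - (w Nz * f w)).
  apply/funext => w'; rewrite /hJ; vf_expand; rewrite yz /= /cst; ring.
have zyy : hDz (hDy (hDy f)) = hDy f.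
  by apply/funext => w'; rewrite -hDyhDz ?fE //; smooth.
rewrite yE; vf_expand; rewrite zyy fE /hJ /= /cst; ring.
Qed.

Lemma hDzhDy_boost k m : hDz (hDy (boost k m)) = boost k m.
Proof.
elim: k => [|k IHk]; last by apply: hDzhDy_hJ => // w; exact: smooth_boost.
apply/funext => w; rewrite /boost /=.
have -> : hDy (fun w => w (Nq m)) = fun w => w (Nq (m + 1)).
  by apply/funext => w'; rewrite vf_coord.
by rewrite vf_coord /= addrK.
Qed.

Context (c : kg) (s : seq kgvar) (e : R) (e0 : 0 < e).
Local Notation B := (box c s e).
Local Notation reg := (reg c s e).
Local Notation wfree := (wfree c s e).
Local Notation yzonly := (yzonly c s e).

Lemma iter_pd_leq m n v f : (m <= n)%N -> (forall w, B w -> iter m (pd v) f w = 0) ->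
  forall w, B w -> iter n (pd v) f w = 0.
Proof.
move=> /subnK <-; elim: (n - m)%N => [//|k IHk] f0 w Bw.
by rewrite addSn /=; exact: (pd0_box _ (IHk f0) Bw).
Qed.

(** Two steps in the index cost one derivative: in f_(i+2) differentiated floor(i/2) + 1 times, the
    recurrence leaves f_i differentiated floor(i/2) times and f_(i+1) differentiated floor(i/2) + 1
    times, both zero by induction. This halved count later bounds a degree. *)
Lemma iter_pd_nilpotent v1 v2 (f : nat -> kg -> R) : (forall i, reg (f i)) ->
  (forall w, B w -> f 0%N w = 0) -> (forall w, B w -> f 1%N w = 0) ->
  (forall i w, B w -> pd v1 (f i.+2) w = -1 * pd v2 (f i) w + -1 * pd v1 (pd v2 (f i.+1)) w) ->
  forall i w, B w -> iter i./2 (pd v1) (f i) w = 0.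
Proof.
move=> rf f0 f1 fS i.
suff [] : (forall w, B w -> iter i./2 (pd v1) (f i) w = 0) /\
  (forall w, B w -> iter i.+1./2 (pd v1) (f i.+1) w = 0) by [].
elim: i => [|i [IH0 IH1]]; first by split.
split=> // w Bw; rewrite (_ : i.+2./2 = i./2.+1) // iterSr.
rewrite (iter_pd_comb _ _ (reg_pd v2 (rf i)) (reg_pd v1 (reg_pd v2 (rf i.+1))) (fS i) Bw).
rewrite (iter_pdC _ _ _ (rf i) Bw) (pd0_box _ IH0 Bw) mulr0 add0r.
rewrite -iterSr (iter_pdC _ _ _ (rf i.+1) Bw).
have IH1' := @iter_pd_leq _ i./2.+1 _ _ _ IH1.
by rewrite (pd0_box _ (IH1' _) Bw) ?mulr0 //; lia.
Qed.

Lemma pd_exprn v i k w : pd i (fun w : kg => w v ^+ k.+1) w =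
  (i == v)%:R * (k.+1%:R * w v ^+ k).
Proof.
rewrite /pd; case: (eqVneq i v) => [->|iv].
  rewrite (_ : line _ _ _ = (fun t => t ^+ k.+1)); last first.
    by apply/funext => t; rewrite /line dfwithin.
  by rewrite exp_derive1 mul1r.
rewrite (_ : line _ _ _ = cst (w v ^+ k.+1)) ?derive1_cst ?mul0r //.
by apply/funext => t; rewrite /line dfwithout.
Qed.

Lemma reg_exprn v k : reg (fun w => w v ^+ k).
Proof.
elim: k => [|k IHk]; first by apply: reg_eq (reg_cst _ _ _ 1) => w _; rewrite expr0.
by apply: reg_eq (regM (reg_coord c s e v) IHk) => w _; rewrite exprS.
Qed.

Lemma box_pd_sum (T : Type) (r : seq T) (F : T -> kg -> R) i w :
  (forall t, reg (F t)) -> B w ->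
  pd i (fun w => \sum_(t <- r) F t w) w = \sum_(t <- r) pd i (F t) w.
Proof.
move=> rF Bw; have sF t : smooth w (F t) by exact: reg_smooth (rF t) Bw.
rewrite (pd_vf i (smooth_sum r sF)) vf_sum //.
by apply: eq_bigr => t _; rewrite -pd_vf.
Qed.

Lemma box_const f : reg f -> (forall i w, B w -> pd i f w = 0) ->
  forall w, B w -> f w = f c.
Proof.
move=> rf f0 w Bw; apply: (box_indep (P := xpred0) rf) => //; last exact: box_center.
by move=> i _ w' Bw'; exact: f0.
Qed.

(** The polynomial found for the derivative in [v] is integrated termwise; the difference from [u]
    has no derivatives left and is constant on the box. *)
Lemma polynomial_of_nilpotent n v u : reg u ->
  (forall i, i <> v -> forall w, B w -> pd i u w = 0) ->
  (forall w, B w -> iter n (pd v) u w = 0) ->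
  exists p : nat -> R, forall w, B w -> u w = \sum_(k < n) p k * w v ^+ k.
Proof.
elim: n u => [|n IHn] u ru u0 un.
  by exists (fun=> 0) => w Bw; rewrite big_ord0; exact: un.
have [|||p pE] := IHn (pd v u); first exact: reg_pd.
- move=> i iv w Bw; rewrite (smooth_pdC v i (reg_smooth ru Bw)).
  by apply: (pd0_box _ _ Bw) => w' Bw'; exact: (u0 i iv w' Bw').
- by move=> w Bw; rewrite -iterSr; exact: un.
pose F (k : 'I_n) w := p k / k.+1%:R * w v ^+ k.+1.
have rF k : reg (F k) by apply: regZ; exact: reg_exprn.
pose U w := \sum_(k < n) F k w.
have rU : reg U by exact: reg_sum.
have pdU i w : B w -> pd i U w = (i == v)%:R * \sum_(k < n) p k * w v ^+ k.
  move=> Bw; rewrite box_pd_sum // mulr_sumr; apply: eq_bigr => k _.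
  rewrite (box_pdZ _ _ (reg_exprn v k.+1) Bw) pd_exprn.
  by rewrite mulrCA; congr (_ * _); rewrite mulrA divfK // pnatr_eq0.
have rD : reg (fun w => u w + -1 * U w) by apply: regD => //; exact: regZ.
have pdD0 i w : B w -> pd i (fun w => u w + -1 * U w) w = 0.
  move=> Bw; rewrite (box_pdD _ ru (regZ _ rU) Bw) (box_pdZ _ _ rU Bw) pdU //.
  case: (eqVneq i v) => [->|/eqP iv]; first by rewrite pE // mul1r mulN1r subrr.
  by rewrite u0 // mul0r mulr0 addr0.
have constE := box_const rD pdD0.
exists (fun k => if k is k'.+1 then p k' / k'.+1%:R else u c + -1 * U c) => w Bw.
rewrite big_ord_recl /= expr0 mulr1 -(constE w Bw).
rewrite [X in _ = _ + X](_ : _ = U w); first by rewrite mulN1r subrK.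
by apply: eq_bigr => k _; rewrite /F /bump /= add1n.
Qed.

(** Remainders keep this form throughout the reduction, since the class is linear and contains every
    [boost]. *)
Definition solution b : Prop := [/\ reg b, wfree b,
  forall k, yzonly (pd (Nq k) b) & forall w, B w -> hDz (hDy b) w = b w].

Lemma wfree_hDy f : reg f -> wfree f -> wfree (hDy f).
Proof.
move=> rf wf k w Bw; rewrite pd_Nw_hDy; last exact: reg_smooth rf Bw.
rewrite (vf0_box _ (wf k) Bw) add0r; case: k => [|k] /=.
  by rewrite /cst mulr0 oppr0.
by rewrite wf // mulr0 oppr0.
Qed.

Lemma wfree_hDz f : reg f -> wfree f -> wfree (hDz f).
Proof.
move=> rf wf k w Bw; rewrite pd_Nw_hDz; last exact: reg_smooth rf Bw.
rewrite (vf0_box _ (wf k) Bw) add0r; case: k => [|k] /=.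
  by rewrite /cst mulr0.
by rewrite wf // mulr0.
Qed.

Lemma pd_Nq_hDy_affine b k w : reg b -> wfree b -> yzonly (pd (Nq k) b) -> B w ->
  pd (Nq k) (hDy b) w = pd Ny (pd (Nq k) b) w + pd (Nq (k - 1)) b w.
Proof.
move=> rb wb yb Bw; rewrite (pd_Nq_hDy_wfree _ rb wb Bw); congr (_ + _).
by apply: (hDy_yz yb.1 yb.2 Bw); exact: reg_smooth (reg_pd _ rb) Bw.
Qed.

Lemma pd_Nq_hDz_affine b k w : reg b -> wfree b -> yzonly (pd (Nq k) b) -> B w ->
  pd (Nq k) (hDz b) w = pd Nz (pd (Nq k) b) w + pd (Nq (k + 1)) b w.
Proof.
move=> rb wb yb Bw; rewrite (pd_Nq_hDz_wfree _ rb wb Bw); congr (_ + _).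
by apply: (hDz_yz yb.1 yb.2 Bw); exact: reg_smooth (reg_pd _ rb) Bw.
Qed.

Lemma cancel_fixed (t x y z : R) : t = x + y + (z + t) -> y + z + x = 0.
Proof. by move=> E; apply: (addIr t); rewrite add0r [RHS]E; ring. Qed.

Lemma solve_middle (x y z : R) : x + y + z = 0 -> y = -1 * x + -1 * z.
Proof. by move=> E; rewrite -[LHS]subr0 -E; ring. Qed.

(** The derivative of D_z D_y b = b in q_k. Raising and lowering the index once each restores the
    coefficient b_k, which cancels against the right-hand side. *)
Lemma solution_recurrence b k w : solution b -> B w ->
  pd Nz (pd (Nq (k - 1)) b) w + pd Ny (pd (Nq (k + 1)) b) w +
  pd Ny (pd Nz (pd (Nq k) b)) w = 0.
Proof.
move=> [rb wb yb bE] Bw.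
have rh := reg_hDy rb; have wh := wfree_hDy rb wb.
have rbk i : reg (pd (Nq i) b) by exact: reg_pd.
have hk w' : B w' -> pd (Nq k) (hDy b) w' = pd Ny (pd (Nq k) b) w' + pd (Nq (k - 1)) b w'.
  by move=> Bw'; exact: pd_Nq_hDy_affine.
have := pd_Nq_hDz_wfree k rh wh Bw; rewrite (box_pd_eq _ bE Bw) (box_vf_eq _ hk Bw).
rewrite pd_Nq_hDy_affine // addrK.
have sb i : smooth w (pd (Nq i) b) := reg_smooth (rbk i) Bw.
have spb : smooth w (pd Ny (pd (Nq k) b)) by exact: smooth_pd.
rewrite (vfD _ spb (sb (k - 1))).
have [y1 y2] := yzonly_pd Ny (rbk k) (yb k).
rewrite (hDz_yz y1 y2 Bw spb) (hDz_yz (yb (k - 1)).1 (yb (k - 1)).2 Bw (sb _)).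
rewrite (smooth_pdC Ny Nz (sb k)); exact: cancel_fixed.
Qed.

Lemma solution_comb x y f g h : solution f -> solution g ->
  (forall w, B w -> x * f w + y * g w = h w) -> solution h.
Proof.
move=> [rf wf yf fE] [rg wg yg gE] hE.
have rh : reg (fun w => x * f w + y * g w) by apply: regD; exact: regZ.
have hE' w : B w -> h w = x * f w + y * g w by move=> /hE ->.
have pdh i w : B w -> pd i h w = x * pd i f w + y * pd i g w.
  move=> Bw; rewrite (box_pd_eq _ hE' Bw) (box_pdD _ (regZ x rf) (regZ y rg) Bw).
  by rewrite (box_pdZ _ _ rf Bw) (box_pdZ _ _ rg Bw).
have vfh X w : B w -> vf X h w = x * vf X f w + y * vf X g w.
  move=> Bw; have [sf sg] := (reg_smooth rf Bw, reg_smooth rg Bw).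
  rewrite (box_vf_eq _ hE' Bw) (@vfD _ _ X (fun w => x * f w) (fun w => y * g w)).
  - by rewrite !vfZ.
  - exact: (smoothM (smooth_cst _ x) sf).
  - exact: (smoothM (smooth_cst _ y) sg).
split.
- exact: reg_eq hE rh.
- by move=> k w Bw; rewrite pdh // wf // wg // !mulr0 addr0.
- move=> k; apply: (yzonly_comb (reg_pd _ rf) (reg_pd _ rg) (yf k) (yg k)) => w Bw.
  exact: pdh.
- move=> w Bw; rewrite (box_vf_eq _ (vfh (@Yy R)) Bw).
  have [sf sg] : smooth w (hDy f) /\ smooth w (hDy g).
    by split; apply: reg_smooth Bw; exact: reg_hDy.
  rewrite (@vfD _ _ _ (fun w => x * hDy f w) (fun w => y * hDy g w)).
  - by rewrite !vfZ // fE // gE // hE.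
  - exact: (smoothM (smooth_cst _ x) sf).
  - exact: (smoothM (smooth_cst _ y) sg).
Qed.

Lemma solution0 : solution (cst 0).
Proof.
split.
- exact: reg_cst.
- by move=> k w Bw; exact: pdcst.
- move=> k; apply: yzonlyP => i _ _ w Bw; apply: pd0_box Bw => w' _; exact: pdcst.
- move=> w Bw; rewrite (vf0_box _ _ Bw) // => w' Bw'; exact: vf_cst.
Qed.

Lemma yzonlyM f g : reg f -> reg g -> yzonly f -> yzonly g -> yzonly (fun w => f w * g w).
Proof.
move=> rf rg yf yg; apply: yzonlyP => i iy iz w Bw.
rewrite pdM; [|exact: smooth_C1 (reg_smooth rf Bw)|exact: smooth_C1 (reg_smooth rg Bw)].
by rewrite (yzonly0 yf iy iz Bw) (yzonly0 yg iy iz Bw) mul0r mulr0 addr0.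
Qed.

Lemma yzonly_coord v : v = Ny \/ v = Nz -> yzonly (fun w => w v).
Proof.
move=> vyz; apply: yzonlyP => i iy iz w Bw; rewrite pd_coord.
by case: eqP => // iv; case: vyz => vE; [case: iy|case: iz]; rewrite iv.
Qed.

Lemma reg_hJ f : reg f -> reg (hJ f).
Proof.
move=> rf; apply: regD; first by apply: regM; [exact: reg_coord|exact: reg_hDy].
by apply: regN; apply: regM; [exact: reg_coord|exact: reg_hDz].
Qed.

Lemma pd_hJ i f w : reg f -> i <> Ny -> i <> Nz -> B w ->
  pd i (hJ f) w = w Ny * pd i (hDy f) w + - (w Nz * pd i (hDz f) w).
Proof.
move=> rf iy iz Bw; have ry := reg_hDy rf; have rz := reg_hDz rf.
have ryc := regM (reg_coord c s e Ny) ry; have rzc := regM (reg_coord c s e Nz) rz.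
rewrite (box_pdD _ ryc (regN rzc) Bw).
have pdc v g : reg g -> i <> v -> pd i (fun w => w v * g w) w = w v * pd i g w.
  move=> rg iv; rewrite (@pdM _ _ w (fun w => w v) g); [|exact: C1_coord|].
    by rewrite pd_coord; case: eqP => // _; rewrite mul0r add0r.
  exact: smooth_C1 (reg_smooth rg Bw).
rewrite pdc //; congr (_ + _).
rewrite (pd_vf i (reg_smooth (regN rzc) Bw)) (vfN _ (reg_smooth rzc Bw)).
by rewrite -(pd_vf i (reg_smooth rzc Bw)) pdc.
Qed.

Lemma comb_ones (x y y1 z1 y2 z2 : R) : 1 * (x * (1 * y1 + 1 * z1)) + -1 * (y * (1 * y2 + 1 * z2)) =
  x * (y1 + z1) + - (y * (y2 + z2)).
Proof. ring. Qed.

(** In J the term y D_y raises indices by one with the factor y, and z D_z lowers them by one; hence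
    the support between m - k and m + k and the leading coefficient y^k. *)
Lemma boost_coefficients k m : [/\ reg (boost k m), wfree (boost k m),
  forall l, yzonly (pd (Nq l) (boost k m)),
  forall l : int, l < m - k%:Z \/ m + k%:Z < l -> forall w, B w -> pd (Nq l) (boost k m) w = 0 &
  forall l : int, l = m + k%:Z -> forall w, B w -> pd (Nq l) (boost k m) w = w Ny ^+ k].
Proof.
elim: k => [|k [rk wk yk sk tk]].
  have pdE l w : pd (Nq l) (boost 0 m) w = (l == m)%:R by rewrite pd_coord eq_Nq.
  split.
  - exact: reg_coord.
  - by move=> l w Bw; rewrite pd_coord neq_Nqw.
  - move=> l; apply: yzonlyP => i _ _ w Bw.
    by rewrite (@box_pd_eq _ _ c s e i _ (cst (l == m)%:R)) ?pdcst.
  - by move=> l lm w Bw; rewrite pdE (_ : (l == m) = false) //; apply/eqP; lia.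
  - by move=> l -> w Bw; rewrite pdE addr0 eqxx expr0.
have JE l w : B w -> pd (Nq l) (boost k.+1 m) w =
    w Ny * (pd Ny (pd (Nq l) (boost k m)) w + pd (Nq (l - 1)) (boost k m) w) +
    - (w Nz * (pd Nz (pd (Nq l) (boost k m)) w + pd (Nq (l + 1)) (boost k m) w)).
  by move=> Bw; rewrite pd_hJ // pd_Nq_hDy_affine // pd_Nq_hDz_affine.
have rk1 : reg (boost k.+1 m) by exact: reg_hJ.
have rkl l : reg (pd (Nq l) (boost k m)) by exact: reg_pd.
have J0 l : l < m - k.+1%:Z \/ m + k.+1%:Z < l ->
    forall w, B w -> pd (Nq l) (boost k.+1 m) w = 0.
  move=> lm w Bw; rewrite JE // !(pd0_box _ (sk l _) Bw); [|lia|lia].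
  by rewrite !sk //; [ring|lia|lia].
split; [exact: rk1| | |exact: J0|].
- move=> l w Bw; rewrite pd_hJ // wfree_hDy // wfree_hDz //.
  by rewrite !mulr0 oppr0 addr0.
- move=> l; pose y1 w := w Ny * (1 * pd Ny (pd (Nq l) (boost k m)) w + 1 * pd (Nq (l - 1)) (boost k m) w).
  pose z1 w := w Nz * (1 * pd Nz (pd (Nq l) (boost k m)) w + 1 * pd (Nq (l + 1)) (boost k m) w).
  have aux v l' : v = Ny \/ v = Nz -> reg (fun w => w v * (1 * pd v (pd (Nq l) (boost k m)) w +
      1 * pd (Nq l') (boost k m) w)) /\ yzonly (fun w => w v * (1 * pd v (pd (Nq l) (boost k m)) w +
      1 * pd (Nq l') (boost k m) w)).
    move=> vyz; have r1 : reg (fun w => 1 * pd v (pd (Nq l) (boost k m)) w + 1 * pd (Nq l') (boost k m) w).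
      by apply: regD; apply: regZ => //; exact: reg_pd.
    split; first by apply: regM => //; exact: reg_coord.
    apply: yzonlyM => //; [exact: reg_coord|exact: yzonly_coord|].
    apply: (yzonly_comb (reg_pd v (rkl l)) (rkl l') _ (yk l') (fun w _ => erefl)).
    exact: yzonly_pd.
  have [ry yy] := aux Ny (l - 1) (or_introl erefl).
  have [rz yz] := aux Nz (l + 1) (or_intror erefl).
  apply: (yzonly_comb (x := 1) (y := -1) ry rz yy yz).
  by move=> w' Bw'; rewrite [RHS]comb_ones; exact: JE.
- move=> l lE w Bw; rewrite JE //.
  rewrite !(pd0_box _ (sk l _) Bw); [|lia|lia].
  rewrite (tk (l - 1)) //; last by lia.
  by rewrite (sk (l + 1)) //; [rewrite exprS; ring|lia].
Qed.

Lemma solution_boost k m : solution (boost k m).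
Proof.
by have [rb wb yb _ _] := boost_coefficients k m; split=> // w Bw; rewrite hDzhDy_boost.
Qed.

Lemma solution_sum (T : Type) (r : seq T) (F : T -> kg -> R) :
  (forall t, solution (F t)) -> solution (fun w => \sum_(t <- r) F t w).
Proof.
move=> sF; elim: r => [|t r IHr].
  by apply: (solution_comb (x := 0) (y := 0) solution0 solution0) => w _;
    rewrite big_nil /cst mulr0 addr0.
by apply: (solution_comb (x := 1) (y := 1) (sF t) IHr) => w _; rewrite big_cons !mul1r.
Qed.

(** Induction on the length of the window of indices occurring in b. The coefficient at the top
    index N is a polynomial in y of degree at most n/2 with coefficients p_k, and the sum of the p_k
    J^k q_(N-k) has the same top coefficient. The lowest index of such a term, N - 2k, is at least N
    - n = lo, so the window shrinks at the top and does not grow at the bottom. *)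
Lemma solution_reduction n (lo : int) b : solution b ->
  (forall k : int, k < lo \/ lo + n%:Z <= k -> forall w, B w -> pd (Nq k) b w = 0) ->
  exists (L : seq (R * (nat * int))) f, [/\ reg f, yzonly f &
    forall w, B w -> b w = \sum_(t <- L) t.1 * boost t.2.1 t.2.2 w + f w].
Proof.
elim: n b => [|n IHn] b sb b0.
  have [rb wb _ _] := sb; exists [::], b; split=> //.
    by split=> // k; apply: b0; lia.
  by move=> w Bw; rewrite big_nil add0r.
have [rb wb yb _] := sb; pose N := lo + n%:Z.
have rbk k : reg (pd (Nq k) b) by exact: reg_pd.
(* The recurrence at N + 1 involves the coefficients at N, N + 1 and N + 2, of which the last two
   vanish. *)
have zN w : B w -> pd Nz (pd (Nq N) b) w = 0.
  move=> Bw; have := solution_recurrence (N + 1) sb Bw; rewrite addrK.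
  rewrite (pd0_box _ (b0 (N + 1 + 1) _) Bw); last by rewrite /N; lia.
  rewrite (@pd0_box _ c s e Ny _ _ _ Bw) ?addr0 // => w' Bw'.
  by apply: pd0_box Bw'; apply: b0; rewrite /N; lia.
have nilN w : B w -> iter n./2.+1 (pd Ny) (pd (Nq N) b) w = 0.
  (* The offset 2 makes f_0 and f_1 the two vanishing coefficients just below the window. *)
  pose f (i : nat) := pd (Nq (lo - 2 + i%:Z)) b.
  have fN : f n.+2 = pd (Nq N) b by congr (pd (Nq _) b); rewrite /N; lia.
  have fS i w' : B w' -> pd Ny (f i.+2) w' =
      -1 * pd Nz (f i) w' + -1 * pd Ny (pd Nz (f i.+1)) w'.
    move=> Bw'; have := solution_recurrence (lo - 2 + i.+1%:Z) sb Bw'.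
    have -> : lo - 2 + i.+1%:Z - 1 = lo - 2 + i%:Z by lia.
    have -> : lo - 2 + i.+1%:Z + 1 = lo - 2 + i.+2%:Z by lia.
    exact: solve_middle.
  have f0 : forall w, B w -> f 0%N w = 0 by apply: b0; lia.
  have f1 : forall w, B w -> f 1%N w = 0 by apply: b0; lia.
  move=> Bw; rewrite -fN -[n./2.+1]/(n.+2./2).
  exact: (iter_pd_nilpotent (fun i => rbk _) f0 f1 fS).
have [|p pE] := polynomial_of_nilpotent (v := Ny) (rbk N) _ nilN.
  move=> i iy w Bw; case: (eqVneq i Nz) => [->|/eqP iz]; first exact: zN.
  exact: yzonly0 (yb N) iy iz Bw.
pose F (k : 'I_(n./2.+1)) w := p k * boost k (N - k%:Z) w.
have sF k : solution (F k).
  have := solution_boost k (N - k%:Z).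
  by move=> sk; apply: (solution_comb (x := p k) (y := 0) sk solution0) => w _;
    rewrite /cst mulr0 addr0.
pose b' w := 1 * b w + -1 * \sum_k F k w.
have sS := solution_sum (index_enum _) sF.
have sb' : solution b' by exact: (solution_comb sb sS (fun w _ => erefl)).
have pdF l (k : 'I_(n./2.+1)) w : B w -> pd (Nq l) (F k) w = p k * pd (Nq l) (boost k (N - k%:Z)) w.
  by move=> Bw; have [rk _ _ _ _] := boost_coefficients k (N - k%:Z); exact: box_pdZ rk Bw.
have rF k : reg (F k) by have [] := sF k.
have rS : reg (fun w => \sum_k F k w) by have [] := sS.
have pdb' l w : B w -> pd (Nq l) b' w = pd (Nq l) b w - \sum_k pd (Nq l) (F k) w.
  move=> Bw; rewrite (box_pdD _ (regZ _ rb) (regZ _ rS) Bw).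
  by rewrite (box_pdZ _ _ rb Bw) (box_pdZ _ _ rS Bw) (box_pd_sum _ _ rF Bw) mul1r mulN1r.
have topE k : N = N - k%:Z + k%:Z by rewrite subrK.
have [|L [f [rf yf fE]]] := IHn b' sb'.
  move=> k kN w Bw; rewrite pdb' //.
  have [->|kNe] := eqVneq k N.
    rewrite (pE _ Bw); apply/eqP; rewrite subr_eq0; apply/eqP; apply: eq_bigr => l _.
    have [_ _ _ _ tl] := boost_coefficients l (N - l%:Z).
    by rewrite (pdF _ _ _ Bw) (tl N (topE l) w Bw).
  rewrite (b0 k _ w Bw); last by move/eqP: kNe; rewrite /N; lia.
  rewrite big1 ?subr0 // => l _; rewrite (pdF _ _ _ Bw).
  have [_ _ _ sl _] := boost_coefficients l (N - l%:Z).
  rewrite (sl k _ w Bw) ?mulr0 //.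
  by have := ltn_ord l; move/eqP: kNe; move: kN; rewrite /N; lia.
exists ([seq (p (k : 'I_(n./2.+1)), ((k : nat), N - k%:Z)) | k <- index_enum _] ++ L), f.
split=> // w Bw; rewrite big_cat big_map /= -addrA -(fE w Bw) /b' mul1r mulN1r.
by rewrite addrC subrK.
Qed.

End SolutionsOfKleinGordon.

(** * The three families *)

Section Families.
Context {R : realType}.
Local Notation jet := {ptws jetvar -> R}.
Implicit Types (j p : jet) (f g : jet -> R) (lam mu : 'I_3 -> jet -> R).

Definition Xadv (i : 'I_3) (v : jetvar) : jet -> R :=
  fun j => cst 1 j * Xt v j + V i j * Xx v j.

Ltac smooth_lemma ::= first [simple apply smooth_Xx | simple apply smooth_Dx |
  simple apply smooth_r | simple apply smooth_V | simple apply smooth_Xt |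
  simple apply smooth_Dt | simple apply smooth_half_gap | simple apply smooth_qt |
  simple apply smooth_omega]; smooth.

Lemma vf_Xadv i f j : smooth j f -> Dt f j + V i j * Dx f j = vf (Xadv i) f j.
Proof.
by move=> sf; rewrite (vf_linear _ _ _ _ sf) Dt_vf // Dx_vf // mul1r.
Qed.

Definition cosymmetry_at lam j : Prop :=
  [/\ vf (Xadv i1) (lam i1) j =
        r i2 1 j * (lam i2 j - lam i1 j) + r i3 1 j * lam i3 j,
      vf (Xadv i2) (lam i2) j =
        r i1 1 j * (lam i1 j - lam i2 j) + r i3 1 j * lam i3 j &
      vf (Xadv i3) (lam i3) j + (r i1 1 j + r i2 1 j) * lam i3 j = 0].

Lemma near_smooth_family (I : finType) (mu : I -> jet -> R) p :
  (forall l, smooth p (mu l)) -> \forall j \near p, forall l, smooth j (mu l).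
Proof.
move=> smu; apply: (@filter_forall _ _ _ (nbhs p)) => l; exact: near_smooth.
Qed.

Lemma reduced_cosymmetryP p lam : reduced_cosymmetry p lam <->
  (forall i, smooth p (lam i)) /\ \forall j \near p, cosymmetry_at lam j.
Proof.
split=> [[sl eql]|[sl eql]].
  have sl' i : smooth p (lam i) by split; exact: sl.
  split=> //; apply: filterS2 (near_smooth_family sl') eql => j sj [].
  by rewrite !vf_Xadv.
split; first by move=> i; case: (sl i).
apply: filterS2 (near_smooth_family sl) eql => j sj [].
by rewrite -!vf_Xadv.
Qed.

Lemma reduced_cosymmetry_eq p lam mu : (\forall j \near p, forall i, mu i j = lam i j) ->
  reduced_cosymmetry p lam -> reduced_cosymmetry p mu.
Proof.
move=> ml /reduced_cosymmetryP[sl eql]; apply/reduced_cosymmetryP.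
have mli i : \forall j \near p, lam i j = mu i j.
  by apply: filterS ml => j mj; rewrite mj.
split; first by move=> i; exact: smooth_eq (mli i) (sl i).
have ml2 := near_join ml.
apply: filterS2 ml2 eql => j mlj [E1 E2 E3].
have mE i : vf (Xadv i) (mu i) j = vf (Xadv i) (lam i) j.
  by apply: vf_eq; apply: filterS mlj => w mw; rewrite mw.
by have mj := nbhs_singleton mlj; split; rewrite mE !mj.
Qed.

Lemma reduced_cosymmetry_sum p n (c : 'I_n -> R) (mu : 'I_n -> 'I_3 -> jet -> R) :
  (forall l, reduced_cosymmetry p (mu l)) ->
  reduced_cosymmetry p (fun i j => \sum_(l < n) c l * mu l i j).
Proof.
move=> rmu; have smu l i : smooth p (mu l i) by have [] := (reduced_cosymmetryP p (mu l)).1 (rmu l).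
apply/reduced_cosymmetryP; split.
  by move=> i; apply: smooth_sum => l; apply: smoothM => //; exact: smooth_cst.
have nmu : \forall j \near p, forall l, (forall i, smooth j (mu l i)) /\ cosymmetry_at (mu l) j.
  apply: (@filter_forall _ _ _ (nbhs p)) => l; have [_ nl] := (reduced_cosymmetryP p (mu l)).1 (rmu l).
  exact: (@filterS2 _ (nbhs p) _ _ _ _ (fun w a b => conj a b) (near_smooth_family (smu l)) nl).
apply: filterS nmu => j nj.
have vE i : vf (Xadv i) (fun j => \sum_(l < n) c l * mu l i j) j =
    \sum_(l < n) c l * vf (Xadv i) (mu l i) j.
  rewrite vf_sum; last by move=> l; apply: smoothM; [exact: smooth_cst|have [sl _] := nj l; exact: sl].
  by apply: eq_bigr => l _; rewrite vfZ //; have [sl _] := nj l; exact: sl.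
split; rewrite vE.
- rewrite -sumrB !mulr_sumr -big_split; apply: eq_bigr => l _ /=.
  by have [_ [-> _ _]] := nj l; ring.
- rewrite -sumrB !mulr_sumr -big_split; apply: eq_bigr => l _ /=.
  by have [_ [_ -> _]] := nj l; ring.
- rewrite mulr_sumr -big_split big1 // => l _ /=; have [_ [_ _ E]] := nj l.
  by rewrite mulrCA -mulrDr E mulr0.
Qed.

Lemma vf_Xadv_half_gap i j : vf (Xadv i) half_gap j =
  half_gap j * ((V i2 j * j (Jr i2 1) - V i1 j * j (Jr i1 1)) / 2 +
                V i j * ((j (Jr i1 1) - j (Jr i2 1)) / 2)).
Proof.
rewrite (vf_linear _ _ _ _ (smooth_half_gap j)) vf_Xt_half_gap vf_Xx_half_gap.
by rewrite /cst /=; ring.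
Qed.

(** Since D_t + V^1 D_x = -r2_x D_z and D_t + V^2 D_x = -r1_x D_y, the factor e^((r1 - r2)/2)
    absorbs the diagonal undifferentiated terms. Families 2 and 3 both have this shape. *)
Lemma reduced_cosymmetry_two p a b : jet_regular p -> smooth p a -> smooth p b ->
  (\forall j \near p, Dz a j = - b j) -> (\forall j \near p, Dy b j = - a j) ->
  reduced_cosymmetry p (triple (fun j => half_gap j * a j) (fun j => half_gap j * b j) (fun=> 0)).
Proof.
move=> np sa sb ab ba; apply/reduced_cosymmetryP; split.
  by case=> [[|[|[|//]]] ?]; rewrite /triple (tnth_nth (cst 0)) /=; smooth.
near=> j; have nj : jet_regular j by near: j; exact: near_jet_regular.
have sja : smooth j a by near: j; exact: near_smooth.
have sjb : smooth j b by near: j; exact: near_smooth.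
have [u0 v0] := nj; have abj : Dz a j = - b j by near: j.
have baj : Dy b j = - a j by near: j.
have advz : vf (Xadv i1) a j = j (Jr i2 1) * b j.
  rewrite -vf_Xadv // -[b j]opprK -abj /Dz /r; move: (Dt a j) (V i1 j * Dx a j) => x y.
  by field; exact: v0.
have advy : vf (Xadv i2) b j = j (Jr i1 1) * a j.
  rewrite -vf_Xadv // -[a j]opprK -baj /Dy /r; move: (Dt b j) (V i2 j * Dx b j) => x y.
  by field; exact: u0.
split; rewrite /triple !(tnth_nth (cst 0)) /=.
- rewrite (vfM _ (smooth_half_gap j) sja) vf_Xadv_half_gap advz V1V2 /r mulr0 addr0.
  move: (V i2 j) (j (Jr i1 1)) (j (Jr i2 1)) (half_gap j) (a j) (b j) => *; by field.
- rewrite (vfM _ (smooth_half_gap j) sjb) vf_Xadv_half_gap advy V1V2 /r mulr0 addr0.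
  move: (V i2 j) (j (Jr i1 1)) (j (Jr i2 1)) (half_gap j) (a j) (b j) => *; by field.
- by rewrite vf_cst mulr0 addr0.
Unshelve. all: by end_near. Qed.

End Families.

(** * Members of families 1 and 3 are cosymmetries *)

Section FamiliesAreCosymmetries.
Context {R : realType}.
Local Notation jet := {ptws jetvar -> R}.
Implicit Types (j p : jet) (f g : jet -> R) (lam mu : 'I_3 -> jet -> R).

Lemma regular_jet p : regular p -> jet_regular p.
Proof. by case. Qed.

Lemma omega1E j : omega 1 j = expR (r i2 0 j - r i1 0 j) * r i3 1 j.
Proof. by rewrite /omega /= Dx_vf ?vf_coord //; exact: smooth_coord. Qed.

Definition shift_field (k : nat) : {ptws nat -> R} -> R := fun w => w k.+1.

Lemma AopE Om : Aop Om = vf shift_field Om.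
Proof. by []. Qed.

Lemma Dx_comp_omegas Om j : smooth (omegas j) Om ->
  Dx (Om \o omegas) j = expR (r i1 0 j - r i2 0 j) * Aop Om (omegas j).
Proof.
move=> sOm; have sG k : smooth j (fun j => omegas j k) by exact: smooth_omega.
have sf : smooth j (Om \o omegas) by exact: smooth_comp.
pose B v (j : jet) : R := cst 0 j * Xt v j + expR (r i2 0 j - r i1 0 j) * Xx v j.
have BE g : smooth j g -> vf B g j = expR (r i2 0 j - r i1 0 j) * vf Xx g j.
  by move=> sg; rewrite (vf_linear _ _ _ _ sg) mul0r add0r.
have /eqP : vf B (Om \o omegas) j = Aop Om (omegas j).
  rewrite AopE; apply: vf_comp => // k; rewrite BE; last exact: sG.
  rewrite -Dx_vf; last exact: sG.
  by rewrite Dx_omega mulrA -expRD -opprB addNr expR0 mul1r.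
rewrite BE // -Dx_vf // => /eqP <-.
by rewrite mulrA -expRD -opprB addNr expR0 mul1r.
Qed.

Lemma D3_comp_omegas Om j : smooth (omegas j) Om -> D3 (Om \o omegas) j = 0.
Proof.
move=> sOm; have sG k : smooth j (fun j => omegas j k) by exact: smooth_omega.
rewrite vf_D3; last exact: smooth_comp.
rewrite (vf_comp (Y := fun _ => cst 0) sG sOm).
  by rewrite vf_zero.
by move=> k; rewrite -vf_D3; [exact: D3_omega|exact: sG].
Qed.

Definition gap j : R := expR (r i1 0 j - r i2 0 j).

Lemma smooth_gap j : smooth j gap.
Proof. by cbv beta delta [gap r]; smooth. Qed.

Lemma vf_Xadv_gap i j : vf (Xadv i) gap j = gap j *
  (V i2 j * j (Jr i2 1) - V i1 j * j (Jr i1 1) + V i j * (j (Jr i1 1) - j (Jr i2 1))).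
Proof.
cbv beta delta [gap r]; vf_expand; rewrite /Xadv /= /cst /r; ring.
Qed.

(** On functions of the omega^k one has D_t = -V^3 D_x, so only the difference of the velocities
    remains. *)
Lemma vf_Xadv_comp_omegas Om i j : smooth (omegas j) Om ->
  vf (Xadv i) (Om \o omegas) j = (V i j - V i3 j) * (gap j * Aop Om (omegas j)).
Proof.
move=> sOm; have sG k : smooth j (fun j => omegas j k) by exact: smooth_omega.
rewrite -vf_Xadv; last exact: smooth_comp.
have /eqP := D3_comp_omegas sOm; rewrite /D3 addr_eq0 => /eqP ->.
by rewrite Dx_comp_omegas // mulrBl addrC.
Qed.

Lemma cosymmetry_family1 Om j : omega 1 j != 0 -> smooth (omegas j) Om ->
  cosymmetry_at (triple (fun j => gap j * Om (omegas j)) (fun j => gap j * - Om (omegas j))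
    (fun j => gap j * (Aop Om (omegas j) / omega 1 j))) j.
Proof.
move=> w0 sOm; have sG k : smooth j (fun j => omegas j k) by exact: smooth_omega.
have sA : smooth (omegas j) (Aop Om) by rewrite AopE; apply: smooth_vf => // k; exact: smooth_coord.
have sf := smooth_comp sG sOm; have sg := smooth_comp sG sA.
have sw := smooth_omega 1 j; have swV := smoothV w0 sw.
have g0 : gap j != 0 by rewrite gt_eqF ?expR_gt0.
have wE : omega 1 j = (gap j)^-1 * r i3 1 j by rewrite omega1E -expRN opprB.
have r30 : r i3 1 j != 0 by apply: contraNneq w0 => r0; rewrite wE r0 mulr0.
have fE i := vf_Xadv_comp_omegas i sOm.
have adv_w : vf (Xadv i3) (omega 1) j = 0 by rewrite -vf_Xadv //; exact: D3_omega.
have adv_g : vf (Xadv i3) (Aop Om \o omegas) j = 0.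
  by rewrite -vf_Xadv //; exact: D3_comp_omegas.
move: (omega 1) w0 sw swV wE adv_w => o w0 sw swV wE adv_w.
split; rewrite /triple !(tnth_nth (cst 0)) /=.
- rewrite (vfM _ (smooth_gap j) sf) vf_Xadv_gap fE /= wE V1E V2E V3E.
  move: (gap j) g0 (Om _) (Aop _ _) (r i3 1 j) r30 => x x0 y z u u0.
  rewrite /r; move: (j _) (j _) (j _) (j _) => a b c d; field.
  by rewrite x0 u0.
- rewrite (vfM _ (smooth_gap j) (smoothN sf)) (vfN _ sf) vf_Xadv_gap fE /= wE V1E V2E V3E.
  move: (gap j) g0 (Om _) (Aop _ _) (r i3 1 j) r30 => x x0 y z u u0.
  rewrite /r; move: (j _) (j _) (j _) (j _) => a b c d; field.
  by rewrite x0 u0.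
- rewrite (vfM _ (smooth_gap j) (smoothM sg swV)) (vfM _ sg swV) (vfV _ w0 sw).
  rewrite adv_w adv_g vf_Xadv_gap V1E V2E V3E /r /=.
  move: (gap j) (Aop _ _) (omega 1 j) w0 => x y z z0.
  move: (j _) (j _) (j _) (j _) => a b c d; field.
  exact: z0.
Qed.

Lemma continuous_omegas p : {for p, continuous (@omegas R)}.
Proof. by apply: smooth_continuous => k; exact: smooth_omega. Qed.

Lemma family1_reduced p lam : regular p -> family1 p lam -> reduced_cosymmetry p lam.
Proof.
move=> hp [Om [/(@Smooth R _ _ _) sOm ->]].
have sG k j : smooth j (fun j => omegas j k) by exact: smooth_omega.
have w0 : omega 1 p != 0 by case: hp.
apply/reduced_cosymmetryP; split.
  have sA : smooth (omegas p) (Aop Om) by rewrite AopE; apply: smooth_vf => // k; exact: smooth_coord.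
  have sf := smooth_comp (sG^~ p) sOm; have sg := smooth_comp (sG^~ p) sA.
  have sg0 := smooth_gap p; have swV := smoothV w0 (smooth_omega 1 p).
  case=> [[|[|[|//]]] ?]; rewrite /triple (tnth_nth (cst 0)) /=.
  - exact: (smoothM sg0 sf).
  - exact: (smoothM sg0 (smoothN sf)).
  - exact: (smoothM sg0 (smoothM sg swV)).
have nOm : \forall j \near p, smooth (omegas j) Om.
  have cp := @continuous_omegas p; exact: (cp _ (near_smooth sOm)).
apply: (@filterS2 _ (nbhs p) _ _ _ _ _ (near_neq0 (smooth_omega 1 p) w0) nOm) => j.
exact: cosymmetry_family1.
Qed.

(** On regular jets [Jop] is the boost J transported by [Phi]. The induction carries equality on all
    regular jets, since D_y and D_z depend on germs and not on values at one jet. *)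
Lemma iter_Jop_boost k m (f : jet -> R) : (forall j, jet_regular j -> f j = qk m j) ->
  forall j, jet_regular j -> iter k Jop f j = boost k m (Phi j).
Proof.
move=> fE; elim: k => [|k IHk] j nj; first exact: fE.
have sb := smooth_boost k m (Phi j).
have sbP : smooth j (boost k m \o Phi) by apply: smooth_comp => // v; exact: smooth_Phi.
have nE : \forall w \near j, (boost k m \o Phi) w = iter k Jop f w.
  by apply: filterS (near_jet_regular nj) => w nw; rewrite IHk.
rewrite /boost !iterS -/(boost k m) /Jop -(Dy_eq sbP nE) -(Dz_eq sbP nE).
by rewrite Dy_comp_Phi // Dz_comp_Phi // /hJ /= /r mulNr mulNr opprK.
Qed.

Lemma Qop_boost (Q : (jet -> R) -> jet -> R) : Qop Q -> exists k m,
  forall j, jet_regular j -> Q qt j = boost k m (Phi j).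
Proof.
case=> [k|k l _|k l l0].
- by exists k, 0; apply: iter_Jop_boost.
- by exists k, l%:Z; apply: iter_Jop_boost.
(* [Negz l.-1] is the integer -l. *)
- by exists k, (Negz l.-1); apply: iter_Jop_boost => j nj; rewrite /qk prednK.
Qed.

Lemma boost_Qop k m : exists Q : (jet -> R) -> jet -> R, Qop Q /\
  forall j, jet_regular j -> Q qt j = boost k m (Phi j).
Proof.
case: m => [[|m]|m].
- by exists (iter k Jop); split; [exact: Qop_J|exact: iter_Jop_boost].
- exists (fun f => iter k Jop (iter m.+1 Dy f)).
  by split; [exact: Qop_Jy|exact: iter_Jop_boost].
- exists (fun f => iter k Jop (iter m.+1 Dz f)).
  by split; [exact: Qop_Jz|exact: iter_Jop_boost].
Qed.

(** J^k q_m is a fixed point of D_z D_y, so with b = J^k q_m and a = -D_y b both equations of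
    [reduced_cosymmetry_two] hold. *)
Lemma family3_reduced p lam : regular p -> family3 lam -> reduced_cosymmetry p lam.
Proof.
move=> /regular_jet np [Q [/Qop_boost[k [m QE]] ->]].
have sQ j : jet_regular j -> smooth j (Q qt).
  move=> nj; apply: (@smooth_eq _ _ _ (boost k m \o Phi)).
    by apply: filterS (near_jet_regular nj) => w nw; rewrite QE.
  by apply: smooth_comp => [v|]; [exact: smooth_Phi|exact: smooth_boost].
apply: (@reduced_cosymmetry_two _ p (fun j => - Dy (Q qt) j) (Q qt)) => //.
- by apply: smoothN; apply: smooth_Dy => //; exact: sQ.
- exact: sQ.
- apply: filterS (near_jet_regular np) => j nj.
  have sDy : smooth j (Dy (Q qt)) by apply: smooth_Dy => //; exact: sQ.
  rewrite Dz_vf ?vfN //; last exact: smoothN.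
  congr (- _); rewrite -Dz_vf //.
  have sb := smooth_boost k m.
  have nE : \forall w \near j, Dy (Q qt) w = (vf (@Yy R) (boost k m) \o Phi) w.
    apply: filterS (near_jet_regular nj) => w nw /=; rewrite -Dy_comp_Phi //.
    apply: Dy_eq; first exact: sQ.
    by apply: filterS (near_jet_regular nw) => w' nw' /=; exact: QE.
  rewrite (Dz_eq sDy nE) Dz_comp_Phi //; last first.
    by apply: smooth_vf => // v; exact: smooth_Yy.
  by rewrite hDzhDy_boost QE.
- by near=> j; rewrite opprK.
Unshelve. all: by end_near. Qed.

End FamiliesAreCosymmetries.

Lemma vf_scaled_pd (R : realType) (I : choiceType) x i (f : {ptws I -> R} -> R) z : smooth z f ->
  vf (fun k => cst (x * (k == i)%:R)) f z = x * pd i f z.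
Proof.
move=> sf; rewrite (pd_vf i sf) -[RHS]addr0 -[X in _ + X](mul0r (vf (fun _ => cst 0) f z)).
rewrite -(vf_linear _ _ (cst x) (cst 0) sf); apply: vf_ext => k.
by rewrite /cst mul0r addr0.
Qed.

(** * Functions of r1 and r2: the second family *)

Section KleinGordonFamily.
Context {R : realType}.
Local Notation jet := {ptws jetvar -> R}.
Local Notation kg := {ptws kgvar -> R}.
Local Notation plane := {ptws 'I_2 -> R}.
Implicit Types (j p : jet) (lam mu : 'I_3 -> jet -> R) (v : plane).

Lemma smooth_r12 i j : smooth j (fun j => r12 j i).
Proof.
case: i => [[|[|//]] ?]; rewrite /r12; first exact: (smooth_coord j (Jr i1 0)).
exact: (smooth_coord j (Jr i2 0)).
Qed.

Lemma ord2P (i : 'I_2) : i = ord0 \/ i = ord_max.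
Proof. by case: i => [[|[|//]] ?]; [left|right]; apply/val_inj. Qed.

Lemma Dy_r (i : 'I_3) j : jet_regular j -> i = i1 \/ i = i2 ->
  Dy (fun j => j (Jr i 0)) j = 2 * (i == i1)%:R.
Proof.
move=> nj ii; have [u0 v0] := nj; rewrite DyE //; last exact: smooth_coord.
rewrite !vf_coord /= /r; by case: ii => -> /=; rewrite ?V1V2; field; rewrite ?u0 ?v0.
Qed.

Lemma Dz_r (i : 'I_3) j : jet_regular j -> i = i1 \/ i = i2 ->
  Dz (fun j => j (Jr i 0)) j = -2 * (i == i2)%:R.
Proof.
move=> nj ii; have [u0 v0] := nj; rewrite DzE //; last exact: smooth_coord.
rewrite !vf_coord /= /r; by case: ii => -> /=; rewrite ?V1V2; field; rewrite ?u0 ?v0.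
Qed.

Lemma Dy_comp_r12 f j : jet_regular j -> smooth (r12 j) f ->
  Dy (f \o r12) j = 2 * pd ord0 f (r12 j).
Proof.
move=> nj sf; have sr i := smooth_r12 i j.
rewrite Dy_vf; last exact: smooth_comp.
rewrite -vf_scaled_pd //; apply: vf_comp => // i; rewrite -Dy_vf //.
case: (ord2P i) => ->; first by rewrite (Dy_r nj (or_introl erefl)).
by rewrite (Dy_r nj (or_intror erefl)).
Qed.

Lemma Dz_comp_r12 f j : jet_regular j -> smooth (r12 j) f ->
  Dz (f \o r12) j = -2 * pd ord_max f (r12 j).
Proof.
move=> nj sf; have sr i := smooth_r12 i j.
rewrite Dz_vf; last exact: smooth_comp.
rewrite -vf_scaled_pd //; apply: vf_comp => // i; rewrite -Dz_vf //.
case: (ord2P i) => ->; first by rewrite (Dz_r nj (or_introl erefl)).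
by rewrite (Dz_r nj (or_intror erefl)).
Qed.

(** On functions of r1 and r2 the operators D_y and D_z act as 2 d/dr1 and -2 d/dr2, which turns D_z
    D_y b = b into the Klein-Gordon equation with the factor -1/4. *)
Lemma family2_reduced p lam : regular p -> family2 p lam -> reduced_cosymmetry p lam.
Proof.
move=> /regular_jet np [Ph [/(@Smooth R _ _ _) sPh kgPh ->]].
have cr : r12 @ p --> r12 p by apply: smooth_continuous => k; exact: smooth_r12.
have nsPh : \forall j \near p, smooth (r12 j) Ph by exact: (cr _ (near_smooth sPh)).
have nkg := cr _ kgPh.
have sPhr : smooth p (Ph \o r12) by apply: smooth_comp => // i; exact: smooth_r12.
have sdPhr : smooth p (pd ord0 Ph \o r12).
  by apply: smooth_comp => [i|]; [exact: smooth_r12|exact: smooth_pd].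
apply: (@reduced_cosymmetry_two _ p (fun j => - 2 * pd ord0 Ph (r12 j)) (Ph \o r12)) => //.
- exact: (smoothM (smooth_cst p _) sdPhr).
- near=> j; have nj : jet_regular j by near: j; exact: near_jet_regular.
  have sj : smooth (r12 j) Ph by near: j.
  have sdj : smooth j (pd ord0 Ph \o r12).
    by apply: smooth_comp => [i|]; [exact: smooth_r12|exact: smooth_pd].
  have kgj : pd ord_max (pd ord0 Ph) (r12 j) = - Ph (r12 j) / 4 by near: j.
  rewrite Dz_vf; last exact: (smoothM (smooth_cst j _) sdj).
  rewrite (vfZ _ _ sdj) -Dz_vf // Dz_comp_r12 //; last exact: smooth_pd.
  by rewrite kgj /=; field.
- near=> j; have nj : jet_regular j by near: j; exact: near_jet_regular.
  have sj : smooth (r12 j) Ph by near: j.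
  by rewrite Dy_comp_r12 // mulNr opprK.
Unshelve. all: by end_near. Qed.

(** Completes a point of the plane by the values of [c], so that a function depending on y and z
    alone can be read as a function of r1 and r2. *)
Definition of_plane (c : kg) v : kg := fun i =>
  match i with Ny => 2^-1 * v ord0 | Nz => - 2^-1 * v ord_max | _ => c i end.

Lemma smooth_of_plane c i v : smooth v (fun v => of_plane c v i).
Proof.
case: i => [||k|k] /=; [|exact: (smoothM (smooth_cst v _) (smooth_coord v _))..|exact: smooth_cst|exact: smooth_cst].
exact: (smoothM (smooth_cst v _) (smooth_coord v _)).
Qed.

Lemma pd_of_plane c (f : kg -> R) v : smooth (of_plane c v) f ->
  pd ord0 (f \o of_plane c) v = 2^-1 * pd Ny f (of_plane c v) /\
  pd ord_max (f \o of_plane c) v = - 2^-1 * pd Nz f (of_plane c v).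
Proof.
move=> sf; have sc i := smooth_of_plane c i v.
have s1 : smooth v (f \o of_plane c) by exact: smooth_comp.
rewrite -!vf_scaled_pd // !(pd_vf _ s1).
have vz x (k : 'I_2) i :
    vf (fun k : 'I_2 => cst (k == i)%:R) (fun v => x * v k) v = x * (k == i)%:R.
  by rewrite (vfZ _ _ (smooth_coord v k)) vf_coord.
split; apply: (vf_comp _ sf) => // -[||k|k] /=;
  by rewrite ?vz ?vf_cst /cst /= ?kgE ?mulr0 ?mulr1.
Qed.

End KleinGordonFamily.

(** * The classification in Klein-Gordon coordinates *)

Section KleinGordonClassification.
Context {R : realType}.
Local Notation kg := {ptws kgvar -> R}.
Local Notation hDy := (vf (@Yy R)).
Local Notation hDz := (vf (@Yz R)).
Local Notation hA := (vf (@Ya R)).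
Implicit Types (w : kg) (f g h : kg -> R).
Context (c : kg) (s : seq kgvar) (e : R) (e0 : 0 < e).
Local Notation B := (box c s e).
Local Notation reg := (reg c s e).
Local Notation wonly := (wonly c s e).
Local Notation yzonly := (yzonly c s e).
Hypothesis Breg : forall w, B w -> kg_regular w.

Lemma wonly_first_omegaM h : reg h -> wonly h -> wonly (fun w => w (Nw 1) * h w).
Proof.
move=> rh wh; apply: wonlyP => i iw w Bw.
rewrite (@pdM _ _ w (fun w => w (Nw 1)) h); [|exact: C1_coord|exact: smooth_C1 (reg_smooth rh Bw)].
rewrite (wonly0 wh iw Bw) mulr0 addr0 pd_coord.
by case: eqP => [iE|_]; [case: (iw 1%N)|rewrite mul0r].
Qed.

(** Let a' and b' be a and b without their parts E F and -E F. Once x = 0, the second equation reads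
    a' = -D_y b' and the first becomes D_z D_y b' = b', so that only b' has to be decomposed. *)
Lemma kg_classification a b h : reg a -> reg b -> reg h ->
  (forall w, B w -> [/\ hDz a w + b w = Ek w * Tk w * (w (Nw 1) * h w),
     hDy b w + a w = Ek w * Sk w * (w (Nw 1) * h w) &
     Sk w * hDz h w + Tk w * hDy h w = 0]) ->
  exists F f (L : seq (R * (nat * int))), [/\ reg F, wonly F, reg f, yzonly f &
    forall w, B w -> [/\ w (Nw 1) * h w = hA F w, hDz (hDy f) w = f w,
      b w = - (Ek w * F w) + (\sum_(t <- L) t.1 * boost t.2.1 t.2.2 w + f w) &
      a w = Ek w * F w - (\sum_(t <- L) t.1 * hDy (boost t.2.1 t.2.2) w + hDy f w)]].
Proof.
move=> ra rb rh eqs.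
have [wh1 wh2 wh3] : wonly h.
  by apply: (transport_kernel e0 Breg rh) => w /eqs[].
have rg : reg (fun w => w (Nw 1) * h w) by apply: regM => //; exact: reg_coord.
have wg := wonly_first_omegaM rh (And3 wh1 wh2 wh3).
have [] := omega_elimination e0 Breg ra rb rg wg.
- by move=> w /eqs[].
- by move=> w /eqs[].
set F := fun w => a (frz c w) / Ek c => rF wF wa wb [x xE].
pose a' w := a w - Ek w * F w; pose b' w := b w + Ek w * F w.
have rEF : reg (fun w => Ek w * F w) by apply: regM => //; exact: reg_Ek.
have ra' : reg a' by apply: regD => //; exact: regN.
have rb' : reg b' by exact: regD.
have eqz w : B w -> hDz a' w + b' w = x * (Ek w * Tk w) by move=> /xE[].
have eqy w : B w -> hDy b' w + a' w = x * (Ek w * Sk w) by move=> /xE[].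
have x0 := inhomogeneity_eq0 e0 ra' rb' wa wb eqz eqy.
have yb := affine_coefficients e0 ra' rb' wa wb eqz eqy.
have a'E w : B w -> - hDy b' w = a' w.
  by move=> /eqy; rewrite x0 mul0r => /eqP; rewrite addrC addr_eq0 => /eqP.
have sb' : solution c s e b'.
  split=> [//|//|k|w Bw]; first by have [] := yb k.
  have := eqz w Bw; rewrite -(box_vf_eq _ a'E Bw) vfN; last first.
    exact: reg_smooth (reg_hDy rb') Bw.
  by rewrite x0 mul0r => /eqP; rewrite addrC subr_eq0 => /eqP.
have [n [bn _]] := reg_bound rb'.
(* The indices occurring in b' lie strictly between -n and n, inside the window of length n + n that
   starts at -n. *)
have [|L [f [rf yf fE]]] := @solution_reduction R c s e e0 (n + n) (- n%:Z) b' sb'.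
  by move=> k kn w Bw; apply: bn => //; lia.
have sL t w : smooth w (boost t.2.1 t.2.2 : kg -> R) := @smooth_boost R (t : R * (nat * int)).2.1 t.2.2 w.
have hDyb w : B w -> hDy b' w = \sum_(t <- L) t.1 * hDy (boost t.2.1 t.2.2) w + hDy f w.
  move=> Bw; rewrite (box_vf_eq _ fE Bw) vfD; last exact: reg_smooth rf Bw.
    rewrite vf_sum => [|t]; last exact: (smoothM (smooth_cst w t.1) (sL t w)).
    by congr (_ + _); apply: eq_bigr => t _; exact: (vfZ _ _ (sL t w)).
  by apply: smooth_sum => t; exact: (smoothM (smooth_cst w t.1) (sL t w)).
exists F, f, L; split=> // w Bw; split.
- by have [-> _ _] := xE w Bw; rewrite x0 addr0.
- have : solution c s e f.
    have sS : solution c s e (fun w => \sum_(t <- L) t.1 * boost t.2.1 t.2.2 w).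
      apply: solution_sum => t.
      by apply: (solution_comb (x := t.1) (y := 0) (solution_boost c s e0 t.2.1 t.2.2) (solution0 c s e)) => w' _;
        rewrite /cst mulr0 addr0.
    apply: (solution_comb (x := 1) (y := -1) sb' sS) => w' Bw'.
    by rewrite fE // mul1r mulN1r addrC addKr.
  by case=> _ _ _; apply.
- by rewrite -fE // /b' addrC addrK.
- by rewrite -hDyb // a'E // /a' addrC subrK.
Qed.

End KleinGordonClassification.

(** * The cosymmetry system in Klein-Gordon coordinates *)

Section CosymmetriesInKleinGordonCoordinates.
Context {R : realType}.
Local Notation jet := {ptws jetvar -> R}.
Local Notation kg := {ptws kgvar -> R}.
Local Notation hDy := (vf (@Yy R)).
Local Notation hDz := (vf (@Yz R)).
Local Notation hA := (vf (@Ya R)).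
Implicit Types (j p : jet) (w : kg) (f g : kg -> R) (lam mu : 'I_3 -> jet -> R).

Lemma Psi_r i w : kg_regular w -> [/\ r i1 1 (Psi w) = hr1x w, r i2 1 (Psi w) = hr2x w &
  r i3 1 (Psi w) = Ek w ^+ 2 * w (Nw 1)] /\ V i (Psi w) = hV w + tnth [tuple 1; -1; 0] i.
Proof.
move=> nw; have [S0 T0] := nw; have E0 := Ek_neq0 w; split; last exact: V_Psi.
rewrite /r /= !hDxE; [|exact: smooth_hr0..].
rewrite /hr0 !(tnth_nth (cst 0)) /=; split; vf_expand; rewrite /= /cst; [by field|by field|].
by rewrite /hr1x /hr2x; field; rewrite S0 T0.
Qed.

Lemma vf_Xadv_Psi i (f : jet -> R) w : kg_regular w -> smooth (Psi w) f ->
  vf (Xadv i) f (Psi w) = ((tnth [tuple 1; -1; 0] i - 1) * hr1x w / 2) * hDy (fun w => f (Psi w)) w -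
    ((tnth [tuple 1; -1; 0] i + 1) * hr2x w / 2) * hDz (fun w => f (Psi w)) w.
Proof.
move=> nw sf; have sP v := smooth_Psi v nw; have sfP := smooth_comp sP sf.
rewrite -vf_Xadv // Dt_vf // Dx_vf // -(vf_comp sP sf (fun v => Psi_Xt v nw)).
rewrite -(vf_comp sP sf (fun v => Psi_Xx v nw)) hDtE // hDxE // V_Psi.
move: (tnth _ _) => k; by field.
Qed.

(** Along the first characteristic only D_z occurs and along the second only D_y, so the first two
    equations are solved for one derivative each and the third for D_z of the third component.
    Substitution together with the weights in a, b, h gives the symmetric form. *)
Lemma cosymmetry_kg lam w : kg_regular w -> (forall i, smooth (Psi w) (lam i)) ->
  cosymmetry_at lam (Psi w) ->
  let a w := (Ek w)^-1 * lam i1 (Psi w) in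
  let b w := (Ek w)^-1 * lam i2 (Psi w) in
  let h w := (Ek w)^-1 * ((Ek w)^-1 * lam i3 (Psi w)) in
  [/\ hDz a w + b w = Ek w * Tk w * (w (Nw 1) * h w),
     hDy b w + a w = Ek w * Sk w * (w (Nw 1) * h w) &
     Sk w * hDz h w + Tk w * hDy h w = 0].
Proof.
move=> nw sl [eq1 eq2 eq3] a b h; have [S0 T0] := nw; have E0 := Ek_neq0 w.
have sE := smooth_Ek w; have sEV := smoothV E0 sE.
have slP i : smooth w (fun w => lam i (Psi w)).
  by apply: (@smooth_comp _ _ _ (@Psi R) w) => // v; exact: smooth_Psi.
have sl3 : smooth w (fun w => (Ek w)^-1 * lam i3 (Psi w)) by exact: smoothM.
have vV X : vf X Ek w = Ek w -> vf X (fun w => (Ek w)^-1) w = - (Ek w)^-1.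
  by move=> XE; rewrite vfV // XE; field; exact: E0.
have vE X f : vf X Ek w = Ek w -> smooth w f ->
    vf X (fun w => (Ek w)^-1 * f w) w = (Ek w)^-1 * (vf X f w - f w).
  by move=> /vV XE sf; rewrite (vfM _ sEV sf) XE; ring.
have [vy vz] := (vf_Yy_Ek w, vf_Yz_Ek w).
move: eq1 eq2 eq3; rewrite !vf_Xadv_Psi //.
have [[-> -> ->] _] := Psi_r i1 nw.
rewrite !(tnth_nth 0) /= /a /b /h (vE _ _ vz (slP i1)) (vE _ _ vy (slP i2)).
rewrite (vE _ _ vz sl3) (vE _ _ vy sl3) (vE _ _ vz (slP i3)) (vE _ _ vy (slP i3)).
have u0 := hr1x_neq0 nw; have v0 := hr2x_neq0 nw.
have SE : Sk w = - (Ek w ^+ 2 / hr1x w) by rewrite /hr1x; field; rewrite S0 E0.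
have TE : Tk w = - (Ek w ^+ 2 / hr2x w) by rewrite /hr2x; field; rewrite T0 E0.
rewrite {}SE {}TE.
move: (hDz (fun w => lam i1 (Psi w)) w) (hDy (fun w => lam i2 (Psi w)) w).
move: (hDz (fun w => lam i3 (Psi w)) w) (hDy (fun w => lam i3 (Psi w)) w).
move: (hDy (fun w => lam i1 (Psi w)) w) (hDz (fun w => lam i2 (Psi w)) w).
move: (lam i1 _) (lam i2 _) (lam i3 _) (hr1x w) (hr2x w) u0 v0 (Ek w) E0 => l1 l2 l3 u v u0 v0 E E0.
move=> y1 z2 z3 y3 z1 y2 q1 q2 q3.
have {q1}-> : z1 = l1 - l2 - E ^+ 2 * w (Nw 1) * l3 / v.
  apply: (mulfI v0); rewrite (_ : v * z1 = - ((1 - 1) * u / 2 * y1 - (1 + 1) * v / 2 * z1)).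
    by rewrite q1; field.
  by field.
have {q2}-> : y2 = l2 - l1 - E ^+ 2 * w (Nw 1) * l3 / u.
  apply: (mulfI u0); rewrite (_ : u * y2 = - ((-1 - 1) * u / 2 * y2 - (-1 + 1) * v / 2 * z2)).
    by rewrite q2; field.
  by field.
have {q3}-> : z3 = - (y3 * u / v) + 2 * (u + v) * l3 / v.
  apply: (mulfI v0); rewrite (_ : v * z3 = 2 * (u + v) * l3 - y3 * u -
    2 * ((0 - 1) * u / 2 * y3 - (0 + 1) * v / 2 * z3 + (u + v) * l3)).
    by rewrite q3; field.
  by field.
by split; field; rewrite ?u0 ?v0 ?E0.
Qed.

End CosymmetriesInKleinGordonCoordinates.

(** * Linear spans of germs *)

Section Span.
Context {R : realType}.
Local Notation jet := {ptws jetvar -> R}.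
Implicit Types (j p : jet) (lam mu : 'I_3 -> jet -> R) (F : ('I_3 -> jet -> R) -> Prop).

Lemma span_near0 p F : span_near p F (fun _ => cst 0).
Proof.
exists 0%N, (fun=> 0), (fun=> (fun _ => cst 0)); split; first by case.
by near=> j => i; rewrite big_ord0.
Unshelve. all: by end_near. Qed.

(** The families are given by equalities of total functions, while constructions fix their members
    only near [p]. Here [mu] is an actual member and [mu'] a convenient expression with the same
    germ. *)
Lemma span_near_cons p F x mu mu' lam : F mu -> (\forall j \near p, forall i, mu i j = mu' i j) ->
  span_near p F lam -> span_near p F (fun i j => x * mu' i j + lam i j).
Proof.
move=> Fmu muE [n [a [nu [Fnu lamE]]]].
exists n.+1, (fun l => oapp a x (unlift ord0 l)), (fun l => oapp nu mu (unlift ord0 l)).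
split; first by move=> l; case: (unlift ord0 l) => [l'|] /=.
apply: (@filterS2 _ (nbhs p) _ _ _ _ _ muE lamE) => j mj lj i.
rewrite big_ord_recl unlift_none /= mj lj; congr (_ + _).
by apply: eq_bigr => l _; rewrite liftK.
Qed.

Lemma span_near_eq p F lam mu : (\forall j \near p, forall i, mu i j = lam i j) ->
  span_near p F lam -> span_near p F mu.
Proof.
move=> ml [n [a [nu [Fnu lamE]]]]; exists n, a, nu; split=> //.
by apply: (@filterS2 _ (nbhs p) _ _ _ _ _ ml lamE) => j mj lj i; rewrite mj lj.
Qed.

Lemma span_near_reduced p F lam : (forall mu, F mu -> reduced_cosymmetry p mu) ->
  span_near p F lam -> reduced_cosymmetry p lam.
Proof.
move=> Fred [n [a [nu [Fnu lamE]]]].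
by apply: (reduced_cosymmetry_eq lamE); apply: reduced_cosymmetry_sum => l; exact: Fred.
Qed.

End Span.

Lemma smooth_near_reg (R : realType) (I : choiceType) (c : {ptws I -> R}) f : smooth c f ->
  exists U, nbhs c U /\ forall s e, box c s e `<=` U -> reg c s e f.
Proof.
move=> sf; have [U [l [oU Uc _ fl _]]] := (smoothP c f).1 sf.
exists (U `&` [set w | smooth w f]); split.
  by apply: filterI; [exact: open_nbhs_nbhs (conj oU Uc)|exact: near_smooth].
move=> s e BU; split; first by move=> w Bw; have [] := BU w Bw.
by exists l; apply: depends_on_sub fl => // w Bw; have [] := BU w Bw.
Qed.

(** * Return to jets and the decomposition of a cosymmetry *)

Section BackToJets.
Context {R : realType}.
Local Notation jet := {ptws jetvar -> R}.
Local Notation kg := {ptws kgvar -> R}.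
Local Notation plane := {ptws 'I_2 -> R}.
Local Notation hDy := (vf (@Yy R)).
Local Notation hDz := (vf (@Yz R)).
Local Notation hA := (vf (@Ya R)).
Implicit Types (j p : jet) (w c : kg) (f g : kg -> R) (lam mu : 'I_3 -> jet -> R).

Definition of_omegas c (u : {ptws nat -> R}) : kg := fun i => if i is Nw k then u k else c i.

Lemma of_omegasE c j : of_omegas c (omegas j) = frz c (Phi j).
Proof. by apply/funext => -[]. Qed.

Lemma smooth_of_omegas c i u : smooth u (fun u => of_omegas c u i).
Proof. by case: i => [||k|k] /=; [exact: smooth_cst..|exact: smooth_coord]. Qed.

Lemma Aop_comp_of_omegas c f u : smooth (of_omegas c u) f ->
  Aop (f \o of_omegas c) u = hA f (of_omegas c u).
Proof.
move=> sf; rewrite AopE; apply: vf_comp => // [i|]; first exact: smooth_of_omegas.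
by case=> [||k|k] /=; rewrite ?vf_cst ?vf_coord.
Qed.

Context (c : kg) (s : seq kgvar) (e : R) (e0 : 0 < e).
Local Notation B := (box c s e).
Local Notation reg := (reg c s e).

Lemma of_plane_r12 j : of_plane c (r12 j) Ny = Phi j Ny /\ of_plane c (r12 j) Nz = Phi j Nz.
Proof. by split; rewrite /= mulrC // mulrN mulNr. Qed.

Lemma box_of_plane_r12 j : B (Phi j) -> B (of_plane c (r12 j)).
Proof.
have [yE zE] := of_plane_r12 j.
by move=> Bj [||k|k] ks; [rewrite yE|rewrite zE|rewrite subrr normr0|rewrite subrr normr0]; try exact: e0; exact: Bj.
Qed.

Lemma yzonly_of_plane f j : reg f -> yzonly c s e f -> B (Phi j) ->
  f (of_plane c (r12 j)) = f (Phi j).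
Proof.
move=> rf yf Bj; have [yE zE] := of_plane_r12 j.
apply: (box_indep (P := fun i => (i == Ny) || (i == Nz)) rf).
- by move=> i; rewrite negb_or => /andP[/eqP iy /eqP iz] w Bw; exact: (yzonly0 yf iy iz Bw).
- exact: box_of_plane_r12.
- exact: Bj.
- by move=> i /orP[] /eqP ->.
Qed.

(** Freezing all coordinates but the omegas turns F into a function Omega of the sequence of the
    omega^k; as F and A F depend on the omegas only, freezing does not change their values at
    [Phi j]. *)
Lemma family1_of_kg F p : jet_regular p -> reg F -> wonly c s e F -> B (Phi p) ->
  exists mu, family1 p mu /\ \forall j \near p, forall i, mu i j =
    triple (fun j => gap j * F (Phi j)) (fun j => gap j * - F (Phi j))
           (fun j => gap j * (hA F (Phi j) / omega 1 j)) i j.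
Proof.
move=> np rF wF Bp; have Bf w : B w -> B (frz c w) := @frzB R c s e e0 w.
have sF w : B w -> smooth (frz c w) F by move=> /Bf; exact: reg_smooth.
pose Om := F \o of_omegas c.
exists (triple (fun j => gap j * Om (omegas j)) (fun j => gap j * - Om (omegas j))
  (fun j => gap j * (Aop Om (omegas j) / omega 1 j))); split.
  exists Om; split=> //.
  have [] : smooth (omegas p) Om; last by [].
  apply: smooth_comp; first by move=> i; exact: smooth_of_omegas.
  by rewrite of_omegasE; exact: sF.
have cP : Phi @ p --> Phi p by apply: smooth_continuous => v; exact: smooth_Phi.
have nB := cP _ (open_nbhs_nbhs (conj (@open_box _ _ c s e) Bp)).
have {}nB : \forall j \near p, B (Phi j) by exact: nB.
apply: (@filterS _ (nbhs p) _ _ _ _ nB) => j Bj.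
have OmE : Om (omegas j) = F (Phi j).
  by rewrite /Om /= of_omegasE (wonly_frzE e0 rF wF Bj).
have AE : Aop Om (omegas j) = hA F (Phi j).
  rewrite Aop_comp_of_omegas of_omegasE; last exact: sF.
  exact: (wonly_frzE e0 (reg_hA rF) (wonly_hA rF wF) Bj).
by case=> [[|[|[|//]]] ?]; rewrite /triple !(tnth_nth (cst 0)) /= ?OmE ?AE.
Qed.

(** With y = r1/2 and z = -r2/2 the mixed derivative in r1, r2 is -1/4 of the one in y, z, and for a
    function of y and z alone D_z D_y f = f says f_yz = f. *)
Lemma family2_of_kg f p : jet_regular p -> reg f -> yzonly c s e f -> B (Phi p) ->
  (forall w, B w -> hDz (hDy f) w = f w) ->
  exists mu, family2 p mu /\ \forall j \near p, forall i, mu i j =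
    triple (fun j => half_gap j * - hDy f (Phi j)) (fun j => half_gap j * f (Phi j)) (fun=> 0) i j.
Proof.
move=> np rf yf Bp fE.
pose Ph : plane -> R := f \o of_plane c.
have hDyE w : B w -> hDy f w = pd Ny f w.
  by move=> Bw; exact: (hDy_yz yf.1 yf.2 Bw (reg_smooth rf Bw)).
have ry : reg (pd Ny f) by exact: reg_pd.
have yy : yzonly c s e (pd Ny f) by exact: yzonly_pd.
have fE' w : B w -> pd Nz (pd Ny f) w = f w.
  move=> Bw; rewrite -[RHS]fE // (box_vf_eq _ hDyE Bw).
  by rewrite (hDz_yz yy.1 yy.2 Bw (reg_smooth ry Bw)).
have cP : Phi @ p --> Phi p by apply: smooth_continuous => v; exact: smooth_Phi.
have nB := cP _ (open_nbhs_nbhs (conj (@open_box _ _ c s e) Bp)).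
have Bv : B (of_plane c (r12 p)) by exact: box_of_plane_r12.
have cO (v : plane) : of_plane c @ v --> of_plane c v.
  by apply: smooth_continuous => i; exact: smooth_of_plane.
have nv v : B (of_plane c v) -> \forall v' \near v, B (of_plane c v').
  by move=> Bv'; exact: (cO v _ (open_nbhs_nbhs (conj (@open_box _ _ c s e) Bv'))).
have dPh v : B (of_plane c v) -> pd ord0 Ph v = 2^-1 * pd Ny f (of_plane c v).
  by move=> Bv'; have [] := pd_of_plane (reg_smooth rf Bv').
exists (triple (fun j => half_gap j * (- 2 * pd ord0 Ph (r12 j)))
  (fun j => half_gap j * Ph (r12 j)) (fun=> 0)); split.
  exists Ph; split=> //.
    have [] : smooth (r12 p) Ph; last by [].
    apply: smooth_comp; first by move=> i; exact: smooth_of_plane.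
    exact: reg_smooth rf Bv.
  apply: filterS (nv _ Bv) => v Bv'.
  have dE : \forall v' \near v, pd ord0 Ph v' = 2^-1 * (pd Ny f \o of_plane c) v'.
    by apply: filterS (nv v Bv') => v'; exact: dPh.
  have sy : smooth v (pd Ny f \o of_plane c).
    by apply: smooth_comp => [i|]; [exact: smooth_of_plane|exact: reg_smooth ry Bv'].
  rewrite (eq_pd _ dE) (pd_vf _ (smoothM (smooth_cst v (2^-1 : R)) sy)).
  rewrite (vfZ _ (2^-1 : R) sy) -(pd_vf _ sy).
  have [_ ->] := pd_of_plane (reg_smooth ry Bv').
  by rewrite fE' // -[Ph v]/(f (of_plane c v)); field.
have {}nB : \forall j \near p, B (Phi j) by exact: nB.
apply: (@filterS _ (nbhs p) _ _ _ _ nB) => j Bj.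
have PhE : Ph (r12 j) = f (Phi j) by exact: yzonly_of_plane.
have dE : - 2 * pd ord0 Ph (r12 j) = - hDy f (Phi j).
  rewrite dPh; last exact: box_of_plane_r12.
  by rewrite (yzonly_of_plane ry yy Bj) hDyE // mulrA mulNr divff ?pnatr_eq0 // mulN1r.
by case=> [[|[|[|//]]] ?]; rewrite /triple !(tnth_nth (cst 0)) /= ?PhE ?dE.
Qed.

End BackToJets.

Lemma family3_of_kg (R : realType) k m (p : {ptws jetvar -> R}) : jet_regular p ->
  exists mu, family3 mu /\ \forall j \near p, forall i, mu i j =
    triple (fun j => half_gap j * - vf (@Yy R) (boost k m) (Phi j))
           (fun j => half_gap j * boost k m (Phi j)) (fun=> 0) i j.
Proof.
move=> np; have [Q [QQ QE]] := @boost_Qop R k m.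
exists (triple (fun j => half_gap j * - Dy (Q qt) j) (fun j => half_gap j * Q qt j) (fun=> 0)).
split; first by exists Q.
apply: filterS (near_jet_regular np) => j nj.
have sb := smooth_boost k m (Phi j).
have dE : Dy (Q qt) j = vf (@Yy R) (boost k m) (Phi j).
  rewrite -(Dy_comp_Phi nj sb); apply/esym/Dy_eq.
    by apply: smooth_comp => // v; exact: smooth_Phi.
  by apply: filterS (near_jet_regular nj) => w nw; rewrite QE.
by case=> [[|[|[|//]]] ?]; rewrite /triple !(tnth_nth (cst 0)) /= ?QE ?dE.
Qed.

(** The cosymmetry is pulled back by [Psi] to a box around [Phi p], decomposed there and composed
    with [Phi]; [Psi (Phi j) = j] near [p] restores [lam]. *)
Lemma cosymmetry_spanned (R : realType) (p : {ptws jetvar -> R}) lam : regular p ->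
  reduced_cosymmetry p lam ->
  span_near p (fun mu => family1 p mu \/ family2 p mu \/ family3 mu) lam.
Proof.
move=> hp /reduced_cosymmetryP[sl eql]; have np := regular_jet hp.
have w0 : omega 1 p != 0 by case: hp.
set c := Phi p; have nc : kg_regular c by exact: Phi_regular.
have PE : Psi c = p by exact: PsiK.
pose a w := (Ek w)^-1 * lam i1 (Psi w).
pose b w := (Ek w)^-1 * lam i2 (Psi w).
pose h w := (Ek w)^-1 * ((Ek w)^-1 * lam i3 (Psi w)).
have slc i : smooth (Psi c) (lam i) by rewrite PE.
have sEV := smoothV (Ek_neq0 c) (smooth_Ek c).
have slP i : smooth c (lam i \o Psi).
  by apply: smooth_comp => // v; exact: smooth_Psi.
have sa : smooth c a by exact: (smoothM sEV (slP i1)).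
have sb : smooth c b by exact: (smoothM sEV (slP i2)).
have sh : smooth c h by exact: (smoothM sEV (smoothM sEV (slP i3))).
have cPsi : @Psi R @ c --> p.
  by rewrite -[X in _ --> X]PE; apply: smooth_continuous => v; exact: smooth_Psi.
have neq : \forall w \near c, (forall i, smooth (Psi w) (lam i)) /\ cosymmetry_at lam (Psi w).
  have nl : \forall j \near p, (forall i, smooth j (lam i)) /\ cosymmetry_at lam j.
    exact: (@filterS2 _ (nbhs p) _ _ _ _ (fun w a b => conj a b) (near_smooth_family sl) eql).
  exact: (cPsi _ nl).
have [U1 [cU1 rU1]] := smooth_near_reg sa.
have [U2 [cU2 rU2]] := smooth_near_reg sb.
have [U3 [cU3 rU3]] := smooth_near_reg sh.
(* One box on which the three functions are regular, S and T do not vanish and the pulled-back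
   system holds. *)
have [s [e e0 sub]] := nbhs_box (filterI (filterI cU1 cU2)
  (filterI cU3 (filterI (near_kg_regular nc) neq))).
have ra : reg c s e a by apply: rU1 => w /sub[[]].
have rb : reg c s e b by apply: rU2 => w /sub[[]].
have rh : reg c s e h by apply: rU3 => w /sub[_ []].
have Breg w : box c s e w -> kg_regular w by move=> /sub[_ [_ []]].
have [] := kg_classification e0 Breg ra rb rh.
  move=> w Bw; have [_ [_ [nw [slw eqw]]]] := sub w Bw.
  exact: (cosymmetry_kg nw slw eqw).
move=> F [f [L [rF wF rf yf E]]].
have Bc : box c s e c by exact: box_center.
have fE w : box c s e w -> vf (@Yz R) (vf (@Yy R) f) w = f w by move=> /E[].
have [mu1 [fam1 mu1E]] := family1_of_kg e0 np rF wF Bc.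
have [mu2 [fam2 mu2E]] := family2_of_kg e0 np rf yf Bc fE.
pose tri := (fun t : nat * int => triple
  (fun j : {ptws jetvar -> R} => half_gap j * - vf (@Yy R) (boost t.1 t.2) (Phi j))
  (fun j => half_gap j * boost t.1 t.2 (Phi j)) (fun=> 0)).
have spanL : span_near p (fun mu => family1 p mu \/ family2 p mu \/ family3 mu)
    (fun i j => \sum_(t <- L) t.1 * tri t.2 i j).
  elim: L {E} => [|t L IHL].
    apply: span_near_eq (span_near0 p _).
    by near=> j => i; rewrite big_nil.
  have [mu [fam3 muE]] := family3_of_kg t.2.1 t.2.2 np.
  apply: span_near_eq (span_near_cons t.1 (or_intror (or_intror fam3)) muE IHL).
  by near=> j => i; rewrite big_cons.
(* F and f already collect all contributions of families 1 and 2, so each of these enters with one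
   member and coefficient 1. *)
have span := span_near_cons 1 (or_introl fam1) mu1E
  (span_near_cons 1 (or_intror (or_introl fam2)) mu2E spanL).
apply: span_near_eq span.
have cPhi : Phi @ p --> c by apply: smooth_continuous => v; exact: smooth_Phi.
have nB : \forall j \near p, box c s e (Phi j).
  exact: (cPhi _ (nbhs_boxW c s e0)).
have nw0 := near_neq0 (smooth_omega 1 p) w0.
have nr := near_jet_regular np.
near=> j => i.
have Bj : box c s e (Phi j) by near: j.
have nj : jet_regular j by near: j.
have wj : omega 1 j != 0 by near: j.
have hj := half_gap_neq0 j.
have gE : gap j = half_gap j ^+ 2 by rewrite half_gap_sq.
have [gA _ bE aE] := E _ Bj.
have [aj bj hjE] : [/\ lam i1 j = half_gap j * a (Phi j), lam i2 j = half_gap j * b (Phi j) &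
    lam i3 j = half_gap j ^+ 2 * h (Phi j)].
  rewrite /a /b /h PsiK // Ek_Phi.
  by split; field; exact: hj.
(* This is where omega^1 != 0 is used: h is recovered from omega^1 h = A F. *)
have hE : h (Phi j) = vf (@Ya R) F (Phi j) / omega 1 j.
  by rewrite -gA mulrC mulKf.
have S1 : \sum_(t <- L) t.1 * tri t.2 i1 j =
    - (half_gap j * \sum_(t <- L) t.1 * vf (@Yy R) (boost t.2.1 t.2.2) (Phi j)).
  by rewrite mulr_sumr -sumrN; apply: eq_bigr => t _; rewrite mulrCA mulrN mulrN.
have S2 : \sum_(t <- L) t.1 * tri t.2 i2 j =
    half_gap j * \sum_(t <- L) t.1 * boost t.2.1 t.2.2 (Phi j).
  by rewrite mulr_sumr; apply: eq_bigr => t _; rewrite mulrCA.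
have S3 : \sum_(t <- L) t.1 * tri t.2 i3 j = 0.
  by rewrite big1 // => t _; exact: mulr0.
have iE : [\/ i = i1, i = i2 | i = i3].
  by case: i => [[|[|[|//]]] ?]; [constructor 1|constructor 2|constructor 3]; exact/val_inj.
case: iE => ->.
- rewrite S1 aj aE Ek_Phi /triple !(tnth_nth (cst 0)) /= gE; ring.
- rewrite S2 bj bE Ek_Phi /triple !(tnth_nth (cst 0)) /= gE; ring.
- by rewrite S3 hjE hE /triple !(tnth_nth (cst 0)) /= gE mul1r mulr0 !addr0.
Unshelve. all: by end_near. Qed.

Theorem theorem13 (R : realType) (p : {ptws jetvar -> R}) (hp : regular p)
    (lam : 'I_3 -> {ptws jetvar -> R} -> R) :
  reduced_cosymmetry p lam <->
  span_near p (fun mu => family1 p mu \/ family2 p mu \/ family3 mu) lam.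
Proof.
split; first exact: cosymmetry_spanned.
apply: span_near_reduced => mu [|[]].
- exact: family1_reduced.
- exact: family2_reduced.
- exact: family3_reduced.
Qed.
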